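(* Let $Q = (\mathcal{I}, E)$ be a quiver, $\mathbf{v} \in \mathbb{Z}^{\mathcal{I}}_{\geq 0}$ a dimension vector, $\mathrm{Rep}(Q, \mathbf{v})$ the associated representation space with moment map $\Phi$ for the standard action of $G=\prod_{\ell}U(V_\ell)$, and $\alpha=(\alpha_\ell)_{\ell\in\mathcal{I}}\in(i\mathbb{R})^{\mathcal{I}}$ a central parameter. Let $A_0 \in \mathrm{Rep}(Q, \mathbf{v})$, and let $A_\infty$ be the limit of $A_0$ under the negative gradient flow of $\| \Phi - \alpha \|^2$. Then $A_\infty$ is isomorphic (as a representation of $Q$) to the graded object of the Harder-Narasimhan-Jordan-Hölder filtration of $A_0$ (with respect to $\alpha$).
   Context: A quiver $Q=(\mathcal{I},E)$ is a finite oriented graph; $\mathrm{out}(a),\mathrm{in}(a)$ are the tail and head of $a\in E$. $V_\ell$ are hermitian vector spaces with $\dim_{\mathbb{C}}V_\ell=v_\ell$; $\mathrm{Rep}(Q,\mathbf{v})=\bigoplus_{a\in E}\mathrm{Hom}(V_{\mathrm{out}(a)},V_{\mathrm{in}(a)})$ with its standard hermitian structure. $G$ acts by $(g_\ell)\cdot(A_a)=(g_{\mathrm{in}(a)}A_ag_{\mathrm{out}(a)}^* )$; $\mathfrak{g}=\prod_\ell\mathfrak{u}(V_\ell)$ has inner product $\langle u,v\rangle=\mathrm{tr}(u^*v)$; $\Phi(A)=\frac{i}{2}\sum_{a}[A_a,A_a^*]\in\mathfrak{g}$ (with $A_aA_a^*$ an endomorphism of $V_{\mathrm{in}(a)}$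 and $A_a^*A_a$ of $V_{\mathrm{out}(a)}$). $\alpha$ is identified with $(\alpha_\ell\,\mathrm{id}_{V_\ell})_\ell\in Z(\mathfrak{g})$, and it is always assumed that $\sum_\ell\alpha_\ell v_\ell=0$. The negative gradient flow of $\|\Phi-\alpha\|^2$ exists for all $t\ge0$ and converges to a critical point from every initial condition. For a nonzero dimension vector $\mathbf{w}$, the slope is $\mu_\alpha(Q,\mathbf{w})=\left(\sum_\ell i\alpha_\ell w_\ell\right)/\left(\sum_\ell w_\ell\right)$. A subrepresentation is a collection of subspaces $V'_\ell\subseteq V_\ell$ preserved by all $A_a$, with restricted maps. A representation is $\alpha$-stable (resp. $\alpha$-semistable) if every nonzero proper subrepresentation has slope $<$ (resp. $\le$) that of the representation. The Harder-Narasimhan filtration of $A$ is the filtration $0=A_0\subsetneq A_1\subsetneq\cdots\subsetneq A_L=A$ by subrepresentations such that each $A_j/A_{j-1}$ is the nonzero subrepresentation of $A/A_{j-1}$ of maximal slope and, among those, maximal rank (total dimension). A Jordan-Hölder filtration of an $\alpha$-semistable representation $B$ is a filtration $0=B_0\subset B_1\subset\cdots\subset B_m=B$ by subrepresentations whose successive quotients are $\alpha$-stable of the same $\alpha$-slope as $B$. A Harder-Narasimhan-Jordan-Hölder (H-N-J-H) filtration of $A$ is the double filtration obtained by refining the Harder-Narasimhan filtration by a Jordan-Hölder filtration of each ($\alpha$-semistable) successive quotient; its graded object is the direct sum of all the resulting successive ($\alpha$-stable) quotients, a representation of $Q$ of dimension vector $\mathbf{v}$ well defined up to isomorphism. *)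

(* Defs.v *)
From HB Require Import structures.
From mathcomp Require Import all_boot all_order all_algebra.
From mathcomp Require Import complex.
From mathcomp Require Import all_classical all_reals all_analysis.

Set Implicit Arguments.
Unset Strict Implicit.
Unset Printing Implicit Defensive.

Import Order.TTheory GRing.Theory Num.Theory.
Import numFieldNormedType.Exports.

Local Open Scope classical_set_scope.
Local Open Scope ring_scope.
Local Open Scope complex_scope.

Record quiver := Quiver {
  vertex : finType;
  arrow : finType;
  src : arrow -> vertex;
  tgt : arrow -> vertex }.

Section Representations.
Variables (K : fieldType) (Q : quiver).

Record qrep := QRep {
  rspace : vertex Q -> vectType K;
  arrow_map : forall a : arrow Q, 'Hom(rspace (src a), rspace (tgt a)) }.

Definition dimvec (M : qrep) (l : vertex Q) : nat := \dim {: rspace M l}.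

Definition isomorphic (M N : qrep) : Prop :=
  exists f : forall l, 'Hom(rspace M l, rspace N l),
    (forall l, bijective (f l)) /\
    (forall a x, f (tgt a) (arrow_map M a x) = arrow_map N a (f (src a) x)).

Definition subfamily (M : qrep) := forall l, {vspace rspace M l}.

Definition is_subrepr (M : qrep) (U : subfamily M) : Prop :=
  forall a, (arrow_map M a @: U (src a) <= U (tgt a))%VS.

Definition sub_le (M : qrep) (U W : subfamily M) : Prop :=
  forall l, (U l <= W l)%VS.

Definition sub_lt (M : qrep) (U W : subfamily M) : Prop :=
  sub_le U W /\ ~ sub_le W U.

Definition sub_zero (M : qrep) : subfamily M := fun l => 0%VS.
Definition sub_full (M : qrep) : subfamily M := fun l => fullv.

(* The restriction of the maps of M to U; [vsproj] only serves to land in the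
   subtype, and is the identity there when U is a subrepresentation. *)
Definition subr (M : qrep) (U : subfamily M) : qrep :=
  QRep (rspace := fun l => subvs_of (U l))
    (fun a => (linfun (vsproj (U (tgt a))) \o arrow_map M a
               \o linfun (@vsval _ _ (U (src a))))%VF).

(* The quotient M / U. The library has no quotient of vector spaces, so the
   quotient of M l by U l is realised on the complement (U l)^C, and the
   canonical projection is the linear projection onto (U l)^C along U l:
   see [quot_proj_surj], [quot_proj_ker] and [quot_projE] below. *)
Definition quot_proj (M : qrep) (U : subfamily M) (l : vertex Q) :
    'Hom(rspace M l, subvs_of (U l)^C) :=
  (linfun (vsproj (U l)^C) \o daddv_pi (U l)^C (U l))%VF.

Definition quot (M : qrep) (U : subfamily M) : qrep :=
  QRep (rspace := fun l => subvs_of (U l)^C)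
    (fun a => (quot_proj U (tgt a) \o arrow_map M a
               \o linfun (@vsval _ _ (U (src a))^C))%VF).

(* W / U as a family of subspaces of M / U *)
Definition quot_sub (M : qrep) (U W : subfamily M) : subfamily (quot U) :=
  fun l => (quot_proj U l @: W l)%VS.

(* W / U as a representation, for subrepresentations U <= W of M *)
Definition subquot (M : qrep) (U W : subfamily M) : qrep :=
  subr (quot_sub U W).

Definition qrep0 : qrep :=
  QRep (rspace := fun _ => 'cV[K]_0) (fun a => 0).

Definition pair_map (V1 V2 W1 W2 : vectType K) (f : 'Hom(V1, W1))
    (g : 'Hom(V2, W2)) (x : V1 * V2) : W1 * W2 := (f x.1, g x.2).

Fact pair_map_linear (V1 V2 W1 W2 : vectType K) (f : 'Hom(V1, W1))
  (g : 'Hom(V2, W2)) : linear (pair_map f g).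
Proof. by move=> c x y; rewrite /pair_map /= !linearP. Qed.

HB.instance Definition _ (V1 V2 W1 W2 : vectType K) (f : 'Hom(V1, W1))
    (g : 'Hom(V2, W2)) :=
  GRing.isLinear.Build K (V1 * V2)%type (W1 * W2)%type _ (pair_map f g)
    (pair_map_linear f g).

Definition dsum2 (M N : qrep) : qrep :=
  QRep (rspace := fun l => (rspace M l * rspace N l)%type)
    (fun a => linfun (pair_map (arrow_map M a) (arrow_map N a))).

Definition dsum (s : seq qrep) : qrep := foldr dsum2 qrep0 s.

(* 0 = F 0 <= F 1 <= ... <= F L = M; the values F j for j > L are irrelevant. *)
Definition is_filtration (M : qrep) (L : nat) (F : nat -> subfamily M) : Prop :=
  [/\ forall l, F 0%N l = sub_zero M l,
      forall l, F L l = sub_full M l,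
      forall j, (j <= L)%N -> is_subrepr (F j)
    & forall j, (j < L)%N -> sub_le (F j) (F j.+1)].

Definition pieces (M : qrep) (L : nat) (F : nat -> subfamily M) : seq qrep :=
  [seq subquot (F j) (F j.+1) | j <- iota 0 L].

Lemma quot_projEval (M : qrep) (U : subfamily M) l x :
  vsval (quot_proj U l x) = daddv_pi (U l)^C (U l) x.
Proof. by rewrite comp_lfunE lfunE /= vsprojK // memv_pi. Qed.

Lemma capv_complC (M : qrep) (U : subfamily M) l : ((U l)^C :&: U l = 0)%VS.
Proof. by rewrite capvC capv_compl. Qed.

Lemma quot_proj_surj (M : qrep) (U : subfamily M) l :
  limg (quot_proj U l) = fullv.
Proof.
apply/vspaceP => y; rewrite memvf; apply/memv_imgP; exists (vsval y) => //.
  exact: memvf.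
by apply: (can_inj vsvalK); rewrite quot_projEval
  daddv_pi_id ?capv_complC ?subvsP.
Qed.

Lemma quot_proj_ker (M : qrep) (U : subfamily M) l :
  lker (quot_proj U l) = U l.
Proof.
have dec x : daddv_pi (U l)^C (U l) x + daddv_pi (U l) (U l)^C x = x.
  by apply: daddv_pi_add; rewrite ?capv_complC // addvC addv_complf memvf.
apply/vspaceP => x; rewrite memv_ker; apply/eqP/idP => [/(congr1 vsval)|Ux].
  by rewrite quot_projEval linear0 => p0; rewrite -[x]dec p0 add0r memv_pi.
apply: (can_inj vsvalK); rewrite quot_projEval; apply: (addIr x).
by rewrite add0r -{2}[x](daddv_pi_id (capv_compl _) Ux) dec.
Qed.

Lemma quot_projE (M : qrep) (U : subfamily M) : is_subrepr U ->
  forall a x, arrow_map (quot U) a (quot_proj U (src a) x) =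
              quot_proj U (tgt a) (arrow_map M a x).
Proof.
move=> sU a x; rewrite /= 2!comp_lfunE.
rewrite [X in arrow_map M a X]lfunE /= quot_projEval.
set p := daddv_pi _ _ x.
have Up : p - x \in U (src a).
  rewrite -(quot_proj_ker U) memv_ker linearB subr_eq0.
  apply/eqP/(can_inj vsvalK); rewrite !quot_projEval.
  by rewrite daddv_pi_proj // capv_complC.
have : arrow_map M a p - arrow_map M a x \in lker (quot_proj U (tgt a)).
  by rewrite quot_proj_ker -linearB; apply/(subvP (sU a))/memv_img.
by rewrite memv_ker linearB subr_eq0 => /eqP.
Qed.

Lemma subrE (M : qrep) (U : subfamily M) : is_subrepr U ->
  forall a x, vsval (arrow_map (subr U) a x) = arrow_map M a (vsval x).
Proof.
move=> sU a x; rewrite /= !comp_lfunE !lfunE /= vsprojK //.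
exact/(subvP (sU a))/memv_img/subvsP.
Qed.

End Representations.

Section Stability.
Variables (R : realType) (Q : quiver) (alpha : vertex Q -> R[i]).
Local Notation qrep := (qrep R[i] Q).

(* Real when alpha is imaginary; only meaningful for w nonzero. On R[i],
   x <= y means that x and y have the same imaginary part and Re x <= Re y. *)
Definition slope (w : vertex Q -> nat) : R[i] :=
  (\sum_l 'i * alpha l * (w l)%:R) / (\sum_l (w l)%:R).

Definition rank (w : vertex Q -> nat) : nat := (\sum_l w l)%N.

Definition subdim (M : qrep) (U : subfamily M) (l : vertex Q) : nat :=
  \dim (U l).

Definition sub_nonzero (M : qrep) (U : subfamily M) : Prop :=
  sub_lt (sub_zero M) U.

Definition sub_proper (M : qrep) (U : subfamily M) : Prop :=
  sub_lt U (sub_full M).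

(* The zero representation, which has no slope, is not stable. *)
Definition stable (M : qrep) : Prop :=
  (0 < rank (dimvec M))%N /\
  forall U : subfamily M, is_subrepr U -> sub_nonzero U -> sub_proper U ->
    slope (subdim U) < slope (dimvec M).

Definition semistable (M : qrep) : Prop :=
  forall U : subfamily M, is_subrepr U -> sub_nonzero U -> sub_proper U ->
    slope (subdim U) <= slope (dimvec M).

Definition max_destabilizing (M : qrep) (U : subfamily M) : Prop :=
  [/\ is_subrepr U, sub_nonzero U
    & forall W : subfamily M, is_subrepr W -> sub_nonzero W ->
        slope (subdim W) <= slope (subdim U) /\
        (slope (subdim W) = slope (subdim U) ->
         (rank (subdim W) <= rank (subdim U))%N)].

Definition is_HN (M : qrep) (L : nat) (F : nat -> subfamily M) : Prop :=
  [/\ is_filtration L F,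
      forall j, (j < L)%N -> sub_lt (F j) (F j.+1)
    & forall j, (j < L)%N -> max_destabilizing (quot_sub (F j) (F j.+1))].

Definition is_JH (M : qrep) (m : nat) (G : nat -> subfamily M) : Prop :=
  [/\ semistable M, is_filtration m G
    & forall k, (k < m)%N ->
        stable (subquot (G k) (G k.+1)) /\
        slope (dimvec (subquot (G k) (G k.+1))) = slope (dimvec M)].

Record HNJH (M : qrep) := {
  HN_length : nat;
  HN_step : nat -> subfamily M;
  HN_axiom : is_HN HN_length HN_step;
  JH_length : nat -> nat;
  JH_step : forall j, nat -> subfamily (subquot (HN_step j) (HN_step j.+1));
  JH_axiom : forall j, (j < HN_length)%N -> is_JH (JH_length j) (JH_step j) }.

Definition graded (M : qrep) (H : HNJH M) : qrep :=
  dsum (flatten [seq pieces (JH_length H j) (JH_step H j)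
                | j <- iota 0 (HN_length H)]).

End Stability.

Section GradientFlow.
Variables (R : realType) (Q : quiver) (v : vertex Q -> nat).
Local Notation C := R[i].

(* V_l is C^(v l) with its standard hermitian structure; matrices act on column
   vectors. *)
Definition Rep := forall a : arrow Q, 'M[C]_(v (tgt a), v (src a)).

Definition qrep_of (A : Rep) : qrep C Q :=
  QRep (rspace := fun l => 'cV[C]_(v l)) (fun a => linfun (mulmx (A a))).

Definition adj m n (M : 'M[C]_(m, n)) : 'M[C]_(n, m) :=
  map_mx (@Num.conj C) M^T.

Definition Rep_inner (A B : Rep) : R :=
  complex.Re (\sum_a \tr (adj (A a) *m B a)).

(* The component at l of (i/2) sum_a [A_a, A_a^*]. As tgt a = l (resp.
   src a = l), [conform_mx 0] is a transport along v (tgt a) = v l (resp.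
   v (src a) = v l). *)
Definition moment (A : Rep) (l : vertex Q) : 'M[C]_(v l) :=
  ('i / 2%:R) *:
  (\sum_(a | tgt a == l) conform_mx 0 (A a *m adj (A a))
   - \sum_(a | src a == l) conform_mx 0 (adj (A a) *m A a)).

(* ||Phi - alpha||^2 *)
Definition energy (alpha : vertex Q -> C) (A : Rep) : R :=
  complex.Re (\sum_l \tr (adj (moment A l - (alpha l)%:M)
                          *m (moment A l - (alpha l)%:M))).

Definition Rep_shift (A : Rep) (s : R) (B : Rep) : Rep :=
  fun a => A a + s%:C *: B a.

(* X is the gradient of f at A for the Riemannian metric [Rep_inner]. The
   energy being polynomial in the real coordinates, its differential is
   determined by its directional derivatives. *)
Definition is_gradient (f : Rep -> R) (A X : Rep) : Prop :=
  forall B : Rep,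
    is_derive (0 : R) 1 (fun s => f (Rep_shift A s B)) (Rep_inner X B).

Definition Rep_cvg (A : R -> Rep) (F : set_system R) (B : Rep) : Prop :=
  forall a i j,
    ((complex.Re (A t a i j)) @[t --> F] --> complex.Re (B a i j)) /\
    ((complex.Im (A t a i j)) @[t --> F] --> complex.Im (B a i j)).

Definition Rep_derive (A : R -> Rep) (t : R) (X : Rep) : Prop :=
  forall a i j,
    is_derive t 1 (fun s => complex.Re (A s a i j)) (complex.Re (X a i j)) /\
    is_derive t 1 (fun s => complex.Im (A s a i j)) (complex.Im (X a i j)).

(* A solution on [0, +oo) of A' = - grad f (A), A 0 = A0; the values of A at
   negative times are irrelevant. *)
Definition is_gradient_flow (f : Rep -> R) (A0 : Rep) (A : R -> Rep) : Prop :=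
  [/\ A 0 = A0,
      Rep_cvg A (0 : R)^'+ A0
    & forall t : R, 0 < t ->
        exists2 X, is_gradient f (A t) X & Rep_derive A t (fun a => - X a)].

Definition is_flow_limit (f : Rep -> R) (A0 Ainf : Rep) : Prop :=
  exists2 A : R -> Rep, is_gradient_flow f A0 A & Rep_cvg A +oo Ainf.

End GradientFlow.

(* Main.v *)
From HB Require Import structures.
Require Import Defs.
From mathcomp Require Import all_boot all_order all_algebra.
From mathcomp Require Import complex.
From mathcomp Require Import all_classical all_reals all_analysis.
From mathcomp Require Import ring lra zify.

(** Write H(A) = i (Phi(A) - alpha), a family of hermitian matrices. The gradient
    flow is A' = 2 (H A - A H), so that A(t) g(t) = g(t) A0 for the solution of
    g' = 2 H(A) g with g(0) = 1 ([transport]): the flow stays in the isomorphism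
    class of A0, and Ainf lies in its closure. As A(t) and A'(t) both converge,
    A'(t) tends to 0, and H(Ainf) commutes with Ainf ([limit_critical]).

    The limit is a direct sum of stable representations. If P is the orthogonal
    projection onto a subrepresentation of A, then
    tr (P H) = - |P A - A P|^2 / 2 - deg ([trace_formula]). On a minimal
    orthogonal summand of Ainf, H is a scalar, since its eigenspaces are
    summands. By the formula this scalar is minus the slope, and every proper
    nonzero subrepresentation has smaller slope: equal slopes would give
    P A = A P and split the summand. Hence Ainf is an orthogonal sum of stable
    pieces on each of which H is minus the slope ([decompose]).

    It remains to identify these pieces with those of A0. Their slopes are
    compared through [posexcess], the sum over the pieces of
    max (deg - lam rank, 0): for each lam it is at most as large for Ainf as for
    A0. Indeed, the vectors x for which exp (2 lam' t) g(t) x stays bounded,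
    with lam' slightly below lam, form a subrepresentation of A0, since A(t)
    is bounded. As H(A(t)) tends to H(Ainf), an exponential dichotomy
    ([dichotomy]) shows that its dimension vector is that of the part of Ainf
    of slope at least lam ([slow_subrepr]). The posexcess of Ainf is thus
    deg - lam rank of a subrepresentation of A0, and this is at most the
    posexcess of the pieces of A0, because subrepresentations of a filtered
    representation are filtered by subrepresentations of its stable pieces
    ([filtered_excess]).

    Finally one inducts along the Harder-Narasimhan-Jordan-Holder filtration
    ([degenerates_graded]). Let S be its first piece, which has the largest
    slope. The inclusions of S in A(t), normalised, have a nonzero limit
    S -> Ainf along an ultrafilter, and hence a nonzero component S -> X in one
    of the stable pieces of Ainf. The inequality at lam = slope S says that no
    piece of Ainf has slope above that of S, so that S -> X is an isomorphism.
    Thus S splits off Ainf, and because the limit of the inclusions is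
    injective, the quotients A(t) / S converge to what remains
    ([degenerates_step]). The inequality persists, and the argument applies to
    A0 / S. *)

Set Implicit Arguments.
Unset Strict Implicit.
Unset Printing Implicit Defensive.

Import Order.TTheory GRing.Theory Num.Theory.
Import numFieldNormedType.Exports.

Local Open Scope classical_set_scope.
Local Open Scope ring_scope.
Local Open Scope complex_scope.

Local Notation Re := (@complex.Re _).
Local Notation Im := (@complex.Im _).

(** * Homomorphisms, exact sequences and filtrations *)

Lemma dep_choice (I : Type) (T : I -> Type) (P : forall i, T i -> Prop) :
  (forall i, exists x, P i x) -> exists f : forall i, T i, forall i, P i (f i).
Proof.
by move=> h; exists (fun i => sval (cid (h i))) => i; exact: svalP (cid (h i)).
Qed.

Section Hom.
Variables (K : fieldType) (Q : quiver).
Implicit Types M N P : qrep K Q.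

Definition famhom M N := forall l, 'Hom(rspace M l, rspace N l).

Definition is_hom M N (f : famhom M N) : Prop :=
  forall a x, f (tgt a) (arrow_map M a x) = arrow_map N a (f (src a) x).

Definition idh M : famhom M M := fun l => \1%VF.
Definition comph M N P (g : famhom N P) (f : famhom M N) : famhom M P :=
  fun l => (g l \o f l)%VF.

Lemma comphE M N P (g : famhom N P) (f : famhom M N) l x :
  comph g f l x = g l (f l x).
Proof. by rewrite /comph comp_lfunE. Qed.

Lemma hom_comp M N P (g : famhom N P) (f : famhom M N) :
  is_hom g -> is_hom f -> is_hom (comph g f).
Proof. by move=> hg hf a x; rewrite !comphE hf hg. Qed.

Lemma iso_refl M : isomorphic M M.
Proof.
exists (@idh M); split=> [l|a x]; last by rewrite /idh !lfunE.
by exists id => x; rewrite /idh ?lfunE.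
Qed.

Lemma iso_trans N M P : isomorphic M N -> isomorphic N P -> isomorphic M P.
Proof.
move=> [f [fb fh]] [g [gb gh]]; exists (comph g f); split; last exact: hom_comp.
by move=> l; apply: (eq_bij (bij_comp (gb l) (fb l))) => x; rewrite comphE.
Qed.

Lemma lfun_inv (V W : vectType K) (f : 'Hom(V, W)) :
  injective f -> (forall y, exists x, f x = y) ->
  exists g : 'Hom(W, V), cancel f g /\ cancel g f.
Proof.
move=> fi fs; have kf : lker f == 0%VS by apply/lker0P.
exists (f^-1)%VF; split => [x|y]; first exact: lker0_lfunK.
by have [x <-] := fs y; rewrite lker0_lfunK.
Qed.

Lemma iso_inv M N : isomorphic M N ->
  exists (f : famhom M N) (g : famhom N M),
    [/\ is_hom f, is_hom g, forall l, cancel (f l) (g l)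
      & forall l, cancel (g l) (f l)].
Proof.
move=> [f [fb fh]].
have /dep_choice [g gP] : forall l, exists g : 'Hom(rspace N l, rspace M l),
    cancel (f l) g /\ cancel g (f l).
  move=> l; apply: lfun_inv; first exact: bij_inj.
  by move=> y; have [h h1 h2] := fb l; exists (h y).
exists f, g; split=> // [a y|l|l]; try by have [] := gP l.
apply: (can_inj (gP _).1); rewrite (gP _).2 fh (gP _).2 //.
Qed.

Lemma iso_sym M N : isomorphic M N -> isomorphic N M.
Proof.
move=> /iso_inv [f [g [_ gh fg gf]]]; exists g; split=> // l.
by exists (f l).
Qed.

Lemma inj_surj_iso M N (f : famhom M N) : is_hom f ->
  (forall l, injective (f l)) -> (forall l y, exists x, f l x = y) ->
  isomorphic M N.
Proof.
move=> fh fi fs; exists f; split=> // l.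
by have [g [h1 h2]] := lfun_inv (fi l) (fs l); exists g.
Qed.

Definition surj_fam M N (f : famhom M N) : Prop :=
  forall l y, exists x, f l x = y.
Definition inj_fam M N (f : famhom M N) : Prop := forall l, injective (f l).

(** The short exact sequences 0 -> M1 -> M -> M2 -> 0. Subrepresentations and
    quotients are handled through these rather than through [subr] and [quot]
    themselves, so that they can be transported along isomorphisms freely. *)
Definition exact M1 M M2 (f : famhom M1 M) (g : famhom M M2) : Prop :=
  [/\ is_hom f, is_hom g, inj_fam f, surj_fam g
    & forall l x, g l x = 0 <-> exists y, x = f l y].

Lemma injfam0 M N (f : famhom M N) :
  (forall l x, f l x = 0 -> x = 0) -> inj_fam f.
Proof.
move=> f0 l x y /eqP; rewrite -subr_eq0 -linearB => /eqP/f0/eqP.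
by rewrite subr_eq0 => /eqP.
Qed.

(** The first isomorphism theorem: two surjections with the same kernel have
    isomorphic targets. Every identification of a quotient below comes from
    it. *)
Lemma coker_unique M N P (g : famhom M N) (h : famhom M P) :
  is_hom g -> is_hom h -> surj_fam g -> surj_fam h ->
  (forall l x, g l x = 0 <-> h l x = 0) -> isomorphic N P.
Proof.
move=> gh hh gs hs gk.
have fE l y : g l ((g l)^-1%VF y) = y.
  by rewrite limg_lfunVK //; have [x <-] := gs l y; apply/memv_img/memvf.
pose k : famhom N P := fun l => (h l \o (g l)^-1)%VF.
have kE l x : k l (g l x) = h l x.
  rewrite /k comp_lfunE; apply/eqP; rewrite -subr_eq0 -linearB.
  by apply/eqP/gk; rewrite linearB /= fE subrr.
apply: (@inj_surj_iso _ _ k).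
- move=> a y; have [x <-] := gs _ y.
  by rewrite -gh !kE hh.
- apply: injfam0 => l y; have [x <-] := gs _ y.
  by rewrite kE => /gk.
- by move=> l y; have [x <-] := hs l y; exists (g l x); rewrite kE.
Qed.

Lemma iso_dim M N : isomorphic M N -> forall l, dimvec M l = dimvec N l.
Proof.
move=> /iso_inv [f [g [_ _ fK gK]]] l; rewrite /dimvec.
have -> : \dim {: rspace M l} = \dim (f l @: fullv)%VS.
  rewrite limg_dim_eq //; have /eqP -> : lker (f l) == 0%VS.
    by apply/lker0P/(can_inj (fK l)).
  by rewrite capv0.
congr (\dim _); apply/vspaceP => y; rewrite memvf.
by rewrite -[y]gK; apply/memv_img/memvf.
Qed.

Lemma dim0P M l : dimvec M l = 0%N -> forall x : rspace M l, x = 0.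
Proof.
move=> /eqP; rewrite /dimvec dimv_eq0 => /eqP d0 x.
by apply/eqP; rewrite -memv0 -d0 memvf.
Qed.

Lemma iso_dim0 M N : (forall l, dimvec M l = 0%N) ->
  (forall l, dimvec N l = 0%N) -> isomorphic M N.
Proof.
move=> M0 N0; apply: (@inj_surj_iso _ _ (fun l => 0)).
- by move=> a x; rewrite !lfunE /= linear0.
- by apply: injfam0 => l x _; apply: dim0P.
- by move=> l y; exists 0; rewrite linear0; apply/esym/dim0P.
Qed.

Definition quotp M (U : subfamily M) : famhom M (quot U) := @quot_proj _ _ M U.

Lemma quotp_hom M (U : subfamily M) : is_subrepr U -> is_hom (quotp U).
Proof. by move=> Us a x; rewrite /quotp quot_projE. Qed.

Lemma quotp_surj M (U : subfamily M) : surj_fam (quotp U).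
Proof.
move=> l y; have : y \in limg (quot_proj U l) by rewrite quot_proj_surj memvf.
by move=> /memv_imgP [x _ ->]; exists x.
Qed.

Lemma quotp_eq0 M (U : subfamily M) l x : quotp U l x = 0 <-> x \in U l.
Proof.
rewrite -[in X in _ <-> X](quot_proj_ker U) memv_ker.
by split=> [|/eqP //]; rewrite /quotp => ->.
Qed.

End Hom.

Definition mkpair (K : fieldType) (V W1 W2 : vectType K) (f : 'Hom(V, W1))
    (g : 'Hom(V, W2)) (x : V) : W1 * W2 := (f x, g x).

Fact mkpair_linear (K : fieldType) (V W1 W2 : vectType K) (f : 'Hom(V, W1))
  (g : 'Hom(V, W2)) : linear (mkpair f g).
Proof. by move=> c x y; rewrite /mkpair !linearP. Qed.

HB.instance Definition _ (K : fieldType) (V W1 W2 : vectType K)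
    (f : 'Hom(V, W1)) (g : 'Hom(V, W2)) :=
  GRing.isLinear.Build K V (W1 * W2)%type _ (mkpair f g) (mkpair_linear f g).

Section DirectSum.
Variables (K : fieldType) (Q : quiver).
Implicit Types M N P X Y : qrep K Q.

Lemma dsum2_map M N a x :
  arrow_map (dsum2 M N) a x = (arrow_map M a x.1, arrow_map N a x.2).
Proof. by rewrite /= lfunE. Qed.

(** A pair of maps that jointly is a bijection at each vertex splits M; this
    avoids having to give the two inclusions. *)
Lemma iso_dsum2 M X Y (p : famhom M X) (q : famhom M Y) :
  is_hom p -> is_hom q ->
  (forall l z, p l z = 0 -> q l z = 0 -> z = 0) ->
  (forall l x y, exists z, p l z = x /\ q l z = y) ->
  isomorphic M (dsum2 X Y).
Proof.
move=> ph qh pqi pqs.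
pose f : famhom M (dsum2 X Y) := fun l => linfun (mkpair (p l) (q l)).
have fE l z : f l z = (p l z, q l z) by rewrite /f lfunE.
apply: (@inj_surj_iso _ _ _ _ f).
- by move=> a z; rewrite !fE dsum2_map /= ph qh.
- by apply: injfam0 => l z; rewrite fE => -[/pqi h /h].
- by move=> l [x y]; have [z [<- <-]] := pqs l x y; exists z; rewrite fE.
Qed.

Definition fst_fam M N : famhom (dsum2 M N) M :=
  fun l => linfun (fun z : rspace M l * rspace N l => z.1).
Definition snd_fam M N : famhom (dsum2 M N) N :=
  fun l => linfun (fun z : rspace M l * rspace N l => z.2).

Lemma fst_famE M N l z : fst_fam M N l z = z.1. Proof. by rewrite lfunE. Qed.
Lemma snd_famE M N l z : snd_fam M N l z = z.2. Proof. by rewrite lfunE. Qed.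

Lemma fst_hom M N : is_hom (@fst_fam M N).
Proof. by move=> a z; rewrite !fst_famE dsum2_map. Qed.
Lemma snd_hom M N : is_hom (@snd_fam M N).
Proof. by move=> a z; rewrite !snd_famE dsum2_map. Qed.

Lemma dsum2_iso M N M' N' : isomorphic M M' -> isomorphic N N' ->
  isomorphic (dsum2 M N) (dsum2 M' N').
Proof.
move=> /iso_inv [f [f' [fh _ fK fK']]] /iso_inv [g [g' [gh _ gK gK']]].
apply: (@iso_dsum2 _ _ _ (comph f (@fst_fam M N)) (comph g (@snd_fam M N))).
- exact: hom_comp fh (@fst_hom _ _).
- exact: hom_comp gh (@snd_hom _ _).
- move=> l [x y]; rewrite !comphE fst_famE snd_famE /= => fx gy.
  by rewrite -[x]fK -[y]gK fx gy !linear0.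
- move=> l x y; exists (f' l x, g' l y).
  by rewrite !comphE fst_famE snd_famE /= fK' gK'.
Qed.

Definition nonzero_fam M N (f : famhom M N) : Prop := exists l x, f l x <> 0.

(** Besides the component X that phi meets, the projection q onto the other
    terms is needed, to split X off later. *)
Lemma dsum_component (e : seq (qrep K Q)) S (phi : famhom S (dsum e)) :
  is_hom phi -> nonzero_fam phi ->
  exists e1 X e2 (p : famhom (dsum e) X) (q : famhom (dsum e) (dsum (e1 ++ e2))),
    [/\ e = e1 ++ X :: e2, is_hom p, is_hom q, nonzero_fam (comph p phi) &
       (forall l z, p l z = 0 -> q l z = 0 -> z = 0) /\
       (forall l x y, exists z, p l z = x /\ q l z = y)].
Proof.
elim: e phi => [|X e IHe] /= phi ph [l [x nz]].
  by case: nz; apply/matrixP => -[].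
have [p0|p0] := pselect (nonzero_fam (comph (@fst_fam X (dsum e)) phi)).
  exists [::], X, e, (@fst_fam X (dsum e)), (@snd_fam X (dsum e)).
  split=> //; [exact: fst_hom | exact: snd_hom | split].
    by move=> l' [y z]; rewrite fst_famE snd_famE /= => -> ->.
  by move=> l' y z; exists (y, z); rewrite fst_famE snd_famE.
have [] := IHe (comph (@snd_fam X (dsum e)) phi).
- exact: hom_comp (@snd_hom _ _) ph.
- exists l, x => sx; apply: nz; rewrite [phi l x]surjective_pairing.
  move: sx; rewrite comphE snd_famE => ->; congr (_, _).
  apply: contrapT => fx; apply: p0; exists l, x.
  by rewrite comphE fst_famE.
move=> e1 [Y [e2 [p [q [eE p_h q_h pnz [pqi pqs]]]]]].
subst e.
pose D := dsum (e1 ++ Y :: e2).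
pose q' : famhom (dsum2 X D) (dsum ((X :: e1) ++ e2)) :=
  fun l => linfun (mkpair (@fst_fam X D l) (comph q (@snd_fam X D) l)).
have qE l' z : q' l' z = (z.1, q l' z.2).
  rewrite [LHS](lfunE (mkpair (@fst_fam X D l') (comph q (@snd_fam X D) l'))).
  by rewrite /mkpair -[z.1](fst_famE (M := X) (N := D))
    -[z.2](snd_famE (M := X) (N := D)) -(comphE q (@snd_fam X D)).
have pE l' z : comph p (@snd_fam X D) l' z = p l' z.2.
  by rewrite -[z.2](snd_famE (M := X) (N := D)) -(comphE p (@snd_fam X D)).
exists (X :: e1), Y, e2, (comph p (@snd_fam X D)), q'; split=> //.
- exact: hom_comp p_h (@snd_hom _ _).
- by move=> a z; rewrite !qE (dsum2_map (M := X)) (dsum2_map (M := X)) /= q_h.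
- by have [l' [y h]] := pnz; exists l', y; move: h; rewrite !comphE.
split=> [l' [y z]|l' y [w z]].
  by rewrite qE pE /= => pz [-> qz]; rewrite (pqi _ _ pz qz).
have [u [pu qu]] := pqs l' y z; exists (w, u).
by rewrite qE pE /= pu qu.
Qed.

End DirectSum.

Section Filtered.
Variables (K : fieldType) (Q : quiver).
Implicit Types M N P S : qrep K Q.

(** A filtration read from the bottom: its first piece X is a subrepresentation
    and the rest filters the quotient. This form, unlike nested families of
    subspaces of a fixed M, is invariant under isomorphism and suits the
    induction that removes the first piece. *)
Fixpoint filtered M (s : seq (qrep K Q)) : Prop :=
  if s is X :: s' then
    exists (M' : qrep K Q) (f : famhom X M) (g : famhom M M'),
      exact f g /\ filtered M' s'
  else forall l, dimvec M l = 0%N.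

Lemma filtered_iso M N s : isomorphic M N -> filtered M s -> filtered N s.
Proof.
case: s => [|S s] MN /=; first by move=> M0 l; rewrite -(iso_dim MN).
have [u [w [uh wh uK wK]]] := iso_inv MN.
move=> [M' [f [g [[fh gh fi gs fg] Fs]]]].
exists M', (comph u f), (comph g w); split=> //; split.
- exact: hom_comp.
- exact: hom_comp.
- by move=> l x y; rewrite !comphE => /(can_inj (uK l))/fi.
- by move=> l y; have [x <-] := gs l y; exists (u l x); rewrite comphE uK.
- move=> l x; rewrite comphE; split=> [/fg [y wx]|[y ->]].
    by exists y; rewrite comphE -wx wK.
  by rewrite comphE uK; apply/fg; exists y.
Qed.

(** Concatenation refines a two-step filtration, which is how the
    Jordan-Holder filtrations of the Harder-Narasimhan pieces are assembled.
    If N1 is the first piece of M1, then M1 / N1 -> M / N1 -> M2 is again exact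
    and the induction applies to it. *)
Lemma filtered_cat M1 M M2 (f : famhom M1 M) (g : famhom M M2) s1 s2 :
  exact f g -> filtered M1 s1 -> filtered M2 s2 -> filtered M (s1 ++ s2).
Proof.
move=> fg; elim: s1 M1 M f g fg => [|S s1 IHs] M1 M f g fg.
  have [fh gh fi gs ke] := fg; move=> M10; apply: filtered_iso.
  apply: iso_sym; apply: (@inj_surj_iso _ _ _ _ g) => //.
  apply: injfam0 => l x /ke [y ->].
  by rewrite (dim0P (M10 l) y) linear0.
move=> /= [N1 [h [k [[hh kh hi ks hk] FN]]]] F2.
have [fh gh fi gs ke] := fg.
pose U : subfamily M := fun l => (f l @: (h l @: fullv))%VS.
have Ux l x : reflect (exists y, x = f l (h l y)) (x \in U l).
  apply: (iffP memv_imgP) => [[z /memv_imgP [y _ ->] ->]|[y ->]]; first by exists y.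
  by exists (h l y); rewrite ?memv_img ?memvf.
have Us : is_subrepr U.
  move=> a; apply/subvP => _ /memv_imgP [x /Ux [y ->] ->].
  by apply/Ux; exists (arrow_map S a y); rewrite hh fh.
have qh := quotp_hom Us; have qs := @quotp_surj _ _ M U.
have qk l x : quotp U l x = 0 <-> exists y, x = f l (h l y).
  by split=> [/quotp_eq0/Ux|/Ux/quotp_eq0].
exists (quot U), (comph f h), (quotp U); split.
  split=> //; first exact: hom_comp.
    by move=> l x y; rewrite !comphE => /fi/hi.
  move=> l x; rewrite qk.
  by split=> -[y ->]; exists y; rewrite ?comphE.
(* the induced exact sequence N1 -> M / U -> M2 *)
have /dep_choice [j jP] : forall l, exists j : 'Hom(rspace N1 l, rspace (quot U) l),
   forall x, j (k l x) = quotp U l (f l x).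
  move=> l; exists (quotp U l \o f l \o (k l)^-1)%VF => x.
  rewrite 2!comp_lfunE; apply/eqP; rewrite -subr_eq0 -!linearB.
  have [y] : exists y, (k l)^-1%VF (k l x) - x = h l y.
    apply/hk; rewrite linearB /= limg_lfunVK ?subrr //.
    by apply/memv_img/memvf.
  by move=> ->; apply/eqP/qk; exists y.
have /dep_choice [i iP] : forall l, exists i : 'Hom(rspace (quot U) l, rspace M2 l),
   forall x, i (quotp U l x) = g l x.
  move=> l; exists (g l \o (quotp U l)^-1)%VF => x.
  rewrite comp_lfunE; apply/eqP; rewrite -subr_eq0 -!linearB.
  have [y] : exists y, (quotp U l)^-1%VF (quotp U l x) - x = f l (h l y).
    apply/qk; rewrite linearB /= limg_lfunVK ?subrr //.
    by apply/memv_img/memvf.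
  by move=> ->; apply/eqP/ke; exists (h l y).
apply: (IHs N1 (quot U) j i) => //; split.
- move=> a y; have [x <-] := ks _ y.
  by rewrite -kh !jP fh qh.
- move=> a y; have [x <-] := qs _ y.
  by rewrite -qh !iP gh.
- apply: injfam0 => l y; have [x <-] := ks _ y.
  by rewrite jP => /qk [z /fi ->]; apply/hk; exists z.
- by move=> l y; have [x <-] := gs l y; exists (quotp U l x); rewrite iP.
- move=> l y; have [x <-] := qs _ y; rewrite iP ke.
  split=> [[z ->]|[z zE]]; first by exists (k l z); rewrite jP.
  have [w wE] := ks l z; move: zE; rewrite -wE jP => /eqP.
  rewrite -subr_eq0 -linearB => /eqP/qk [t tE].
  by exists (w + h l t); rewrite linearD /= -tE addrC subrK.
Qed.

End Filtered.

Section SubQuotient.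
Variables (K : fieldType) (Q : quiver).
Implicit Types M N : qrep K Q.

Lemma dimvec_subr M (U : subfamily M) l : dimvec (subr U) l = \dim (U l).
Proof. by rewrite /dimvec dimvf. Qed.

Definition sincl M (U : subfamily M) : famhom (subr U) M :=
  fun l => linfun (@vsval _ _ (U l)).

Lemma sinclE M (U : subfamily M) l x : sincl U l x = vsval x.
Proof. by rewrite lfunE. Qed.

Lemma sub_exact M (U : subfamily M) : is_subrepr U ->
  exact (sincl U) (quotp U).
Proof.
move=> Us; split.
- by move=> a x; rewrite !sinclE subrE.
- exact: quotp_hom.
- by apply: injfam0 => l x; rewrite sinclE => x0; apply: val_inj.
- exact: quotp_surj.
- move=> l x; rewrite quotp_eq0; split=> [Ux|[y ->]].
    by exists (vsproj (U l) x : rspace (subr U) l); rewrite sinclE vsprojK.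
  by rewrite sinclE subvsP.
Qed.

Lemma quot_sub_subrepr M (U W : subfamily M) : is_subrepr U -> is_subrepr W ->
  is_subrepr (quot_sub U W).
Proof.
move=> Us Ws a; apply/subvP => _ /memv_imgP [_ /memv_imgP [x Wx ->] ->].
by rewrite quot_projE //; apply/memv_img/(subvP (Ws a))/memv_img.
Qed.

Lemma mem_quot_sub M (U W : subfamily M) l x : sub_le U W ->
  (quotp U l x \in quot_sub U W l) = (x \in W l).
Proof.
move=> UW; apply/memv_imgP/idP => [[y Wy] /eqP|Wx]; last by exists x.
rewrite -subr_eq0 -linearB => /eqP/quotp_eq0/(subvP (UW l)) h.
by rewrite -[x](subrK y) rpredD.
Qed.

(** The third isomorphism theorem. *)
Lemma quot_quot M (U W : subfamily M) : is_subrepr U -> is_subrepr W ->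
  sub_le U W -> isomorphic (quot W) (quot (quot_sub U W)).
Proof.
move=> Us Ws UW; have Vs := quot_sub_subrepr Us Ws.
apply: (@coker_unique _ _ _ _ _ (quotp W) (comph (quotp (quot_sub U W)) (quotp U))).
- exact: quotp_hom.
- by apply: hom_comp; apply: quotp_hom.
- exact: quotp_surj.
- move=> l y; have [z <-] := quotp_surj y; have [x <-] := quotp_surj z.
  by exists x; rewrite comphE.
- by move=> l x; rewrite comphE !quotp_eq0 mem_quot_sub.
Qed.

(** Induction from the top: M / F j is filtered by the pieces that come after
    step j, because (M / F j) / (F (j+1) / F j) is M / F (j+1). *)
Lemma filtered_of_filtration M (L : nat) (F : nat -> subfamily M)
    (s : nat -> seq (qrep K Q)) : is_filtration L F ->
  (forall j, (j < L)%N -> filtered (subquot (F j) (F j.+1)) (s j)) ->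
  filtered M (flatten [seq s j | j <- iota 0 L]).
Proof.
move=> [F0 FL Fs Fle] sP.
have main m j : (j + m = L)%N ->
    filtered (quot (F j)) (flatten [seq s k | k <- iota j m]).
  elim: m j => [|m IHm] j jm /=.
    move=> l; rewrite addn0 in jm; rewrite jm.
    transitivity (\dim (F L l)^C)%VS; first by rewrite /dimvec dimvf.
    by rewrite dimv_compl FL subnn.
  have jL : (j < L)%N by lia.
  have Fj := Fs j (ltnW jL); have Fj1 := Fs j.+1 jL.
  apply: filtered_cat (sub_exact (quot_sub_subrepr Fj Fj1)) (sP j jL) _.
  apply: filtered_iso (quot_quot Fj Fj1 (Fle j jL)) _.
  by apply: IHm; lia.
apply: filtered_iso (main L 0%N (add0n L)); apply: iso_sym.
apply: (@inj_surj_iso _ _ _ _ (quotp (F 0%N))).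
- exact: quotp_hom (Fs _ _).
- by apply: injfam0 => l x /quotp_eq0; rewrite F0 memv0 => /eqP.
- exact: quotp_surj.
Qed.

Lemma dim_quot_sub M (U W : subfamily M) l : sub_le U W ->
  \dim (quot_sub U W l) = (\dim (W l) - \dim (U l))%N.
Proof.
move=> UW; rewrite /quot_sub.
have := limg_ker_dim (quot_proj U l) (W l).
rewrite quot_proj_ker (capv_idPr (UW l)) => <-.
by rewrite addKn.
Qed.

Lemma sub_not_nonzero M (U : subfamily M) : ~ sub_lt (sub_zero M) U ->
  forall l, U l = 0%VS.
Proof.
move=> nU; have le0 : sub_le (sub_zero M) U by move=> l; apply: sub0v.
have [h l|h] := pselect (sub_le U (sub_zero M)); last by case: nU.
by apply/eqP; rewrite -subv0.
Qed.

Lemma sub_not_proper M (U : subfamily M) : ~ sub_lt U (sub_full M) ->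
  forall l, U l = fullv.
Proof.
move=> nU; have lef : sub_le U (sub_full M) by move=> l; apply: subvf.
have [h l|h] := pselect (sub_le (sub_full M) U); last by case: nU.
by apply/eqP; rewrite eqEsubv subvf /=; exact: h.
Qed.

Lemma preim_exact_dim M1 M M2 (f : famhom M1 M) (g : famhom M M2)
    (W : subfamily M) l : exact f g ->
  \dim (W l) = (\dim (f l @^-1: W l)%VS + \dim (g l @: W l)%VS)%N.
Proof.
move=> [fh gh fi gs ke]; rewrite -(limg_ker_dim (g l) (W l)); congr (_ + _)%N.
have -> : (W l :&: lker (g l) = f l @: (f l @^-1: W l))%VS.
  apply/vspaceP => x; rewrite memv_cap memv_ker.
  apply/andP/memv_imgP => [[Wx /eqP/ke [y xE]]|[y + ->]].
    by exists y => //; rewrite -memv_preim -xE.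
  rewrite -memv_preim => h; split=> //.
  by apply/eqP/ke; exists y.
rewrite limg_dim_eq //; have /eqP -> : lker (f l) == 0%VS by apply/lker0P.
by rewrite capv0.
Qed.

End SubQuotient.

(** * Degree, slope and stability *)

Section Degree.
Variables (R : realType) (Q : quiver) (alpha : vertex Q -> R[i]).
Hypothesis alpha_imag : forall l, Re (alpha l) = 0.
Local Notation qrep := (qrep R[i] Q).
Implicit Types (M N S X : qrep) (w : vertex Q -> nat) (lam : R).

Definition degree w : R := \sum_l - Im (alpha l) * (w l)%:R.

(** The excess is additive on exact sequences, which the slope is not, and the
    comparison of the slope with lam is the sign of the excess. All slope
    inequalities are therefore turned into inequalities between excesses. *)
Definition excess lam w : R := degree w - lam * (rank w)%:R.

Definition rslope w : R := degree w / (rank w)%:R.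

(** As alpha is imaginary, the complex slopes are real, and the order of the
    complex numbers restricts to the usual one on them. *)
Lemma slopeE w : slope alpha w = (rslope w)%:C.
Proof.
rewrite /slope /rslope rmorphM fmorphV rmorph_nat; congr (_ / _).
  rewrite /degree rmorph_sum; apply: eq_bigr => l _ /=.
  rewrite rmorphM rmorph_nat; congr (_ * _).
  have -> : alpha l = 0 +i* Im (alpha l).
    by rewrite -[in RHS](alpha_imag l); case: (alpha l).
  by apply/eqP; rewrite eq_complex /=; apply/andP; split; apply/eqP; rewrite /=; ring.
by rewrite /rank natr_sum.
Qed.

Lemma excess_add lam w w1 w2 : (forall l, w l = w1 l + w2 l)%N ->
  excess lam w = excess lam w1 + excess lam w2.
Proof.
move=> wE; rewrite /excess /degree /rank.
have -> : (\sum_l w l = \sum_l w1 l + \sum_l w2 l)%N.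
  by rewrite -big_split; apply: eq_bigr => l _.
have -> : \sum_l - Im (alpha l) * (w l)%:R =
    \sum_l - Im (alpha l) * (w1 l)%:R +
    \sum_l - Im (alpha l) * (w2 l)%:R.
  by rewrite -big_split; apply: eq_bigr => l _; rewrite wE natrD mulrDr.
by rewrite natrD; ring.
Qed.

Lemma excess_eq lam w w' : w =1 w' -> excess lam w = excess lam w'.
Proof.
by move=> e; rewrite /excess /degree /rank; congr (_ - _ * _%:R);
  apply: eq_bigr => l _; rewrite e.
Qed.

Lemma rank_eq w w' : w =1 w' -> rank w = rank w'.
Proof. by move=> e; rewrite /rank; apply: eq_bigr => l _; rewrite e. Qed.

Lemma excess0 lam w : (forall l, w l = 0%N) -> excess lam w = 0.
Proof.
move=> w0; rewrite /excess /degree /rank !big1 ?mulr0 ?subrr // => l _.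
by rewrite w0 mulr0.
Qed.

Lemma excess_le0 lam w : (0 < rank w)%N -> (excess lam w <= 0) = (rslope w <= lam).
Proof. by move=> r; rewrite /excess /rslope ler_pdivrMr ?ltr0n // subr_le0. Qed.

Lemma excess_lt0 lam w : (0 < rank w)%N -> (excess lam w < 0) = (rslope w < lam).
Proof. by move=> r; rewrite /excess /rslope ltr_pdivrMr ?ltr0n // subr_lt0. Qed.

Lemma excess_rslope w : excess (rslope w) w = 0.
Proof.
rewrite /excess /rslope; have [r0|r0] := eqVneq (rank w) 0%N; last first.
  by rewrite divfK ?subrr // pnatr_eq0.
rewrite r0 mulr0 subr0 /degree big1 // => l _.
have /eqP := r0; rewrite /rank sum_nat_eq0 => /forallP /(_ l) /eqP ->.
by rewrite mulr0.
Qed.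

Lemma rslope_excess0 lam w : (0 < rank w)%N -> excess lam w = 0 -> rslope w = lam.
Proof.
move=> r0 e; apply/eqP; rewrite eq_le -excess_le0 // e lexx /= leNgt.
by rewrite -excess_lt0 // e ltxx.
Qed.

Lemma slope_lt w w' : rslope w < rslope w' -> slope alpha w < slope alpha w'.
Proof. by rewrite !slopeE ltcR. Qed.

Lemma rank_nonzero M (U : subfamily M) : sub_nonzero U -> (0 < rank (subdim U))%N.
Proof.
move=> [_ nU]; rewrite lt0n; apply/eqP => r0; apply: nU => l.
have /eqP := r0; rewrite /rank sum_nat_eq0 => /forallP /(_ l) /eqP.
by move/eqP; rewrite /subdim dimv_eq0 => /eqP ->; apply: subvv.
Qed.

Lemma rank_leq w w' : (forall l, w l <= w' l)%N -> (rank w <= rank w')%N.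
Proof. by move=> h; apply: leq_sum. Qed.

Lemma stable_excess_lt M lam (U : subfamily M) : stable alpha M -> is_subrepr U ->
  sub_nonzero U -> sub_proper U -> excess lam (dimvec M) <= 0 ->
  excess lam (subdim U) < 0.
Proof.
move=> [r0 sM] Us Un Up; rewrite (excess_le0 _ r0) excess_lt0 ?rank_nonzero //.
by apply: lt_le_trans; move: (sM U Us Un Up); rewrite !slopeE ltcR.
Qed.

(** If the excess of M is positive, the slope of U is below that of M and its
    rank is at most that of M, so that deg U - lam rk U = rk U (slope U - lam)
    is at most rk M (slope M - lam). *)
Lemma stable_excess_le M lam (U : subfamily M) : stable alpha M -> is_subrepr U ->
  excess lam (subdim U) <= Num.max (excess lam (dimvec M)) 0.
Proof.
move=> sM Us; have [Un|/sub_not_nonzero U0] := pselect (sub_nonzero U); last first.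
  rewrite [X in X <= _]excess0 ?le_max ?lexx ?orbT // => l.
  by rewrite /subdim U0 dimv0.
have [Up|/sub_not_proper U1] := pselect (sub_proper U); last first.
  rewrite [X in X <= _](@excess_eq _ _ (dimvec M)) ?le_max ?lexx // => l.
  by rewrite /subdim U1.
have [h|h] := leP (excess lam (dimvec M)) 0.
  exact/ltW/(stable_excess_lt sM).
have := stable_excess_lt (lam := rslope (dimvec M)) sM Us Un Up.
rewrite excess_rslope lexx => /(_ isT) /ltW.
have [r0 _] := sM; have rU := rank_nonzero Un.
have rle : (rank (subdim U) <= rank (dimvec M))%N.
  by apply: rank_leq => l; apply: dimvS; apply: subvf.
move: h; rewrite /excess /rslope.
set dM := degree (dimvec M); set dU := degree _.
have -> : (rank (dimvec M) = rank (subdim U) + (rank (dimvec M) - rank (subdim U)))%N by lia.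
set b := (_ - _)%N; set a := rank (subdim U) in rU *.
have a0 : 0 < a%:R :> R by rewrite ltr0n.
have b0 : 0 <= b%:R :> R by rewrite ler0n.
rewrite natrD => h1 h2.
have : (dU * (a%:R + b%:R) <= dM * a%:R).
  move: h2; rewrite subr_le0 mulrAC ler_pdivlMr //; lra.
move=> h3; have ab : 0 < a%:R + b%:R :> R by lra.
rewrite -(ler_pM2r ab); nra.
Qed.

Definition all_stable (s : seq qrep) := all (fun X => `[< stable alpha X >]) s.

(** As lam varies, this is the Legendre transform of the polygon with the
    pieces of s as edges. For the pieces of a Harder-Narasimhan-Jordan-Holder
    filtration it is the largest excess of a subrepresentation. *)
Definition posexcess lam (s : seq qrep) : R :=
  \sum_(X <- s) Num.max (excess lam (dimvec X)) 0.

(** The traces of W on the pieces are subrepresentations of stable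
    representations, and their excesses add up to that of W. *)
Lemma filtered_excess M s lam (W : subfamily M) : filtered M s -> all_stable s ->
  is_subrepr W -> excess lam (subdim W) <= posexcess lam s.
Proof.
elim: s M W => [|S s IHs] M W /=.
  move=> M0 _ _; rewrite /posexcess big_nil excess0 // => l.
  apply/eqP; rewrite -leqn0 -(M0 l); apply: dimvS; exact: subvf.
move=> [M' [f [g [fg Fs]]]] /andP [/asboolP sS ss] Ws.
have [fh gh fi gs ke] := fg.
pose W1 : subfamily S := fun l => (f l @^-1: W l)%VS.
pose W2 : subfamily M' := fun l => (g l @: W l)%VS.
have W1s : is_subrepr W1.
  move=> a; apply/subvP => _ /memv_imgP [x + ->]; rewrite -!memv_preim fh => h.
  by apply/(subvP (Ws a))/memv_img.
have W2s : is_subrepr W2.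
  move=> a; apply/subvP => _ /memv_imgP [_ /memv_imgP [x + ->] ->] => h.
  by rewrite -gh; apply/memv_img/(subvP (Ws a))/memv_img.
rewrite (@excess_add lam _ (subdim W1) (subdim W2)); last first.
  by move=> l; apply: preim_exact_dim.
rewrite /posexcess big_cons; apply: lerD; first exact: stable_excess_le.
exact: IHs Fs ss W2s.
Qed.

(** At lam = slope S, the kernel and the image of psi have opposite excesses,
    while stability makes both nonpositive, and negative unless the kernel is
    zero and the image is everything. *)
Lemma schur S X (psi : famhom S X) : stable alpha S -> stable alpha X ->
  rslope (dimvec X) <= rslope (dimvec S) -> is_hom psi -> nonzero_fam psi ->
  inj_fam psi /\ surj_fam psi.
Proof.
move=> sS sX XS ph [l0 [x0 nz]].
pose U : subfamily S := fun l => lker (psi l).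
pose I : subfamily X := fun l => limg (psi l).
have Us : is_subrepr U.
  move=> a; apply/subvP => _ /memv_imgP [x + ->]; rewrite !memv_ker ph => /eqP ->.
  by rewrite linear0.
have Is : is_subrepr I.
  move=> a; apply/subvP => _ /memv_imgP [_ /memv_imgP [x _ ->] ->].
  by rewrite -ph; apply/memv_img/memvf.
set lam := rslope (dimvec S).
have exE : excess lam (subdim U) + excess lam (subdim I) = 0.
  rewrite -(excess_rslope (dimvec S)); apply/esym/excess_add => l.
  by rewrite /dimvec -(limg_ker_dim (psi l) fullv) capfv.
have In : sub_nonzero I.
  split=> [l|/(_ l0)/subvP h]; first exact: sub0v.
  apply: nz; apply/eqP; rewrite -memv0; apply: h; exact/memv_img/memvf.
have Up : sub_proper U.
  split=> [l|/(_ l0)/subvP h]; first exact: subvf.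
  apply: nz; apply/eqP; rewrite -memv_ker; apply: h; exact: memvf.
have [rS _] := sS; have [rX _] := sX.
have XS' : excess lam (dimvec X) <= 0 by rewrite excess_le0.
have I0 : excess lam (subdim I) <= 0.
  by have := stable_excess_le lam sX Is; rewrite max_r.
have Un : ~ sub_nonzero U.
  move=> Un; have := stable_excess_lt (lam := lam) sS Us Un Up.
  by rewrite /lam excess_rslope lexx => /(_ isT); lra.
have Ip : ~ sub_proper I.
  move=> Ip; have := stable_excess_lt (lam := lam) sX Is In Ip XS'.
  have := stable_excess_le lam sS Us; rewrite excess_rslope maxxx; lra.
split=> [|l y].
  apply: injfam0 => l x /eqP; rewrite -memv_ker.
  by have /= := sub_not_nonzero Un l; rewrite /U => ->; rewrite memv0 => /eqP.
have : y \in I l by rewrite (sub_not_proper Ip) memvf.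
by move=> /memv_imgP [x _ ->]; exists x.
Qed.

(** The order is weak because the pieces of one Harder-Narasimhan step have
    equal slopes. *)
Fixpoint slopes_decrease (s : seq qrep) : bool :=
  if s is X :: s' then
    all (fun Y => rslope (dimvec Y) <= rslope (dimvec X)) s' && slopes_decrease s'
  else true.

Lemma rslope_eq w w' : w =1 w' -> rslope w = rslope w'.
Proof.
by move=> e; rewrite /rslope /degree /rank; congr (_ / _%:R); apply: eq_bigr => l _; rewrite e.
Qed.

Lemma subn_chain (a b c x y z : nat) : a = (z - x)%N -> b = (y - x)%N ->
  c = (z - y)%N -> (x <= y)%N -> (y <= z)%N -> a = (b + c)%N.
Proof. lia. Qed.

Lemma le_of_eq_le (a1 b1 a2 b2 : R) : a1 = b1 -> a2 = b2 -> b2 <= b1 -> a2 <= a1.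
Proof. by move=> -> ->. Qed.

Lemma slope_le w w' : slope alpha w <= slope alpha w' -> rslope w <= rslope w'.
Proof. by rewrite !slopeE lecR. Qed.

Lemma slope_eq w w' : slope alpha w = slope alpha w' -> rslope w = rslope w'.
Proof. by rewrite !slopeE => -[]. Qed.

Lemma slopes_sum w w1 w2 : (0 < rank w)%N -> (0 < rank w2)%N ->
  (forall l, w l = w1 l + w2 l)%N -> rslope w <= rslope w1 -> rslope w2 <= rslope w1.
Proof.
move=> r0 r2 wE; rewrite -!excess_le0 //.
by rewrite (excess_add _ wE) excess_rslope add0r.
Qed.

(** F (j+2) / F j has slope at most that of the maximal F (j+1) / F j, and it is
    an extension of F (j+2) / F (j+1) by the latter. *)
Lemma HN_slopes M L (F : nat -> subfamily M) : is_HN alpha L F ->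
  forall j, (j.+1 < L)%N ->
  rslope (dimvec (subquot (F j.+1) (F j.+2))) <= rslope (dimvec (subquot (F j) (F j.+1))).
Proof.
move=> [[F0 FL Fs Fle] Flt Fmax] j jL; have jL' : (j < L)%N by lia.
have [Vs Vn Vmax] := Fmax j jL'; have [_ Vn' _] := Fmax j.+1 jL.
have le1 := Fle j jL'; have le2 := Fle j.+1 jL.
have le3 : sub_le (F j) (F j.+2) by move=> l; apply: subv_trans (le1 l) (le2 l).
pose W := quot_sub (F j) (F j.+2).
have Ws : is_subrepr W by apply: quot_sub_subrepr; apply: Fs => //; lia.
have VW : sub_le (quot_sub (F j) (F j.+1)) W by move=> l; apply: limgS; apply: le2.
have Wn : sub_nonzero W.
  split=> [l|h]; first exact: sub0v.
  have [_ +] := Vn; apply=> l; exact: subv_trans (VW l) (h l).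
have [h _] := Vmax W Ws Wn; have {h} WV := slope_le h.
have r1 := rank_nonzero Wn; have r2 := rank_nonzero Vn'.
have E1 : dimvec (subquot (F j) (F j.+1)) =1 subdim (quot_sub (F j) (F j.+1)).
  by move=> l; rewrite dimvec_subr.
have E2 : dimvec (subquot (F j.+1) (F j.+2)) =1 subdim (quot_sub (F j.+1) (F j.+2)).
  by move=> l; rewrite dimvec_subr.
have E3 l : (subdim W l = subdim (quot_sub (F j) (F j.+1)) l +
     subdim (quot_sub (F j.+1) (F j.+2)) l)%N.
  have d12 := dimvS (le1 l); have d23 := dimvS (le2 l).
  have q13 := dim_quot_sub l le3; have q12 := dim_quot_sub l le1.
  have q23 := dim_quot_sub l le2.
  exact: subn_chain q13 q12 q23 d12 d23.
have eq1 := rslope_eq E1; have eq2 := rslope_eq E2.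
apply: (le_of_eq_le eq1 eq2).
exact: slopes_sum r1 r2 E3 WV.
Qed.

Lemma pairwise_blocks (mu : nat -> R) (s : nat -> seq qrep) m j :
  (forall k, (j <= k < j + m)%N -> all (fun X => rslope (dimvec X) == mu k) (s k)) ->
  (forall k, (j <= k)%N -> (k.+1 < j + m)%N -> mu k.+1 <= mu k) ->
  slopes_decrease (flatten [seq s k | k <- iota j m]) /\
  ((0 < m)%N -> all (fun X => rslope (dimvec X) <= mu j) (flatten [seq s k | k <- iota j m])).
Proof.
elim: m j => [|m IHm] j sP mP; first by [].
have [|k h1 h2|IH1 IH2] := IHm j.+1.
- by move=> k h; apply: sP; lia.
- by apply: mP; lia.
have s0 : all (fun X => rslope (dimvec X) == mu j) (s j) by apply: sP; lia.
have rest : all (fun X => rslope (dimvec X) <= mu j) (flatten [seq s k | k <- iota j.+1 m]).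
  case: m {IHm IH1 sP} mP IH2 => [//|m] mP /(_ isT); apply: sub_all => X /le_trans; apply.
  by apply: mP; lia.
split=> [|_] /=; last first.
  by rewrite all_cat rest andbT; apply: sub_all s0 => X /eqP ->.
elim: (s j) s0 => [//|X t IHt] /= /andP[/eqP -> ht].
rewrite IHt // andbT all_cat rest andbT.
by apply: sub_all ht => Y /eqP ->.
Qed.

Lemma filtered1 X : filtered X [:: X].
Proof.
pose U : subfamily X := fun l => fullv.
have Us : is_subrepr U by move=> a; apply: subvf.
exists (quot U), (@idh _ _ X), (quotp U); split.
  split; [ by move=> a x; rewrite /idh !lfunE | exact: quotp_hom | | exact: quotp_surj | ].
    by move=> l x y; rewrite /idh !lfunE.
  by move=> l x; rewrite quotp_eq0 memvf; split=> // _; exists x; rewrite /idh lfunE.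
move=> l; transitivity (\dim (U l)^C)%VS; first by rewrite /dimvec dimvf.
by rewrite dimv_compl subnn.
Qed.

Lemma JH_filtered M m (G : nat -> subfamily M) : is_JH alpha m G ->
  filtered M (pieces m G).
Proof.
move=> [_ fil _]; have := filtered_of_filtration
  (s := fun j => [:: subquot (G j) (G j.+1)]) fil (fun j _ => filtered1 _).
by rewrite (map_comp (fun X => [:: X]) (fun j => subquot (G j) (G j.+1))) flatten_seq1.
Qed.

(** This merges the double filtration into a single one, with the pieces in the
    order of their slopes. *)
Lemma HNJH_filtered M (H : HNJH alpha M) : exists s : seq qrep,
  [/\ graded H = dsum s, filtered M s, all_stable s & slopes_decrease s].
Proof.
case: H => L F HN m G JH.
exists (flatten [seq pieces (m j) (G j) | j <- iota 0 L]); split=> //.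
- have [fil _ _] := HN; apply: (filtered_of_filtration fil) => j jL.
  exact: JH_filtered (JH j jL).
- have : all (fun j => (j < L)%N) (iota 0 L).
    by apply/allP => j; rewrite mem_iota.
  elim: (iota 0 L) => [//|j t IHt] /= /andP[jL /IHt IH].
  move: IH; rewrite /all_stable all_cat => ->; rewrite andbT /pieces all_map.
  have [_ _ st] := JH j jL.
  have : all (fun k => (k < m j)%N) (iota 0 (m j)).
    by apply/allP => k; rewrite mem_iota.
  by apply: sub_all => k km /=; apply/asboolP; have [] := st k km.
- pose mu j := rslope (dimvec (subquot (F j) (F j.+1))).
  have h1 k : (0 <= k < 0 + L)%N ->
      all (fun X => rslope (dimvec X) == mu k) (pieces (m k) (G k)).
    move=> /andP[_ kL]; have [_ _ st] := JH k kL; rewrite /pieces all_map.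
    have : all (fun i => (i < m k)%N) (iota 0 (m k)).
      by apply/allP => i; rewrite mem_iota.
    apply: sub_all => i im /=; apply/eqP; have [_ e] := st i im.
    exact: slope_eq e.
  have h2 k : (0 <= k)%N -> (k.+1 < 0 + L)%N -> mu k.+1 <= mu k.
    by move=> _ kL; apply: (HN_slopes HN).
  exact: (pairwise_blocks h1 h2).1.
Qed.

End Degree.

(** * Limits of complex matrices and of their cokernels *)

Section ComplexLimits.
Variables (R : realType).
Local Notation C := R[i].

Lemma cReD (x y : C) : Re (x + y) = Re x + Re y. Proof. by case: x; case: y. Qed.
Lemma cImD (x y : C) : Im (x + y) = Im x + Im y. Proof. by case: x; case: y. Qed.
Lemma cReN (x : C) : Re (- x) = - Re x. Proof. by case: x. Qed.
Lemma cImN (x : C) : Im (- x) = - Im x. Proof. by case: x. Qed.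
Lemma cReM (x y : C) : Re (x * y) = Re x * Re y - Im x * Im y.
Proof. by case: x; case: y. Qed.
Lemma cImM (x y : C) : Im (x * y) = Re x * Im y + Im x * Re y.
Proof. by case: x; case: y. Qed.
Lemma cReJ (x : C) : Re (Num.conj x) = Re x. Proof. by case: x. Qed.
Lemma cImJ (x : C) : Im (Num.conj x) = - Im x. Proof. by case: x. Qed.
Lemma cReV (x : C) : Re (x^-1) = Re x / (Re x ^+ 2 + Im x ^+ 2).
Proof. by case: x. Qed.
Lemma cImV (x : C) : Im (x^-1) = - (Im x / (Re x ^+ 2 + Im x ^+ 2)).
Proof. by case: x. Qed.
Lemma cRe_sum I (r : seq I) (P : pred I) (F : I -> C) :
  Re (\sum_(i <- r | P i) F i) = \sum_(i <- r | P i) Re (F i).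
Proof. by apply: (big_morph Re cReD). Qed.
Lemma cIm_sum I (r : seq I) (P : pred I) (F : I -> C) :
  Im (\sum_(i <- r | P i) F i) = \sum_(i <- r | P i) Im (F i).
Proof. by apply: (big_morph Im cImD). Qed.
Lemma C_eq (x y : C) : Re x = Re y -> Im x = Im y -> x = y.
Proof. by case: x => a b; case: y => c d /= -> ->. Qed.

(** q is a surjection with kernel the image of F, and c is a section of it. In
    [coker_limit] the section is constant along the filter, which keeps the
    cokernels on a fixed space. *)
Definition presents_coker m d r (F : 'M[C]_(m, d)) (c : 'M[C]_(m, r)) (q : 'M[C]_(r, m)) :=
  [/\ q *m F = 0, q *m c = 1%:M & forall x : 'cV_m, q *m x = 0 -> exists y, x = F *m y].

Section Filter.
Variables (T : Type) (F : set_system T).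
Context {FF : ProperFilter F}.

(** Convergence of complex numbers by real and imaginary parts, the form in
    which the flow converges. *)
Definition ccvg (f : T -> C) (l : C) : Prop :=
  (Re (f t) @[t --> F] --> Re l) /\ (Im (f t) @[t --> F] --> Im l).

Lemma ccvg_cst c : ccvg (fun=> c) c.
Proof. by split; apply: cvg_cst. Qed.

Lemma ccvgD f g a b : ccvg f a -> ccvg g b -> ccvg (fun t => f t + g t) (a + b).
Proof.
move=> [fr fi] [gr gi]; split.
  by rewrite cReD; under eq_fun do rewrite cReD; apply: cvgD.
by rewrite cImD; under eq_fun do rewrite cImD; apply: cvgD.
Qed.

Lemma ccvgN f a : ccvg f a -> ccvg (fun t => - f t) (- a).
Proof.
move=> [fr fi]; split.
  by rewrite cReN; under eq_fun do rewrite cReN; apply: cvgN.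
by rewrite cImN; under eq_fun do rewrite cImN; apply: cvgN.
Qed.

Lemma ccvgM f g a b : ccvg f a -> ccvg g b -> ccvg (fun t => f t * g t) (a * b).
Proof.
move=> [fr fi] [gr gi]; split.
  by rewrite cReM; under eq_fun do rewrite cReM; apply: cvgB; apply: cvgM.
by rewrite cImM; under eq_fun do rewrite cImM; apply: cvgD; apply: cvgM.
Qed.

Lemma ccvgJ f a : ccvg f a -> ccvg (fun t => Num.conj (f t)) (Num.conj a).
Proof.
move=> [fr fi]; split.
  by rewrite cReJ; under eq_fun do rewrite cReJ.
by rewrite cImJ; under eq_fun do rewrite cImJ; apply: cvgN.
Qed.

Lemma norm2_neq0 (a : C) : a != 0 -> Re a ^+ 2 + Im a ^+ 2 != 0.
Proof.
case: a => x y /=; apply: contra; rewrite paddr_eq0 ?sqr_ge0 // !sqrf_eq0.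
by move=> /andP[/eqP -> /eqP ->].
Qed.

Lemma ccvgV f a : a != 0 -> ccvg f a -> ccvg (fun t => (f t)^-1) a^-1.
Proof.
move=> a0 [fr fi]; have n0 := norm2_neq0 a0.
have n : (Re (f t) ^+ 2 + Im (f t) ^+ 2) @[t --> F] --> Re a ^+ 2 + Im a ^+ 2.
  by apply: cvgD; rewrite expr2; under eq_fun do rewrite expr2; apply: cvgM.
split.
  by rewrite cReV; under eq_fun do rewrite cReV; apply: cvgM => //; apply: cvgV.
rewrite cImV; under eq_fun do rewrite cImV.
by apply: cvgN; apply: cvgM => //; apply: cvgV.
Qed.

Lemma rcvg_sum I (r : seq I) (P : pred I) (f : I -> T -> R) (a : I -> R) :
  (forall i, P i -> f i t @[t --> F] --> a i) ->
  \sum_(i <- r | P i) f i t @[t --> F] --> \sum_(i <- r | P i) a i.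
Proof.
move=> h; elim: r => [|i r IHr].
  by rewrite big_nil; under eq_fun do rewrite big_nil; apply: cvg_cst.
rewrite big_cons; under eq_fun do rewrite big_cons.
by case: ifP => // Pi; apply: cvgD => //; apply: h.
Qed.

Lemma ccvg_sum I (r : seq I) (P : pred I) (f : I -> T -> C) (a : I -> C) :
  (forall i, P i -> ccvg (f i) (a i)) ->
  ccvg (fun t => \sum_(i <- r | P i) f i t) (\sum_(i <- r | P i) a i).
Proof.
move=> h; split.
  rewrite cRe_sum; under eq_fun do rewrite cRe_sum.
  by apply: rcvg_sum => i /h [].
rewrite cIm_sum; under eq_fun do rewrite cIm_sum.
by apply: rcvg_sum => i /h [].
Qed.

Lemma ccvg_prod I (r : seq I) (P : pred I) (f : I -> T -> C) (a : I -> C) :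
  (forall i, P i -> ccvg (f i) (a i)) ->
  ccvg (fun t => \prod_(i <- r | P i) f i t) (\prod_(i <- r | P i) a i).
Proof.
move=> h; elim: r => [|i r IHr].
  by rewrite big_nil; under eq_fun do rewrite big_nil; apply: ccvg_cst.
rewrite big_cons; under eq_fun do rewrite big_cons.
by case: ifP => // Pi; apply: ccvgM => //; apply: h.
Qed.

Lemma ccvg_unique f g a b : ccvg f a -> ccvg g b ->
  (\forall t \near F, f t = g t) -> a = b.
Proof.
move=> [fr fi] [gr gi] fg; apply: C_eq.
  apply: (@cvg_unique _ (@Rhausdorff R) _ _ _ _ fr); apply: cvg_trans gr.
  by apply: near_eq_cvg; apply: filterS fg => t ->.
apply: (@cvg_unique _ (@Rhausdorff R) _ _ _ _ fi); apply: cvg_trans gi.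
by apply: near_eq_cvg; apply: filterS fg => t ->.
Qed.

Lemma ccvg_neq0 f a : a != 0 -> ccvg f a -> \forall t \near F, f t != 0.
Proof.
move=> a0 [fr fi]; have n0 := norm2_neq0 a0.
have n : (Re (f t) ^+ 2 + Im (f t) ^+ 2) @[t --> F] --> Re a ^+ 2 + Im a ^+ 2.
  by apply: cvgD; rewrite expr2; under eq_fun do rewrite expr2; apply: cvgM.
have n1 : 0 < Re a ^+ 2 + Im a ^+ 2 by rewrite lt_neqAle eq_sym n0 addr_ge0 ?sqr_ge0.
near=> t; apply/eqP => ft0.
have : 0 < Re (f t) ^+ 2 + Im (f t) ^+ 2 by near: t; exact: (cvgr_gt _ n).
by rewrite ft0 /= expr0n addr0 ltxx.
Unshelve. all: by end_near. Qed.

Definition mcvg m n (f : T -> 'M[C]_(m, n)) (L : 'M[C]_(m, n)) : Prop :=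
  forall i j, ccvg (fun t => f t i j) (L i j).

Lemma mcvg_cst m n (L : 'M[C]_(m, n)) : mcvg (fun=> L) L.
Proof. by move=> i j; apply: ccvg_cst. Qed.

Lemma mcvgD m n (f g : T -> 'M[C]_(m, n)) L M : mcvg f L -> mcvg g M ->
  mcvg (fun t => f t + g t) (L + M).
Proof.
by move=> fL gM i j; rewrite mxE; under eq_fun do rewrite mxE; apply: ccvgD.
Qed.

Lemma mcvgN m n (f : T -> 'M[C]_(m, n)) L : mcvg f L -> mcvg (fun t => - f t) (- L).
Proof.
by move=> fL i j; rewrite mxE; under eq_fun do rewrite mxE; apply: ccvgN.
Qed.

Lemma mcvgZ m n (c : T -> C) a (f : T -> 'M[C]_(m, n)) L : ccvg c a -> mcvg f L ->
  mcvg (fun t => c t *: f t) (a *: L).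
Proof.
by move=> ca fL i j; rewrite mxE; under eq_fun do rewrite mxE; apply: ccvgM.
Qed.

Lemma mcvgM m n p (f : T -> 'M[C]_(m, n)) (g : T -> 'M[C]_(n, p)) L M :
  mcvg f L -> mcvg g M -> mcvg (fun t => f t *m g t) (L *m M).
Proof.
move=> fL gM i j; rewrite mxE; under eq_fun do rewrite mxE.
by apply: ccvg_sum => k _; apply: ccvgM.
Qed.

Lemma mcvg_sum m n I (r : seq I) (P : pred I) (f : I -> T -> 'M[C]_(m, n)) L :
  (forall i, P i -> mcvg (f i) (L i)) ->
  mcvg (fun t => \sum_(i <- r | P i) f i t) (\sum_(i <- r | P i) L i).
Proof.
move=> h i j; rewrite summxE; under eq_fun do rewrite summxE.
by apply: ccvg_sum => k Pk; apply: h.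
Qed.

Lemma mcvg_adj m n (f : T -> 'M[C]_(m, n)) L : mcvg f L ->
  mcvg (fun t => adj (f t)) (adj L).
Proof.
by move=> fL i j; rewrite !mxE; under eq_fun do rewrite !mxE; apply: ccvgJ.
Qed.

Lemma ccvg_det n (f : T -> 'M[C]_n) L : mcvg f L ->
  ccvg (fun t => \det (f t)) (\det L).
Proof.
move=> fL; apply: ccvg_sum => s _; apply: ccvgM; first exact: ccvg_cst.
by apply: ccvg_prod => i _; apply: fL.
Qed.

Lemma mcvg_adjugate n (f : T -> 'M[C]_n) L : mcvg f L ->
  mcvg (fun t => \adj (f t)) (\adj L).
Proof.
move=> fL i j; rewrite mxE; under eq_fun do rewrite mxE.
apply: ccvgM; first exact: ccvg_cst.
by apply: ccvg_det => k l; rewrite !mxE; under eq_fun do rewrite !mxE; apply: fL.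
Qed.

Lemma mcvg_unique m n (f g : T -> 'M[C]_(m, n)) L M : mcvg f L -> mcvg g M ->
  (\forall t \near F, f t = g t) -> L = M.
Proof.
move=> fL gM fg; apply/matrixP => i j; apply: ccvg_unique (fL i j) (gM i j) _.
by apply: filterS fg => t ->.
Qed.

Lemma mcvg_row_mx m n1 n2 (f : T -> 'M[C]_(m, n1)) (g : T -> 'M[C]_(m, n2)) L M :
  mcvg f L -> mcvg g M -> mcvg (fun t => row_mx (f t) (g t)) (row_mx L M).
Proof.
move=> fL gM i j; rewrite mxE; under eq_fun do rewrite mxE.
by case: (fintype.split j) => k; [apply: fL | apply: gM].
Qed.

Lemma mcvg_dsubmx m1 m2 n (f : T -> 'M[C]_(m1 + m2, n)) L :
  mcvg f L -> mcvg (fun t => dsubmx (f t)) (dsubmx L).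
Proof. by move=> fL i j; rewrite mxE; under eq_fun do rewrite mxE; apply: fL. Qed.

(** If Phi is injective, choose a complement c of its image. Then [Phi c] is
    invertible, hence so is [Ft c] near the limit, and the lower rows of the
    inverse are the projection onto the complement along the image of Ft. They
    converge since the inverse is continuous. *)
Lemma coker_limit m d (Ft : T -> 'M[C]_(m, d)) (Phi : 'M[C]_(m, d)) :
  mcvg Ft Phi -> (forall x : 'cV_d, Phi *m x = 0 -> x = 0) ->
  exists r (c : 'M[C]_(m, r)) (q : T -> 'M[C]_(r, m)) (q0 : 'M[C]_(r, m)),
   [/\ mcvg q q0, presents_coker Phi c q0
     & \forall t \near F, presents_coker (Ft t) c (q t)].
Proof.
move=> FP Pinj.
have free : row_free Phi^T.
  rewrite -kermx_eq0; apply/eqP/row_matrixP => i; rewrite row0.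
  apply: trmx_inj; rewrite trmx0; apply: Pinj.
  by apply: trmx_inj; rewrite trmx_mul trmxK trmx0 -row_mul mulmx_ker row0.
pose r := \rank (Phi^T)^C%MS; pose c := (row_base (Phi^T)^C%MS)^T.
have : row_full (col_mx Phi^T c^T).
  by rewrite -sub1mx -addsmxE trmxK (adds_eqmx (eqmx_refl _) (eq_row_base _))
    sub1mx addsmx_compl_full.
move=> /row_fullP [N' N'E].
have : row_free (col_mx Phi^T c^T).
  apply: inj_row_free => u.
  rewrite -[u]hsubmxK mul_row_col => /eqP; rewrite addr_eq0 => /eqP uE.
  have h : (lsubmx u *m Phi^T <= (Phi^T :&: (Phi^T)^C))%MS.
    rewrite sub_capmx submxMl uE -mulNmx /= -(eq_row_base (Phi^T)^C%MS) /c trmxK.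
    exact: submxMl.
  rewrite capmx_compl submx0 in h; have {}h := eqP h.
  have -> : lsubmx u = 0 by apply: (row_free_inj free); rewrite h mul0mx.
  suff -> : rsubmx u = 0 by rewrite row_mx0.
  have cf : row_free c^T by rewrite /c trmxK row_base_free.
  by apply: (row_free_inj cf); rewrite mul0mx; apply: oppr_inj; rewrite oppr0 -uE h.
move=> /row_freeP [N'' N''E].
pose Rm := row_mx Phi c; pose N := N'^T.
have RmE : Rm^T = col_mx Phi^T c^T by rewrite tr_row_mx.
have RN : Rm *m N = 1%:M by apply: trmx_inj; rewrite trmx_mul trmxK trmx1 RmE.
have NR : N *m Rm = 1%:M.
  apply: trmx_inj; rewrite trmx_mul trmxK trmx1 RmE.
  have -> : N' = N'' by rewrite -[N'']mul1mx -N'E -mulmxA N''E mulmx1.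
  by [].
(* X t is the matrix [Ft c] read in the basis [Phi c]; it tends to 1. *)
pose Rt t := row_mx (Ft t) c; pose X t := N *m Rt t.
have RtX t : Rt t = Rm *m X t by rewrite /X mulmxA RN mul1mx.
pose Y t := ((\det (X t))^-1 *: \adj (X t)) *m N.
have Xcvg : mcvg X 1%:M.
  rewrite -NR; apply: mcvgM; first exact: mcvg_cst.
  by apply: mcvg_row_mx => //; exact: mcvg_cst.
have Ycvg : mcvg Y N.
  rewrite -[X in mcvg _ X]mul1mx -[1%:M]scale1r -[in X in X *: _](invr1 C).
  rewrite -{1}(det1 C (d + r)) -[X in _ *: X](_ : \adj 1%:M = _); last first.
    by have := mul_adj_mx (1%:M : 'M[C]_(d + r)); rewrite mulmx1 det1.
  apply: mcvgM; last exact: mcvg_cst.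
  apply: mcvgZ; last exact: mcvg_adjugate.
  by apply: ccvgV; [rewrite det1 oner_neq0 | exact: ccvg_det].
have Dn : \forall t \near F, \det (X t) != 0.
  by have := ccvg_det Xcvg; rewrite det1; apply: ccvg_neq0; rewrite oner_neq0.
(* The lower rows of the inverse of [F0 c] present the cokernel of F0. *)
have key (F0 : 'M[C]_(m, d)) (Y0 : 'M[C]_(d + r, m)) :
    Y0 *m row_mx F0 c = 1%:M -> row_mx F0 c *m Y0 = 1%:M ->
    presents_coker F0 c (dsubmx Y0).
  move=> YR RY; have : dsubmx Y0 *m row_mx F0 c = row_mx 0 1%:M.
    by rewrite mul_dsub_mx YR scalar_mx_block block_mxEv col_mxKd.
  rewrite mul_mx_row => /eq_row_mx [h1 h2]; split=> // x x0.
  exists (usubmx Y0 *m x); rewrite -[LHS]mul1mx -RY -mulmxA -{1}[Y0]vsubmxK.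
  by rewrite mul_col_mx mul_row_col x0 mulmx0 addr0.
exists r, c, (fun t => dsubmx (Y t)), (dsubmx N); split.
- exact: mcvg_dsubmx.
- exact: key.
- apply: filterS Dn => t Dt; apply: key; rewrite -/(Rt t).
    rewrite /Y -mulmxA -/(X t) -scalemxAl mul_adj_mx.
    by rewrite -mul_scalar_mx -scalar_mxM mulVf.
  rewrite RtX /Y mulmxA -[X in X *m N]mulmxA -scalemxAr mul_mx_adj.
  by rewrite -mul_scalar_mx -scalar_mxM mulVf // mulmx1.
Qed.

End Filter.
End ComplexLimits.

(** * Representations by matrices *)

Definition col_coord (K : fieldType) (V : vectType K) n (e : n.-tuple V) (x : V)
  : 'cV[K]_n := \col_i coord e i x.
Definition of_col (K : fieldType) (V : vectType K) n (e : n.-tuple V)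
  (x : 'cV[K]_n) : V := \sum_i x i 0 *: e`_i.

Fact col_coord_linear (K : fieldType) (V : vectType K) n (e : n.-tuple V) :
  linear (col_coord e).
Proof. by move=> c x y; apply/colP => i; rewrite !mxE linearP. Qed.
Fact of_col_linear (K : fieldType) (V : vectType K) n (e : n.-tuple V) :
  linear (of_col e).
Proof.
move=> c x y; rewrite /of_col scaler_sumr -big_split; apply: eq_bigr => i _ /=.
by rewrite !mxE scalerDl scalerA.
Qed.

HB.instance Definition _ (K : fieldType) (V : vectType K) n (e : n.-tuple V) :=
  GRing.isLinear.Build K V 'cV[K]_n _ (col_coord e) (col_coord_linear e).
HB.instance Definition _ (K : fieldType) (V : vectType K) n (e : n.-tuple V) :=
  GRing.isLinear.Build K 'cV[K]_n V _ (of_col e) (of_col_linear e).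

Lemma cV_coordinates (K : fieldType) (V : vectType K) :
  exists (f : 'Hom(V, 'cV[K]_(\dim {: V}))) (g : 'Hom('cV[K]_(\dim {: V}), V)),
    cancel f g /\ cancel g f.
Proof.
pose e := vbasis {: V}; have eb : basis_of fullv e := vbasisP fullv.
exists (linfun (col_coord e)), (linfun (of_col e)); split=> x; rewrite !lfunE /=.
  rewrite /of_col [RHS](coord_basis eb (memvf x)).
  by apply: eq_bigr => i _; rewrite mxE.
by apply/colP => i; rewrite mxE /of_col coord_sum_free // (basis_free eb).
Qed.

Section MatrixReps.
Variables (R : realType) (Q : quiver).
Local Notation C := R[i].
Local Notation qrep := (qrep R[i] Q).

Definition mx_of_lfun m n (h : 'Hom('cV[C]_m, 'cV[C]_n)) : 'M[C]_(n, m) :=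
  \matrix_(i, j) h (delta_mx j 0) i 0.

Lemma mx_of_lfunE m n (h : 'Hom('cV[C]_m, 'cV[C]_n)) x : mx_of_lfun h *m x = h x.
Proof.
rewrite {2}[x]matrix_sum_delta linear_sum /=; apply/colP => i.
rewrite mxE summxE; apply: eq_bigr => j _.
by rewrite big_ord1 linearZ !mxE mulrC.
Qed.

Definition mxfam (v w : vertex Q -> nat) (F : forall l, 'M[C]_(w l, v l))
    (A : Rep R v) (B : Rep R w) : famhom (qrep_of A) (qrep_of B) :=
  fun l => linfun (mulmx (F l)).

Lemma mxfamE (v w : vertex Q -> nat) F (A : Rep R v) (B : Rep R w) l x : mxfam F A B l x = F l *m x.
Proof. by rewrite lfunE. Qed.

Lemma arrowE (v : vertex Q -> nat) (A : Rep R v) a x : arrow_map (qrep_of A) a x = A a *m x.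
Proof. by rewrite lfunE. Qed.

Definition intertwines (v w : vertex Q -> nat) (A : Rep R v) (B : Rep R w)
    (F : forall l, 'M[C]_(w l, v l)) :=
  forall a, F (tgt a) *m A a = B a *m F (src a).

Lemma mxfam_hom v w F (A : Rep R v) (B : Rep R w) :
  intertwines A B F -> is_hom (mxfam F A B).
Proof. by move=> FAB a x; rewrite !mxfamE !arrowE !mulmxA FAB. Qed.

Lemma eq_mulmx_cV m n (A B : 'M[C]_(m, n)) :
  (forall x : 'cV_n, A *m x = B *m x) -> A = B.
Proof.
move=> AB; apply/matrixP => i j; have /colP /(_ i) := AB (delta_mx j 0).
by rewrite -!colE !mxE.
Qed.

Lemma qrep_mx (M : qrep) : exists v (A : Rep R v), isomorphic M (qrep_of A).
Proof.
pose v l := \dim {: rspace M l}.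
have /dep_choice [f fP] : forall l, exists f : 'Hom(rspace M l, 'cV[C]_(v l)),
    exists g : 'Hom('cV[C]_(v l), rspace M l), cancel f g /\ cancel g f.
  by move=> l; apply: cV_coordinates.
have [g gP] := dep_choice fP.
pose A : Rep R v := fun a => mx_of_lfun (f (tgt a) \o arrow_map M a \o g (src a))%VF.
exists v, A; exists f; split=> [l|a x].
  by exists (g l); have [] := gP l.
rewrite arrowE mx_of_lfunE comp_lfunE; have [fK gK] := gP (src a).
by rewrite comp_lfunE fK.
Qed.

End MatrixReps.

(** * Normalised limits along an ultrafilter *)

(** Ultrafilters replace the extraction of subsequences: one choice of G serves
    all the bounded functions of the proof at once. *)
Lemma ultra_limits (R : realType) (T : Type) (F : set_system T) :
  ProperFilter F ->
  exists G : set_system T, [/\ ProperFilter G, F `<=` G &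
    forall (u : T -> R) (K : R), (\forall t \near G, `|u t| <= K) ->
      exists l : R, u t @[t --> G] --> l].
Proof.
move=> FF; have [G [GU FG]] := ultraFilterLemma FF.
have GP : ProperFilter G by case: GU.
exists G; split=> // u K uK.
have := @segment_compact R (- K) K; rewrite compact_ultra.
have uin : (u @ G) [set` `[- K, K]].
  by apply: filterS uK => t; rewrite /= ler_norml in_itv.
have uU : UltraFilter (u @ G).
  split=> [|H HP GH]; first exact: fmap_proper_filter.
  apply/seteqP; split=> A; last exact: GH.
  move=> HA; have [//|GA] := in_ultra_setVsetC (u @^-1` A) GU.
  have HnA : H (~` A) by apply: GH.
  by have [x []] := filter_ex (filterI HA HnA).
by move=> /(_ (u @ G) uU uin) [l [_ ul]]; exists l.
Qed.

Lemma term_le_sum (R : realType) (I : finType) (f : I -> R) i :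
  (forall j, 0 <= f j) -> f i <= \sum_j f j.
Proof. by move=> f0; rewrite (bigD1 i) //= lerDl; apply: sumr_ge0. Qed.

Section Normalise.
Variables (R : realType) (T : Type) (G : set_system T).
Context {GF : ProperFilter G}.
Hypothesis Gbd : forall (u : T -> R) (K : R), (\forall t \near G, `|u t| <= K) ->
      exists l : R, u t @[t --> G] --> l.
Local Notation C := R[i].
Lemma mcvg_bounded m n (f : T -> 'M[C]_(m, n)) (K : R) :
  (\forall t \near G, forall i j, `|Re (f t i j)| <= K /\ `|Im (f t i j)| <= K) ->
  exists L, mcvg G f L.
Proof.
move=> fK; have lim i j : exists c, ccvg G (fun t => f t i j) c.
  have [|x xP] := Gbd (u := fun t => Re (f t i j)) (K := K).
    by apply: filterS fK => t /(_ i j) [].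
  have [|y yP] := Gbd (u := fun t => Im (f t i j)) (K := K).
    by apply: filterS fK => t /(_ i j) [].
  by exists (x +i* y).
exists (\matrix_(i, j) sval (cid (lim i j))) => i j.
by rewrite mxE; exact: svalP (cid (lim i j)).
Qed.

Variables (I : finType) (v w : I -> nat).

Implicit Type F : forall l, 'M[C]_(w l, v l).

Definition famnorm (F : forall l, 'M[C]_(w l, v l)) : R :=
  \sum_l \sum_i \sum_j (`|Re (F l i j)| + `|Im (F l i j)|).

Lemma famnorm_ge F l i j : `|Re (F l i j)| + `|Im (F l i j)| <= famnorm F.
Proof.
apply: (le_trans _ (term_le_sum l _)) => [|k]; last first.
  by apply: sumr_ge0 => ? _; apply: sumr_ge0 => ? _; rewrite addr_ge0.
apply: (le_trans _ (term_le_sum i _)) => [|k]; last first.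
  by apply: sumr_ge0 => ? _; rewrite addr_ge0.
by apply: (term_le_sum (f := fun j => `|Re (F l i j)| + `|Im (F l i j)|)) => k; rewrite addr_ge0.
Qed.

Lemma famnorm_gt0 F : (exists l, F l != 0) -> 0 < famnorm F.
Proof.
move=> [l nz]; rewrite ltNge; apply: contra nz => h; apply/eqP/matrixP => i j.
have := le_trans (famnorm_ge F i j) h; rewrite mxE => h'.
have h1 := normr_ge0 (Re (F l i j)); have h2 := normr_ge0 (Im (F l i j)).
by apply: C_eq => /=; apply/eqP; rewrite -normr_le0; lra.
Qed.

Lemma famnorm_scale (c : R) F :
  famnorm (fun l => c%:C *: F l) = `|c| * famnorm F.
Proof.
rewrite /famnorm !mulr_sumr; apply: eq_bigr => l _.
rewrite !mulr_sumr; apply: eq_bigr => i _.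
rewrite !mulr_sumr; apply: eq_bigr => j _.
by rewrite !mxE cReM cImM /= !mul0r subr0 addr0 !normrM mulrDr.
Qed.

(** Scaling to norm 1 makes the entries bounded, so that they converge, and
    keeps the limit of norm 1, hence nonzero. *)
Lemma normalise (F : T -> forall l, 'M[C]_(w l, v l)) :
  (\forall t \near G, exists l, F t l != 0) ->
  exists (c : T -> C) (Phi : forall l, 'M[C]_(w l, v l)),
    [/\ \forall t \near G, c t != 0,
        forall l, mcvg G (fun t => c t *: F t l) (Phi l)
      & exists l, Phi l != 0].
Proof.
move=> Fn; pose k t := (famnorm (F t))^-1.
have kn : \forall t \near G, famnorm (fun l => (k t)%:C *: F t l) = 1.
  apply: filterS Fn => t /famnorm_gt0 f0.
  by rewrite famnorm_scale /k gtr0_norm ?invr_gt0 // mulVf // gt_eqF.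
have /dep_choice [Phi PhiP] : forall l, exists L, mcvg G (fun t => (k t)%:C *: F t l) L.
  move=> l; apply: (mcvg_bounded (K := 1)); apply: filterS kn => t <- i j.
  have := famnorm_ge (fun l => (k t)%:C *: F t l) i j.
  by move=> h; split; apply: le_trans h; rewrite ?lerDl ?lerDr.
exists (fun t => (k t)%:C), Phi; split=> //.
  apply: filterS Fn => t /famnorm_gt0 f0; rewrite /k.
  by rewrite eq_complex /= eqxx andbT invr_eq0 gt_eqF.
apply: contrapT => Phi0.
have P0 l : Phi l = 0 by apply/eqP/negPn/negP => h; apply: Phi0; exists l.
have : famnorm (fun l => (k t)%:C *: F t l) @[t --> G] --> (0 : R).
  have <- : famnorm Phi = 0.
    rewrite /famnorm big1 // => l _; rewrite big1 // => i _; rewrite big1 // => j _.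
    by rewrite P0 mxE /= normr0 addr0.
  apply: rcvg_sum => l _; apply: rcvg_sum => i _; apply: rcvg_sum => j _.
  by have [h1 h2] := PhiP l i j; apply: cvgD; apply: cvg_norm.
move=> /(@cvgr_lt _ _ _ _ _) /(_ 1 ltr01) h.
have : \forall t \near G, False.
  near=> t.
  have : famnorm (fun l => (k t)%:C *: F t l) < 1 by near: t.
  have -> : famnorm (fun l => (k t)%:C *: F t l) = 1 by near: t.
  by rewrite ltxx.
by move=> /filter_ex [].
Unshelve. all: by end_near. Qed.
End Normalise.

(** * Degenerations of a filtered representation *)

Section Degeneration.
Variables (R : realType) (Q : quiver) (T : Type) (G : set_system T).
Context {GF : ProperFilter G}.
Hypothesis Gbd : forall (u : T -> R) (K : R), (\forall t \near G, `|u t| <= K) ->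
      exists l : R, u t @[t --> G] --> l.
Local Notation C := R[i].
Local Notation qrep := (qrep R[i] Q).
Implicit Types M N E S : qrep.

(** E lies in the closure of the orbit of M, in suitable coordinates at each
    vertex. *)
Definition degenerates M E : Prop :=
  exists (v : vertex Q -> nat) (A : T -> Rep R v) (B : Rep R v),
  [/\ \forall t \near G, isomorphic M (qrep_of (A t)),
      forall a, mcvg G (fun t => A t a) (B a)
    & isomorphic (qrep_of B) E].

Lemma dimvec_mx (v : vertex Q -> nat) (A : Rep R v) l : dimvec (qrep_of A) l = v l.
Proof. rewrite /dimvec dimvf dim_matrix; exact: muln1. Qed.

Lemma degenerates_dim M E : degenerates M E -> forall l, dimvec M l = dimvec E l.
Proof.
move=> [v [A [B [MA _ BE]]]] l; have [t MAt] := filter_ex MA.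
by rewrite (iso_dim MAt) -(iso_dim BE) !dimvec_mx.
Qed.

(** The cokernel of a homomorphism of matrix representations, as a matrix
    representation on the space of the chosen section. *)
Lemma coker_rep (d v r : vertex Q -> nat) (S : Rep R d) (A : Rep R v)
    (F : forall l, 'M[C]_(v l, d l)) (c : forall l, 'M[C]_(v l, r l))
    (q : forall l, 'M[C]_(r l, v l)) :
  intertwines S A F -> (forall l, presents_coker (F l) (c l) (q l)) ->
  let A' : Rep R r := fun a => q (tgt a) *m A a *m c (src a) in
  [/\ is_hom (mxfam q A A'), surj_fam (mxfam q A A') &
     forall l x, mxfam q A A' l x = 0 <-> exists y, x = F l *m y].
Proof.
move=> SA qP A'; split.
- apply: mxfam_hom => a; apply: eq_mulmx_cV => x.
  have [qF qc qk] := qP (src a); have [qF' _ _] := qP (tgt a).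
  have [|y yE] := qk (x - c (src a) *m (q (src a) *m x)).
    by rewrite mulmxBr !mulmxA qc mul1mx subrr.
  have {1}-> : x = F (src a) *m y + c (src a) *m (q (src a) *m x).
    by rewrite -yE subrK.
  rewrite mulmxDr -!mulmxA [A a *m (F _ *m y)]mulmxA -SA -!mulmxA.
  by rewrite [q (tgt a) *m (F _ *m _)]mulmxA qF' mul0mx add0r /A' !mulmxA.
- move=> l y; have [_ qc _] := qP l.
  by exists (c l *m y); rewrite mxfamE mulmxA qc mul1mx.
- move=> l x; rewrite mxfamE; have [qF _ qk] := qP l; split; first exact: qk.
  by move=> [y ->]; rewrite mulmxA qF mul0mx.
Qed.

(** Rescaling a homomorphism leaves its cokernel alone, so the inclusions of S
    in the representations near E may be normalised to have a nonzero limit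
    phi. When phi is still injective, the cokernels converge as well. *)
Lemma degenerates_step S M M' E (f : famhom S M) (g : famhom M M') :
  exact f g -> (exists l, (0 < dimvec S l)%N) -> degenerates M E ->
  exists phi : famhom S E,
    [/\ is_hom phi, nonzero_fam phi &
     forall E' (psi : famhom E E'), exact phi psi -> degenerates M' E'].
Proof.
move=> fg [l0 S0] [v [A [B [MA AB BE]]]].
have [fh gh fi gs ke] := fg.
have [d [S' SS]] := qrep_mx S.
have [u [w [uh wh uK wK]]] := iso_inv SS.
have /dep_choice [h hP] : forall t, exists h : famhom M (qrep_of (A t)),
    isomorphic M (qrep_of (A t)) -> is_hom h /\ forall l, bijective (h l).
  move=> t; have [[h [hb hh]]|nM] := pselect (isomorphic M (qrep_of (A t))).
    by exists h.
  by exists (fun l => 0).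
pose F t l := mx_of_lfun (h t l \o f l \o w l)%VF.
have FE t l x : F t l *m x = h t l (f l (w l x)).
  by rewrite mx_of_lfunE 2!comp_lfunE.
have Fn : \forall t \near G, exists l, F t l != 0.
  apply: filterS MA => t /hP [hh hb]; exists l0; apply/eqP => F0.
  have [x0 x0n] : exists x : rspace S l0, x != 0.
    exists (vpick {: rspace S l0}); rewrite vpick0.
    by apply: contraTneq S0; rewrite /dimvec => ->; rewrite dimv0.
  have := FE t l0 (u l0 x0); rewrite F0 mul0mx uK.
  move/eqP; rewrite eq_sym => /eqP h0.
  have : f l0 x0 = 0 by apply: (bij_inj (hb l0)); rewrite h0 linear0.
  by rewrite -(linear0 (f l0)) => /fi /eqP; rewrite (negPf x0n).
have [c [Phi [cn FP [l1 P1]]]] := normalise Gbd Fn.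
have Fint : \forall t \near G, intertwines S' (A t) (fun l => c t *: F t l).
  apply: filterS MA => t /hP [hh hb] a; apply: eq_mulmx_cV => x.
  rewrite -!scalemxAl -!scalemxAr -!scalemxAl -!mulmxA !FE; congr (_ *: _).
  have := wh a x; rewrite arrowE => ->.
  by rewrite fh hh arrowE.
(* Being a homomorphism is a closed condition. *)
have Pint : intertwines S' B Phi.
  move=> a; apply: (mcvg_unique (mcvgM (FP (tgt a)) (mcvg_cst (S' a)))
     (mcvgM (AB a) (FP (src a)))).
  by apply: filterS Fint => t /(_ a).
have [th [th' [thh thh' thK thK']]] := iso_inv BE.
pose phi : famhom S E := comph th (comph (mxfam Phi S' B) u).
have phiE l x : phi l x = th l (Phi l *m u l x).
  by rewrite /phi !comphE mxfamE.
exists phi; split.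
- by apply: hom_comp => //; apply: hom_comp => //; exact: mxfam_hom.
- apply: contrapT => nz; move: P1 => /eqP; apply; apply: eq_mulmx_cV => x.
  rewrite mul0mx; apply: contrapT => Px; apply: nz; exists l1, (w l1 x).
  rewrite phiE wK => /(congr1 (th' l1)); rewrite thK linear0 => Px0.
  exact: Px Px0.
move=> E' psi [_ psih phii psis psik].
have Pinj l : forall x : 'cV_(d l), Phi l *m x = 0 -> x = 0.
  move=> x Px; apply: (can_inj (wK l)); rewrite linear0; apply: phii.
  by rewrite linear0 phiE wK Px linear0.
(* one section per vertex for both the nearby quotients and their limit *)
have cok l := coker_limit (FF := GF) (FP l) (Pinj l).
have [r /dep_choice [cc /dep_choice [q /dep_choice [q0 qP]]]] := dep_choice cok.
pose A' t : Rep R r := fun a => q (tgt a) t *m A t a *m cc (src a).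
pose B' : Rep R r := fun a => q0 (tgt a) *m B a *m cc (src a).
have cokt : \forall t \near G, forall l, presents_coker (c t *: F t l) (cc l) (q l t).
  apply: filter_forall => l; by have [_ _] := qP l.
exists r, A', B'; split.
- near=> t.
  have MAt : isomorphic M (qrep_of (A t)) by near: t.
  have [hh hb] := hP t MAt.
  have Ft : intertwines S' (A t) (fun l => c t *: F t l) by near: t.
  have ct : forall l, presents_coker (c t *: F t l) (cc l) (q l t) by near: t.
  have c0 : c t != 0 by near: t.
  have [kh ks kk] := coker_rep Ft ct.
  apply: (coker_unique gh (hom_comp kh hh) gs).
    move=> l y; have [x <-] := ks l y; have [h' _ hK] := hb l.
    by exists (h' x); rewrite comphE hK.
  move=> l x; rewrite ke comphE kk; split=> [[y ->]|[y]].
    exists ((c t)^-1 *: u l y).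
    by rewrite -scalemxAl -scalemxAr scalerA mulfV // scale1r FE uK.
  rewrite -scalemxAl FE -!linearZ => /(bij_inj (hb l)) ->.
  by exists (c t *: w l y); rewrite !linearZ.
- move=> a; apply: mcvgM (mcvg_cst _); apply: mcvgM => //.
  by have [] := qP (tgt a).
- have q0c l : presents_coker (Phi l) (cc l) (q0 l) by have [_] := qP l.
  have [kh ks kk] := coker_rep Pint q0c.
  apply: (coker_unique kh (hom_comp psih thh) ks).
    move=> l y; have [x <-] := psis l y.
    by exists (th' l x); rewrite comphE thK'.
  move=> l x; rewrite kk comphE psik; split=> -[y yE].
    by exists (w l y); rewrite phiE wK yE.
  exists (u l y); apply: (can_inj (thK l)); rewrite yE phiE //.
Unshelve. all: by end_near. Qed.

Variable alpha : vertex Q -> C.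
Hypothesis alpha_imag : forall l, Re (alpha l) = 0.

Lemma posexcess_ge0 lam (s : seq qrep) : 0 <= posexcess alpha lam s.
Proof. by apply: sumr_ge0 => X _; rewrite le_max lexx orbT. Qed.

Lemma posexcess_mid lam (e1 e2 : seq qrep) X :
  posexcess alpha lam (e1 ++ X :: e2) =
  Num.max (excess alpha lam (dimvec X)) 0 + posexcess alpha lam (e1 ++ e2).
Proof. by rewrite /posexcess !big_cat big_cons /= addrCA. Qed.

Lemma all_stable_mid (e1 e2 : seq qrep) X : all_stable alpha (e1 ++ X :: e2) ->
  stable alpha X /\ all_stable alpha (e1 ++ e2).
Proof.
by rewrite /all_stable !all_cat /= => /and3P[-> /asboolP sX ->].
Qed.

(** At the slope of the first piece no other piece contributes. *)
Lemma posexcess_top (S : qrep) (s : seq qrep) : stable alpha S -> all_stable alpha s ->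
  slopes_decrease alpha (S :: s) -> posexcess alpha (rslope alpha (dimvec S)) (S :: s) = 0.
Proof.
move=> sS /=; rewrite /posexcess big_cons excess_rslope maxxx add0r.
elim: s => [|X s IHs] /= ; first by rewrite big_nil.
move=> /andP[/asboolP [rX _] ss] /andP[/andP[XS sS'] /andP[_ sd]].
rewrite big_cons max_r ?excess_le0 // add0r; apply: IHs => //.
by rewrite sS' sd.
Qed.

(** The induction along the filtration. The first piece S has the largest slope
    mu, so that posexcess mu s = 0; hence posexcess mu e = 0, and all the pieces
    of the limit have slope at most mu. A nonzero component S -> X of the limit
    of the inclusions is then an isomorphism, X splits off, and
    [degenerates_step] passes to the quotients. The inequality survives, since
    equal terms are removed on both sides. *)
Lemma degenerates_graded (s e : seq qrep) M :
  filtered M s -> all_stable alpha s -> slopes_decrease alpha s ->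
  all_stable alpha e ->
  (forall lam, posexcess alpha lam e <= posexcess alpha lam s) ->
  degenerates M (dsum e) -> isomorphic (dsum e) (dsum s).
Proof.
elim: s e M => [|S s IHs] e M.
  move=> M0 _ _ _ _ /degenerates_dim Me; apply: iso_dim0 => l.
    by rewrite -Me; exact: M0.
  by rewrite /dimvec dimvf dim_matrix.
move=> [M' [f [g [fg Fs]]]] sSs sd se le_es Me.
have [sS ss] : stable alpha S /\ all_stable alpha s.
  by move: sSs => /andP[/asboolP].
have [sd1 sd2] := andP sd.
have S0 : exists l, (0 < dimvec S l)%N.
  apply: contrapT => n0; have [+ _] := sS; rewrite /rank big1 // => l _.
  by apply/eqP; rewrite -leqn0 leqNgt; apply/negP => h; apply: n0; exists l.
have [phi [phih phin phiE]] := degenerates_step fg S0 Me.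
have [e1 [X [e2 [p [q [eE ph qh pn [pqi pqs]]]]]]] := dsum_component phih phin.
subst e; have [sX se'] := all_stable_mid se.
have XS : rslope alpha (dimvec X) <= rslope alpha (dimvec S).
  have [rX _] := sX; rewrite -excess_le0 //.
  have := le_es (rslope alpha (dimvec S)); rewrite posexcess_top // posexcess_mid.
  have := posexcess_ge0 (rslope alpha (dimvec S)) (e1 ++ e2).
  set a := Num.max _ _; have : excess alpha (rslope alpha (dimvec S)) (dimvec X) <= a.
    by rewrite /a le_max lexx.
  by move: a => a h1 h2 h3; apply: (le_trans h1); lra.
have pph := hom_comp ph phih.
have [ki ks] := schur alpha_imag sS sX XS pph pn.
have isoSX : isomorphic S X := inj_surj_iso pph ki ks.
have [k kP] : exists k : famhom X S, forall l,
    cancel (comph p phi l) (k l) /\ cancel (k l) (comph p phi l).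
  exact: (dep_choice (fun l => lfun_inv (ki l) (ks l))).
have kh : is_hom k.
  move=> a x; apply: (can_inj (kP _).1); rewrite (kP _).2 pph.
  by rewrite (kP (src a)).2.
pose D := dsum (e1 ++ e2).
(* phi need not be the inclusion of the summand X; its other components are
   subtracted to get a projection whose kernel is the image of phi. *)
pose psi : famhom (dsum (e1 ++ X :: e2)) D :=
  fun l => (q l - (q l \o phi l \o k l \o p l))%VF.
have psiE l z : psi l z = q l (z - phi l (k l (p l z))).
  by rewrite /psi add_lfunE opp_lfunE 3!comp_lfunE linearB.
have MD : degenerates M' D.
  apply: (phiE D psi); split=> //.
  - move=> a z; rewrite !psiE -qh; congr (q _ _).
    by rewrite linearB /= -phih -kh -ph.
  - move=> l x y xy; apply: (ki l); rewrite !comphE xy //.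
  - move=> l y; have [z [pz qz]] := pqs l 0 y; exists z.
    by rewrite psiE pz !linear0 addr0.
  - move=> l z; rewrite psiE; split=> [qz|[y ->]]; last first.
      by have := (kP l).1 y; rewrite comphE => ->; rewrite subrr linear0.
    exists (k l (p l z)); apply/eqP; rewrite -subr_eq0; apply/eqP.
    apply: pqi qz; have := (kP l).2 (p l z); rewrite comphE => h.
    by rewrite linearB /= h subrr.
have lee : forall lam, posexcess alpha lam (e1 ++ e2) <= posexcess alpha lam s.
  move=> lam; have := le_es lam; rewrite posexcess_mid {2}/posexcess big_cons.
  rewrite -/(posexcess alpha lam s).
  have -> : excess alpha lam (dimvec X) = excess alpha lam (dimvec S).
    by apply: excess_eq => l; rewrite (iso_dim isoSX).
  by rewrite lerD2l.
apply: iso_trans (iso_dsum2 ph qh pqi pqs) _.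
apply: dsum2_iso; first exact: iso_sym.
exact: IHs Fs ss sd2 se' lee MD.
Qed.

End Degeneration.

(** * Orthogonal projections *)

Section Hermitian.
Variables (R : realType).
Local Notation C := R[i].

Lemma hadjK m n (X : 'M[C]_(m, n)) : adj (adj X) = X.
Proof. by apply/matrixP => i j; rewrite !mxE conjCK. Qed.
Lemma hadj0 m n : adj (0 : 'M[C]_(m, n)) = 0.
Proof. by apply/matrixP => i j; rewrite !mxE rmorph0. Qed.
Lemma hadjD m n (X Y : 'M[C]_(m, n)) : adj (X + Y) = adj X + adj Y.
Proof. by apply/matrixP => i j; rewrite !mxE rmorphD. Qed.
Lemma hadjN m n (X : 'M[C]_(m, n)) : adj (- X) = - adj X.
Proof. by apply/matrixP => i j; rewrite !mxE rmorphN. Qed.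
Lemma hadjB m n (X Y : 'M[C]_(m, n)) : adj (X - Y) = adj X - adj Y.
Proof. by rewrite hadjD hadjN. Qed.
Lemma hadjM m n p (X : 'M[C]_(m, n)) (Y : 'M[C]_(n, p)) :
  adj (X *m Y) = adj Y *m adj X.
Proof.
apply/matrixP => i j; rewrite !mxE rmorph_sum; apply: eq_bigr => k _.
by rewrite !mxE rmorphM mulrC.
Qed.
Lemma conj_real (c : R) : Num.conj (c%:C : C) = c%:C.
Proof. by apply: C_eq; rewrite ?cReJ ?cImJ //= oppr0. Qed.
Lemma hadjZ m n (c : R) (X : 'M[C]_(m, n)) : adj (c%:C *: X) = c%:C *: adj X.
Proof.
by apply/matrixP => i j; rewrite !mxE rmorphM; congr (_ * _); exact: conj_real.
Qed.
Lemma hadj1 n : adj (1%:M : 'M[C]_n) = 1%:M.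
Proof. by apply/matrixP => i j; rewrite !mxE rmorph_nat eq_sym. Qed.
Lemma hadj_scalar n (c : R) : adj ((c%:C)%:M : 'M[C]_n) = (c%:C)%:M.
Proof. by rewrite -scalemx1 hadjZ hadj1. Qed.
Lemma hadj_sum m n I (r : seq I) (P : pred I) (F : I -> 'M[C]_(m, n)) :
  adj (\sum_(i <- r | P i) F i) = \sum_(i <- r | P i) adj (F i).
Proof. by apply: (big_morph (@adj R m n) (@hadjD m n) (hadj0 m n)). Qed.
Lemma mxtrace_adj n (X : 'M[C]_n) : \tr (adj X) = Num.conj (\tr X).
Proof. by rewrite /mxtrace rmorph_sum; apply: eq_bigr => i _; rewrite !mxE. Qed.

(** The real inner product underlying the hermitian trace form, with respect to
    which the gradient is taken. *)
Definition rip m n (X Y : 'M[C]_(m, n)) : R := Re (\tr (adj X *m Y)).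

Lemma ripE m n (X Y : 'M[C]_(m, n)) : rip X Y =
  \sum_j \sum_i (Re (X i j) * Re (Y i j) + Im (X i j) * Im (Y i j)).
Proof.
rewrite /rip /mxtrace cRe_sum; apply: eq_bigr => j _.
rewrite mxE cRe_sum; apply: eq_bigr => i _.
by rewrite !mxE cReM cReJ cImJ mulNr opprK.
Qed.

Lemma ripC m n (X Y : 'M[C]_(m, n)) : rip X Y = rip Y X.
Proof.
rewrite !ripE; apply: eq_bigr => j _; apply: eq_bigr => i _.
by rewrite mulrC [Im _ * _]mulrC.
Qed.
Lemma ripDr m n (X Y Z : 'M[C]_(m, n)) : rip X (Y + Z) = rip X Y + rip X Z.
Proof. by rewrite /rip mulmxDr mxtraceD cReD. Qed.
Lemma ripDl m n (X Y Z : 'M[C]_(m, n)) : rip (X + Y) Z = rip X Z + rip Y Z.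
Proof. by rewrite ripC ripDr !(ripC Z). Qed.
Lemma ripNr m n (X Y : 'M[C]_(m, n)) : rip X (- Y) = - rip X Y.
Proof. by rewrite /rip mulmxN raddfN cReN. Qed.
Lemma ripNl m n (X Y : 'M[C]_(m, n)) : rip (- X) Y = - rip X Y.
Proof. by rewrite ripC ripNr ripC. Qed.
Lemma ripZr m n (c : R) (X Y : 'M[C]_(m, n)) : rip X (c%:C *: Y) = c * rip X Y.
Proof. by rewrite /rip -scalemxAr mxtraceZ cReM /= mul0r subr0. Qed.
Lemma ripZl m n (c : R) (X Y : 'M[C]_(m, n)) : rip (c%:C *: X) Y = c * rip X Y.
Proof. by rewrite ripC ripZr ripC. Qed.
Lemma rip0r m n (X : 'M[C]_(m, n)) : rip X 0 = 0.
Proof. by rewrite /rip mulmx0 mxtrace0. Qed.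
Lemma rip0l m n (X : 'M[C]_(m, n)) : rip 0 X = 0.
Proof. by rewrite ripC rip0r. Qed.
Lemma rip_adj m n p (A : 'M[C]_(m, n)) (X : 'M[C]_(m, p)) (Y : 'M[C]_(n, p)) :
  rip X (A *m Y) = rip (adj A *m X) Y.
Proof. by rewrite /rip hadjM hadjK mulmxA. Qed.

Definition nsq m n (X : 'M[C]_(m, n)) : R := rip X X.

Lemma nsqE m n (X : 'M[C]_(m, n)) : nsq X =
  \sum_j \sum_i (Re (X i j) ^+ 2 + Im (X i j) ^+ 2).
Proof. by rewrite /nsq ripE. Qed.

Lemma nsq_ge0 m n (X : 'M[C]_(m, n)) : 0 <= nsq X.
Proof.
rewrite nsqE; apply: sumr_ge0 => j _; apply: sumr_ge0 => i _.
by rewrite addr_ge0 ?sqr_ge0.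
Qed.

Lemma nsq_ge_entry m n (X : 'M[C]_(m, n)) i j :
  Re (X i j) ^+ 2 + Im (X i j) ^+ 2 <= nsq X.
Proof.
rewrite nsqE; have pos j' : 0 <= \sum_i (Re (X i j') ^+ 2 + Im (X i j') ^+ 2).
  by apply: sumr_ge0 => i' _; rewrite addr_ge0 ?sqr_ge0.
apply: le_trans (term_le_sum j pos).
by apply: (term_le_sum (f := fun i => Re (X i j) ^+ 2 + Im (X i j) ^+ 2)) => i';
  rewrite addr_ge0 ?sqr_ge0.
Qed.

Lemma nsq_eq0 m n (X : 'M[C]_(m, n)) : nsq X = 0 -> X = 0.
Proof.
move=> X0; apply/matrixP => i j; have := nsq_ge_entry X i j; rewrite X0 mxE.
have h1 := sqr_ge0 (Re (X i j)); have h2 := sqr_ge0 (Im (X i j)).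
by move=> h; apply: C_eq => /=; apply/eqP; rewrite -sqrf_eq0 eq_le; apply/andP; split; lra.
Qed.

Lemma nsq_gt0 m n (X : 'M[C]_(m, n)) : X != 0 -> 0 < nsq X.
Proof.
move=> X0; rewrite lt_neqAle nsq_ge0 andbT eq_sym.
by apply: contra X0 => /eqP /nsq_eq0 ->.
Qed.

(** X* X u = 0 gives |X u|^2 = 0. *)
Lemma gram_unit m n (X : 'M[C]_(m, n)) :
  (forall c : 'cV_n, X *m c = 0 -> c = 0) -> adj X *m X \in unitmx.
Proof.
move=> Xi; rewrite -unitmx_tr -row_free_unit; apply: inj_row_free => u u0.
apply: trmx_inj; rewrite trmx0; apply: Xi; apply: nsq_eq0.
rewrite /nsq rip_adj mulmxA; have -> : adj X *m X *m u^T = 0.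
  by apply: trmx_inj; rewrite trmx_mul trmxK u0 trmx0.
by rewrite rip0l.
Qed.

Lemma hadj_inv n (G : 'M[C]_n) : G \in unitmx -> adj (invmx G) = invmx (adj G).
Proof.
move=> Gu; have h : adj (invmx G) *m adj G = 1%:M by rewrite -hadjM mulmxV // hadj1.
have [_ gu] := mulmx1_unit h.
by rewrite -[LHS]mulmx1 -(mulmxV gu) mulmxA h mul1mx.
Qed.

(** Orthogonal projections stand for subspaces: reducing a representation is
    then an equation between matrices, and dimensions are traces. *)
Definition orthoproj n (P : 'M[C]_n) : Prop := adj P = P /\ P *m P = P.

Definition fixsp n (P : 'M[C]_n) : {vspace 'cV[C]_n} :=
  lker (linfun (mulmx (P - 1%:M))).

Lemma mem_fixsp n (P : 'M[C]_n) x : (x \in fixsp P) = (P *m x == x).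
Proof. by rewrite memv_ker lfunE /= mulmxBl mul1mx subr_eq0. Qed.

Lemma fixspP n (P : 'M[C]_n) x : reflect (P *m x = x) (x \in fixsp P).
Proof. by rewrite mem_fixsp; apply: eqP. Qed.

Lemma orthoproj_eq n (P N : 'M[C]_n) : orthoproj P -> orthoproj N ->
  fixsp P = fixsp N -> P = N.
Proof.
move=> [Pa PP] [Na NN] PN.
have h1 : P *m N = N.
  apply: eq_mulmx_cV => x; rewrite -mulmxA; apply/fixspP; rewrite PN.
  by apply/fixspP; rewrite mulmxA NN.
have h2 : N *m P = P.
  apply: eq_mulmx_cV => x; rewrite -mulmxA; apply/fixspP; rewrite -PN.
  by apply/fixspP; rewrite mulmxA PP.
by rewrite -Pa -h2 hadjM Pa Na h1.
Qed.

Lemma basis_mx n (U : {vspace 'cV[C]_n}) : exists X : 'M[C]_(n, \dim U),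
  (forall c : 'cV_(\dim U), X *m c = 0 -> c = 0) /\
  (forall x, x \in U <-> exists c, x = X *m c).
Proof.
pose b := vbasis U; pose X := \matrix_(i < n, j < \dim U) (b`_j : 'cV[C]_n) i 0.
have XE c : X *m c = \sum_j c j 0 *: b`_j.
  apply/colP => i; rewrite mxE summxE; apply: eq_bigr => j _.
  by rewrite !mxE mulrC.
exists X; split=> [c|x].
  rewrite XE => c0; apply/colP => j; rewrite mxE.
  have fb : free b := basis_free (vbasisP U).
  by rewrite -(coord_sum_free (fun j => c j 0) j fb) c0 linear0.
split=> [xU|[c ->]]; last first.
  by rewrite XE; apply: memv_suml => j _; rewrite memvZ // vbasis_mem // mem_nth // size_tuple.
exists (\col_j coord b j x); rewrite XE [LHS](coord_vbasis xU).
by apply: eq_bigr => j _; rewrite mxE.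
Qed.

(** For a basis X of U, the projection is X (X* X)^-1 X*. *)
Lemma orthoproj_exists n (U : {vspace 'cV[C]_n}) :
  exists P : 'M[C]_n, [/\ orthoproj P, fixsp P = U & \tr P = (\dim U)%:R].
Proof.
have [X [Xi XU]] := basis_mx U; have Gu := gram_unit Xi.
set Gm := adj X *m X in Gu; pose P := X *m invmx Gm *m adj X.
have aG : adj Gm = Gm by rewrite /Gm hadjM hadjK.
have PX : P *m X = X by rewrite /P -!mulmxA -/Gm mulVmx // mulmx1.
exists P; split.
- split; first by rewrite /P !hadjM hadjK hadj_inv // aG mulmxA.
  by rewrite {2}/P !mulmxA PX.
- apply/vspaceP => x; apply/fixspP/idP => [<-|/XU [c ->]]; last by rewrite mulmxA PX.
  by apply/XU; exists (invmx Gm *m (adj X *m x)); rewrite /P !mulmxA.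
- by rewrite /P mxtrace_mulC mulmxA -/Gm mulmxV // mxtrace1.
Qed.

Lemma tr_orthoproj n (P : 'M[C]_n) : orthoproj P -> \tr P = (\dim (fixsp P))%:R.
Proof.
by move=> Po; have [N [No /esym NP <-]] := orthoproj_exists (fixsp P);
  rewrite (orthoproj_eq Po No NP).
Qed.

Lemma Re_tr_orthoproj n (P : 'M[C]_n) : orthoproj P ->
  Re (\tr P) = (\dim (fixsp P))%:R.
Proof.
by move=> Po; rewrite (tr_orthoproj Po) -(rmorph_nat (real_complex R)).
Qed.

Lemma orthoproj_le n (P N : 'M[C]_n) : orthoproj P -> orthoproj N ->
  (fixsp N <= fixsp P)%VS -> P *m N = N /\ N *m P = N.
Proof.
move=> [Pa PP] [Na NN] /subvP NP.
have h : P *m N = N.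
  apply: eq_mulmx_cV => x; rewrite -mulmxA; apply/fixspP/NP.
  by apply/fixspP; rewrite mulmxA NN.
by split=> //; rewrite -Pa -[in LHS]Na -hadjM h Na.
Qed.

End Hermitian.

(** * The moment map and its trace formula *)

Section Moment.
Variables (R : realType) (Q : quiver) (v : vertex Q -> nat) (alpha : vertex Q -> R[i]).
Hypothesis alpha_imag : forall l, Re (alpha l) = 0.
Local Notation C := R[i].

(** alpha is imaginary, so that i alpha = theta is real. *)
Definition theta l : R := - Im (alpha l).

(** The hermitian matrices i (Phi - alpha), in which [conform_mx] is an honest
    transport along v (tgt a) = v l or v (src a) = v l. *)
Definition hmom (A : Rep R v) l : 'M[C]_(v l) :=
  (- 2^-1)%:C *: (\sum_(a | tgt a == l) conform_mx 0 (A a *m adj (A a))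
   - \sum_(a | src a == l) conform_mx 0 (adj (A a) *m A a)) - ((theta l)%:C)%:M.

Lemma hmomE A l : 'i *: (moment A l - (alpha l)%:M) = hmom A l.
Proof.
rewrite /hmom /moment scalerBr scalerA mulrA -expr2 sqrCi; congr (_ *: _ - _).
  by rewrite mulN1r rmorphN fmorphV rmorph_nat.
rewrite scale_scalar_mx; congr (_%:M).
have -> : alpha l = 0 +i* Im (alpha l) by rewrite -[in RHS](alpha_imag l); case: (alpha l).
by apply/eqP; rewrite eq_complex /=; apply/andP; split; apply/eqP; rewrite /theta /=; ring.
Qed.

(** Summing over the vertices the terms attached to them is summing over the
    arrows; this removes all the transports at once. *)
Lemma sum_conform (g : arrow Q -> vertex Q) (X : forall a, 'M[C]_(v (g a)))
    (V : zmodType) (phi : forall l, 'M[C]_(v l) -> V) :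
  (forall l x y, phi l (x + y) = phi l x + phi l y) ->
  \sum_l phi l (\sum_(a | g a == l) conform_mx 0 (X a)) = \sum_a phi (g a) (X a).
Proof.
move=> phiD; have phi0 l : phi l 0 = 0.
  by apply: (addrI (phi l 0)); rewrite -phiD !addr0.
under eq_bigr => l _ do rewrite (big_morph (phi l) (phiD l) (phi0 l)).
rewrite (exchange_big_dep xpredT) //=; apply: eq_bigr => a _.
by rewrite (big_pred1 (g a)) ?conform_mx_id // => l; rewrite eq_sym.
Qed.

(** Once l is replaced by g a, the transport is the identity. *)
Lemma conform_map (g : arrow Q -> vertex Q) l a (X : 'M[C]_(v (g a)))
    (phi : forall l, 'M[C]_(v l) -> 'M[C]_(v l)) : g a = l ->
  phi l (conform_mx 0 X) = conform_mx 0 (phi (g a) X).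
Proof. by case: l /; rewrite !conform_mx_id. Qed.

Lemma hmom_herm A l : adj (hmom A l) = hmom A l.
Proof.
rewrite /hmom hadjB hadj_scalar; congr (_ - _).
rewrite hadjZ; congr (_ *: _).
rewrite hadjB !hadj_sum; congr (_ - _).
  apply: eq_bigr => a /eqP e; rewrite (conform_map _ (fun l => @adj R _ _) e).
  by rewrite hadjM hadjK.
apply: eq_bigr => a /eqP e; rewrite (conform_map _ (fun l => @adj R _ _) e).
by rewrite hadjM hadjK.
Qed.

Lemma hmom_comm A (P : forall l, 'M[C]_(v l)) :
  (forall a, P (tgt a) *m A a = A a *m P (src a)) ->
  (forall a, P (src a) *m adj (A a) = adj (A a) *m P (tgt a)) ->
  forall l, P l *m hmom A l = hmom A l *m P l.
Proof.
move=> PA PA' l; rewrite /hmom mulmxBr mulmxBl mul_mx_scalar mul_scalar_mx.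
congr (_ - _); rewrite -scalemxAr -scalemxAl; congr (_ *: _).
rewrite mulmxBr mulmxBl !mulmx_sumr !mulmx_suml; congr (_ - _).
  apply: eq_bigr => a /eqP e; rewrite (conform_map _ (fun l => mulmx (P l)) e).
  rewrite (conform_map _ (fun l => mulmx^~ (P l)) e).
  by rewrite mulmxA PA -!mulmxA PA'.
apply: eq_bigr => a /eqP e; rewrite (conform_map _ (fun l => mulmx (P l)) e).
rewrite (conform_map _ (fun l => mulmx^~ (P l)) e).
by rewrite mulmxA PA' -!mulmxA PA.
Qed.

Lemma sum_tr_hmom A (P : forall l, 'M[C]_(v l)) :
  \sum_l Re (\tr (P l *m hmom A l)) =
  - 2^-1 * \sum_a (Re (\tr (P (tgt a) *m (A a *m adj (A a))))
                  - Re (\tr (P (src a) *m (adj (A a) *m A a))))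
  - \sum_l theta l * Re (\tr (P l)).
Proof.
pose ph l (X : 'M[C]_(v l)) := Re (\tr (P l *m X)).
have phD l x y : ph l (x + y) = ph l x + ph l y.
  by rewrite /ph mulmxDr mxtraceD cReD.
rewrite sumrB.
rewrite -(sum_conform (g := @tgt Q) (fun a => A a *m adj (A a)) phD).
rewrite -(sum_conform (g := @src Q) (fun a => adj (A a) *m A a) phD).
rewrite -sumrB mulr_sumr -sumrB; apply: eq_bigr => l _; rewrite /ph.
rewrite /hmom mulmxBr mul_mx_scalar -scalemxAr mulmxBr.
rewrite raddfB /= !mxtraceZ raddfB /= !(cReD, cReN, cReM) /=.
by rewrite !mul0r !subr0 raddfB /= cReD cReN.
Qed.

(** Chern-Weil in disguise: for a subrepresentation, the trace of P H is minus
    its degree, less half the squared norm of the second fundamental form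
    P A - A P, which vanishes exactly when the orthogonal complement is a
    subrepresentation as well. This is what links the moment map to the slopes. *)
Lemma trace_formula A (P : forall l, 'M[C]_(v l)) :
  (forall l, orthoproj (P l)) ->
  (forall a, P (tgt a) *m (A a *m P (src a)) = A a *m P (src a)) ->
  \sum_l Re (\tr (P l *m hmom A l)) =
  - 2^-1 * \sum_a nsq (P (tgt a) *m A a - A a *m P (src a))
  - degree alpha (fun l => \dim (fixsp (P l))).
Proof.
move=> Po PA; rewrite sum_tr_hmom; congr (_ * _ - _); last first.
  apply: eq_bigr => l _; rewrite (tr_orthoproj (Po l)); congr (_ * _).
  by rewrite -(rmorph_nat (real_complex R)).
apply: eq_bigr => a _; have [Pta Ptt] := Po (tgt a); have [Psa Pss] := Po (src a).
have PA' : P (src a) *m adj (A a) *m P (tgt a) = P (src a) *m adj (A a).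
  have := congr1 (@adj R _ _) (PA a); rewrite !hadjM Pta Psa => ->.
  by [].
rewrite /nsq /rip hadjB !hadjM Pta Psa mulmxBr !mulmxBl.
have -> : adj (A a) *m P (tgt a) *m (P (tgt a) *m A a) = adj (A a) *m (P (tgt a) *m A a).
  by rewrite -!mulmxA [P (tgt a) *m (P (tgt a) *m _)]mulmxA Ptt.
have -> : P (src a) *m adj (A a) *m (P (tgt a) *m A a) = P (src a) *m (adj (A a) *m A a).
  by rewrite mulmxA PA' -mulmxA.
have -> : adj (A a) *m P (tgt a) *m (A a *m P (src a)) = adj (A a) *m A a *m P (src a).
  by rewrite -!mulmxA PA.
rewrite !raddfB /=.
have -> : \tr (P (src a) *m adj (A a) *m (A a *m P (src a))) =
    \tr (P (src a) *m (adj (A a) *m A a)).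
  by rewrite mulmxA mxtrace_mulC !mulmxA Pss.
have -> : \tr (adj (A a) *m (P (tgt a) *m A a)) = \tr (P (tgt a) *m (A a *m adj (A a))).
  by rewrite mxtrace_mulC mulmxA.
rewrite [\tr (adj (A a) *m A a *m P (src a))]mxtrace_mulC.
by ring.
Qed.

End Moment.

(** * Reducing projections of a critical representation *)

Lemma sum_le_eq (I : finType) (f g : I -> nat) :
  (forall i, (f i <= g i)%N) -> (\sum_i g i <= \sum_i f i)%N -> forall i, f i = g i.
Proof.
move=> fg le i; apply/eqP; rewrite eqn_leq fg /= leqNgt; apply/negP => lt.
move: le; rewrite (bigD1 i) //= [X in (_ <= X)%N](bigD1 i) //= leqNgt => /negP; apply.
by rewrite -addSn; apply: leq_add => //; apply: leq_sum.
Qed.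

Section Critical.
Variables (R : realType) (Q : quiver) (v : vertex Q -> nat) (alpha : vertex Q -> R[i]).
Local Notation C := R[i].
Variable A : Rep R v.
Local Notation H := (hmom alpha A).
Hypothesis crit : forall a, H (tgt a) *m A a = A a *m H (src a).

Definition mxfamily := forall l, 'M[C]_(v l).
Implicit Types P N rho : mxfamily.

(** P projects onto an orthogonal direct summand of A: its image and its kernel
    are subrepresentations. *)
Definition reducing P : Prop :=
  (forall l, orthoproj (P l)) /\ forall a, P (tgt a) *m A a = A a *m P (src a).

Definition imfam P : subfamily (qrep_of A) := fun l => fixsp (P l).

Definition rk P : nat := (\sum_l \dim (fixsp (P l)))%N.

Lemma reducing_adj P : reducing P ->
  forall a, P (src a) *m adj (A a) = adj (A a) *m P (tgt a).
Proof.
move=> [Po PA] a; have := congr1 (@adj R _ _) (PA a); rewrite !hadjM.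
by have [-> _] := Po (tgt a); have [-> _] := Po (src a).
Qed.

Lemma reducing_hmom P : reducing P -> forall l, P l *m H l = H l *m P l.
Proof.
by move=> Pr; apply: hmom_comm; [have [] := Pr | exact: reducing_adj].
Qed.

Lemma imfam_subrepr P : (forall a, P (tgt a) *m A a = A a *m P (src a)) ->
  is_subrepr (imfam P).
Proof.
move=> PA a; apply/subvP => _ /memv_imgP [x /fixspP Px ->].
by apply/fixspP; rewrite arrowE mulmxA PA -mulmxA Px.
Qed.

Lemma crit_adj a : adj (A a) *m H (tgt a) = H (src a) *m adj (A a).
Proof. by have := congr1 (@adj R _ _) (crit a); rewrite !hadjM !hmom_herm. Qed.

(** Stability under the adjoints says that the orthogonal complement is a
    subrepresentation. *)
Lemma reducing_of_stable (U : forall l, {vspace 'cV[C]_(v l)}) :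
  (forall a x, x \in U (src a) -> A a *m x \in U (tgt a)) ->
  (forall a x, x \in U (tgt a) -> adj (A a) *m x \in U (src a)) ->
  exists P, reducing P /\ forall l, fixsp (P l) = U l.
Proof.
move=> UA UA'.
have [P PP] := dep_choice (fun l => orthoproj_exists (U l)).
exists P; split; last by move=> l; have [] := PP l.
split=> [l|a]; first by have [] := PP l.
have fixU l x : (P l *m x = x) <-> x \in U l.
  by have [_ <- _] := PP l; split=> [/fixspP|/fixspP].
have idem l : P l *m P l = P l by have [[]] := PP l.
have self l : adj (P l) = P l by have [[]] := PP l.
have h1 : P (tgt a) *m (A a *m P (src a)) = A a *m P (src a).
  apply: eq_mulmx_cV => x; rewrite -!mulmxA; apply/fixU/UA/fixU.
  by rewrite mulmxA idem.
have h2 : P (src a) *m (adj (A a) *m P (tgt a)) = adj (A a) *m P (tgt a).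
  apply: eq_mulmx_cV => x; rewrite -!mulmxA; apply/fixU/UA'/fixU.
  by rewrite mulmxA idem.
have := congr1 (@adj R _ _) h2; rewrite !hadjM !hadjK !self => <-.
by rewrite -mulmxA h1.
Qed.

Lemma rk_eq0 P : (forall l, orthoproj (P l)) -> rk P = 0%N -> forall l, P l = 0.
Proof.
move=> Po r0 l; have /eqP := r0; rewrite /rk sum_nat_eq0 => /forallP /(_ l).
rewrite dimv_eq0 => /eqP f0; apply: eq_mulmx_cV => x; rewrite mul0mx.
apply/eqP; rewrite -memv0 -f0; apply/fixspP; rewrite mulmxA.
by have [_ ->] := Po l.
Qed.

Lemma rk_le_eq rho N : (forall l, fixsp (N l) <= fixsp (rho l))%VS ->
  (rk rho <= rk N)%N -> forall l, fixsp (N l) = fixsp (rho l).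
Proof.
move=> Nr le l; apply/eqP; rewrite eqEdim Nr /=.
exact: eq_leq (esym (sum_le_eq (fun l => dimvS (Nr l)) le l)).
Qed.

(** K preserves the image of P, has an eigenvector there because the field is
    algebraically closed, and its eigenvalues are real because it is
    hermitian. *)
Lemma eigen_fixsp n (P K : 'M[C]_n) : orthoproj P -> adj K = K -> P *m K = K *m P ->
  P != 0 -> exists (mu : R) (x : 'cV[C]_n), [/\ x != 0, P *m x = x & K *m x = mu%:C *: x].
Proof.
move=> Po Ka PK P0; have [X [Xi XP]] := basis_mx (fixsp P).
have d0 : (0 < \dim (fixsp P))%N.
  rewrite lt0n dimv_eq0; apply: contra P0 => /eqP f0; apply/eqP/eq_mulmx_cV => x.
  rewrite mul0mx; apply/eqP; rewrite -memv0 -f0; apply/fixspP; rewrite mulmxA.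
  by have [_ ->] := Po.
have [M XM] : exists M, K *m X = X *m M.
  have /dep_choice [c cP] : forall j, exists c, col j (K *m X) = X *m c.
    move=> j; apply/XP/fixspP; rewrite colE !mulmxA PK -[K *m P *m X]mulmxA.
    congr (_ *m _); congr (_ *m _); apply: eq_mulmx_cV => c; rewrite -mulmxA.
    by apply/fixspP/XP; exists c.
  exists (\matrix_(i, j) c j i 0); apply/matrixP => i j.
  have /colP /(_ i) := cP j; rewrite mxE => ->; rewrite !mxE.
  by apply: eq_bigr => k _; rewrite !mxE.
have [mu /eigenvalueP [u uM u0]] := eigenvalue_closed M^T d0.
have [x xE] : exists x, x = X *m u^T by exists (X *m u^T).
have x0 : x != 0.
  rewrite xE; by apply: contra u0 => /eqP /Xi /(congr1 trmx); rewrite trmxK trmx0 => ->.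
have Kx : K *m x = mu *: x.
  rewrite xE mulmxA XM -mulmxA scalemxAr; congr (_ *m _).
  by apply: trmx_inj; rewrite trmx_mul trmxK uM linearZ /= trmxK.
have mur : mu = (Re mu)%:C.
  have h : \tr (adj x *m (K *m x)) = mu * \tr (adj x *m x).
    by rewrite Kx -scalemxAr mxtraceZ.
  have h' : Num.conj (\tr (adj x *m (K *m x))) = \tr (adj x *m (K *m x)).
    by rewrite -mxtrace_adj !hadjM hadjK Ka mulmxA.
  have im0 (z : C) : Num.conj z = z -> Im z = 0.
    by move=> /(congr1 Im); rewrite cImJ; lra.
  have r1 : Im (\tr (adj x *m (K *m x))) = 0 by apply: im0.
  have r2 : Im (\tr (adj x *m x)) = 0 by apply: im0; rewrite -mxtrace_adj hadjM hadjK.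
  have r3 : 0 < Re (\tr (adj x *m x)) by apply: nsq_gt0.
  move: r1; rewrite h cImM r2 mulr0 add0r => /eqP; rewrite mulf_eq0 (gt_eqF r3) orbF => /eqP i0.
  by apply: C_eq; rewrite /= ?i0.
exists (Re mu), x; split=> //; last by rewrite -mur.
by apply/fixspP/XP; exists u^T.
Qed.

Definition eigsp n (P K : 'M[C]_n) mu : {vspace 'cV[C]_n} :=
  (fixsp P :&: lker (linfun (mulmx (K - mu%:M))))%VS.

Lemma eigspP n (P K : 'M[C]_n) mu (x : 'cV_n) :
  (x \in eigsp P K mu) <-> P *m x = x /\ K *m x = mu *: x.
Proof.
have e : (x \in lker (linfun (mulmx (K - mu%:M)))) = (K *m x == mu *: x).
  by rewrite memv_ker lfunE /= mulmxBl mul_scalar_mx subr_eq0.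
have -> : (x \in eigsp P K mu) = (P *m x == x) && (K *m x == mu *: x).
  exact: etrans (memv_cap _ _ _) (congr2 andb (mem_fixsp P x) e).
by split=> [/andP[/eqP ? /eqP ?]|[-> ->]]; rewrite ?eqxx.
Qed.

Definition minimal rho : Prop :=
  [/\ reducing rho, (0 < rk rho)%N &
   forall N, reducing N -> (0 < rk N)%N -> (forall l, fixsp (N l) <= fixsp (rho l))%VS ->
     forall l, fixsp (N l) = fixsp (rho l)].

Lemma minimal_exists P : reducing P -> (0 < rk P)%N ->
  exists rho, minimal rho /\ (forall l, fixsp (rho l) <= fixsp (P l))%VS.
Proof.
move=> Pr P0.
pose ok n := `[< exists rho, [/\ reducing rho, (0 < rk rho)%N, rk rho = n &
   (forall l, fixsp (rho l) <= fixsp (P l))%VS] >].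
have okP : exists n, ok n by exists (rk P); apply/asboolP; exists P; split.
have [n /asboolP [rho [rr r0 rn rP]] nmin] := ex_minnP okP.
exists rho; split; last exact: rP.
split; [exact: rr | exact: r0 | move=> N Nr N0 Nrho].
apply: (rk_le_eq Nrho); rewrite rn; apply: nmin; apply/asboolP; exists N.
split; [exact: Nr | exact: N0 | by [] | move=> l].
exact: subv_trans (Nrho l) (rP l).
Qed.

Lemma rk_gt0 P l : P l != 0 -> orthoproj (P l) -> (0 < rk P)%N.
Proof.
move=> Pl [_ PP]; rewrite /rk (bigD1 l) //= ltn_addr // lt0n dimv_eq0.
apply: contra Pl => /eqP f0; apply/eqP/eq_mulmx_cV => x.
by rewrite mul0mx; apply/eqP; rewrite -memv0 -f0; apply/fixspP; rewrite mulmxA PP.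
Qed.

(** As H commutes with A and its adjoint, each eigenspace of H in the image of
    rho is again a summand, and a nonzero one is everything by minimality. The
    eigenspaces for one eigenvalue are taken at all vertices together, so that
    the scalar does not depend on the vertex. *)
Lemma minimal_scalar rho : minimal rho ->
  exists mu : R, forall l, H l *m rho l = mu%:C *: rho l.
Proof.
move=> [rr r0 rmin]; have [ro rA] := rr.
have [l0 l0P] : exists l, rho l != 0.
  apply: contrapT => n0; move: r0; rewrite /rk big1 // => l _; apply/eqP.
  rewrite dimv_eq0 -subv0; apply/subvP => x /fixspP <-; rewrite memv0.
  have [->|rl] := eqVneq (rho l) 0; first by rewrite mul0mx.
  by case: n0; exists l.
have [mu [x0 [x0n rx0 Hx0]]] := eigen_fixsp (ro l0) (hmom_herm alpha A l0)
  (reducing_hmom rr l0) l0P.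
pose U l := eigsp (rho l) (H l) (mu%:C).
have UP l x : (x \in U l) <-> rho l *m x = x /\ H l *m x = mu%:C *: x.
  exact: eigspP.
have [N [Nr NU]] : exists P, reducing P /\ forall l, fixsp (P l) = U l.
  apply: reducing_of_stable => a x /UP [rx Hx]; apply/UP; split.
  - by rewrite mulmxA rA -mulmxA rx.
  - by rewrite mulmxA crit -mulmxA Hx scalemxAr.
  - by rewrite mulmxA reducing_adj // -mulmxA rx.
  - by rewrite mulmxA -crit_adj -mulmxA Hx scalemxAr.
have Nrho l : (fixsp (N l) <= fixsp (rho l))%VS by rewrite NU; apply: capvSl.
have N0 : (0 < rk N)%N.
  have [No _] := Nr; apply: (@rk_gt0 N l0) => //; apply/eqP => N00.
  have : x0 \in fixsp (N l0) by rewrite NU; apply/UP.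
  by move=> /fixspP; rewrite N00 mul0mx => /eqP; rewrite eq_sym (negPf x0n).
have e := rmin N Nr N0 Nrho.
exists mu => l; apply: eq_mulmx_cV => x; rewrite -mulmxA -scalemxAl.
have : rho l *m x \in U l.
  by rewrite -NU e; apply/fixspP; rewrite mulmxA; have [_ ->] := ro l.
by case/UP.
Qed.

End Critical.

(** * Splitting of a critical representation into stable pieces *)

Lemma rest_rank_bound (a b c n : nat) :
  a = (b + c)%N -> (0 < b)%N -> (a <= n.+1)%N -> (c <= n)%N.
Proof. lia. Qed.

Section Decompose.
Variables (R : realType) (Q : quiver) (v : vertex Q -> nat) (alpha : vertex Q -> R[i]).
Hypothesis alpha_imag : forall l, Re (alpha l) = 0.
Local Notation C := R[i].
Variable A : Rep R v.
Local Notation H := (hmom alpha A).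
Hypothesis crit : forall a, H (tgt a) *m A a = A a *m H (src a).
Implicit Types P N rho : mxfamily R v.

Lemma dimvec_imfam P l : dimvec (subr (imfam A P)) l = \dim (fixsp (P l)).
Proof. exact: dimvec_subr. Qed.

(** The trace formula where H is the scalar mu: the excess relative to the slope
    - mu is minus half the squared norm of the second fundamental form. *)
Lemma excess_subrepr rho N (mu : R) : (forall l, orthoproj (rho l)) ->
  (forall l, rho l *m H l = H l *m rho l) ->
  (forall l, H l *m rho l = mu%:C *: rho l) ->
  (forall l, orthoproj (N l)) ->
  (forall l, fixsp (N l) <= fixsp (rho l))%VS ->
  (forall a, N (tgt a) *m (A a *m N (src a)) = A a *m N (src a)) ->
  excess alpha (- mu) (fun l => \dim (fixsp (N l))) =
  - 2^-1 * \sum_a nsq (N (tgt a) *m A a - A a *m N (src a)).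
Proof.
move=> ro rH Hr No Nr NA; have := trace_formula alpha No NA.
have -> : \sum_l Re (\tr (N l *m H l)) = mu * (rk N)%:R.
  rewrite /rk natr_sum mulr_sumr; apply: eq_bigr => l _.
  have [rN Nrl] := orthoproj_le (ro l) (No l) (Nr l).
  have -> : N l *m H l = mu%:C *: N l.
    by rewrite -{1}Nrl -mulmxA rH Hr -scalemxAr Nrl.
  rewrite mxtraceZ (tr_orthoproj (No l)) cReM /= mul0r subr0; congr (_ * _).
  by rewrite -(rmorph_nat (real_complex R)).
by rewrite /excess /rk /rank => e; lra.
Qed.

Lemma reducing_excess rho (mu : R) : reducing A rho ->
  (forall l, H l *m rho l = mu%:C *: rho l) ->
  excess alpha (- mu) (fun l => \dim (fixsp (rho l))) = 0.
Proof.
move=> rr Hr; have [ro rA] := rr.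
rewrite (excess_subrepr ro (reducing_hmom alpha rr) Hr ro) => [|l|a]; last first.
- by rewrite mulmxA rA -mulmxA; have [_ ->] := ro (src a).
- exact: subvv.
- by rewrite big1 ?mulr0 // => a _; rewrite rA subrr /nsq rip0r.
Qed.

(** Subrepresentations of the image of rho have excess at most 0 by
    [excess_subrepr]; excess 0 makes the subrepresentation a summand, which
    minimality excludes unless it is zero or everything. *)
Lemma minimal_stable rho (mu : R) : minimal A rho ->
  (forall l, H l *m rho l = mu%:C *: rho l) ->
  stable alpha (subr (imfam A rho)).
Proof.
move=> [rr r0 rmin] Hr; have [ro rA] := rr.
have ex0 := reducing_excess rr Hr.
have rk_r : (0 < rank (dimvec (subr (imfam A rho))))%N.
  by rewrite (rank_eq (dimvec_imfam rho)).
split=> // V Vs Vn Vp.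
have slr : rslope alpha (dimvec (subr (imfam A rho))) = - mu.
  by apply: rslope_excess0; rewrite // (excess_eq alpha _ (dimvec_imfam rho)).
apply: (slope_lt alpha_imag); rewrite slr -excess_lt0 ?rank_nonzero //.
pose V' l : {vspace 'cV[C]_(v l)} := (sincl (imfam A rho) l @: V l)%VS.
have dimV l : \dim (V' l) = \dim (V l).
  rewrite limg_dim_eq //.
  have /eqP -> : lker (sincl (imfam A rho) l) == 0%VS.
    by apply/lker0P => x y; rewrite !sinclE; apply: val_inj.
  by rewrite capv0.
have [N NP] := dep_choice (fun l => orthoproj_exists (V' l)).
have No l : orthoproj (N l) by have [] := NP l.
have NV l : fixsp (N l) = V' l by have [_ -> _] := NP l.
have Nr l : (fixsp (N l) <= fixsp (rho l))%VS.
  rewrite NV; apply/subvP => _ /memv_imgP [x _ ->]; rewrite sinclE; exact: subvsP.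
have NA a : N (tgt a) *m (A a *m N (src a)) = A a *m N (src a).
  apply: eq_mulmx_cV => x; rewrite -!mulmxA; apply/fixspP; rewrite NV.
  have : N (src a) *m x \in V' (src a).
    by rewrite -NV; apply/fixspP; rewrite mulmxA; have [_ ->] := No (src a).
  move=> /memv_imgP [y yV ->]; apply/memv_imgP.
  exists (arrow_map (subr (imfam A rho)) a y); first exact/(subvP (Vs a))/memv_img.
  by rewrite !sinclE subrE ?arrowE //; exact: imfam_subrepr.
have exN := excess_subrepr ro (reducing_hmom alpha rr) Hr No Nr NA.
have eN : excess alpha (- mu) (subdim V) =
    - 2^-1 * \sum_a nsq (N (tgt a) *m A a - A a *m N (src a)).
  by rewrite -exN; apply: excess_eq => l; rewrite NV dimV.
have S0 : 0 <= \sum_a nsq (N (tgt a) *m A a - A a *m N (src a)).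
  by apply: sumr_ge0 => a _; apply: nsq_ge0.
rewrite eN mulNr oppr_lt0 mulr_gt0 ?invr_gt0 // lt_neqAle S0 andbT.
apply/negP => /eqP /esym /eqP; rewrite psumr_eq0; last by move=> a _; apply: nsq_ge0.
move=> /allP all0.
have Nred : reducing A N.
  split=> // a; have := all0 a (mem_index_enum a) => /eqP /nsq_eq0 /eqP.
  by rewrite subr_eq0 => /eqP.
have rkN : (0 < rk N)%N.
  have := rank_nonzero Vn; rewrite /rank /rk; congr (0 < _)%N.
  by apply: eq_bigr => l _; rewrite NV dimV.
have e := rmin N Nred rkN Nr.
have [_ []] := Vp => l.
have -> : V l = fullv; last exact: subvv.
apply/eqP; rewrite eqEdim subvf /= -dimV -NV e -(dimvec_imfam rho l).
exact: leqnn.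
Qed.

Lemma dim_orthoproj_add n (a b : 'M[C]_n) : orthoproj a -> orthoproj b ->
  orthoproj (a + b) ->
  \dim (fixsp (a + b)) = (\dim (fixsp a) + \dim (fixsp b))%N.
Proof.
move=> ao bo abo; apply/eqP; rewrite -(eqr_nat R) natrD; apply/eqP.
have := congr1 Re (mxtraceD a b); rewrite cReD => e.
exact: etrans (esym (Re_tr_orthoproj abo))
  (etrans e (congr2 +%R (Re_tr_orthoproj ao) (Re_tr_orthoproj bo))).
Qed.

Lemma orthoproj_add n (a b : 'M[C]_n) : orthoproj a -> orthoproj b ->
  a *m b = 0 -> b *m a = 0 -> orthoproj (a + b).
Proof.
move=> [aa aI] [ba bI] ab ba0; split; first by rewrite hadjD aa ba.
by rewrite mulmxDl !mulmxDr aI bI ab ba0 addr0 add0r.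
Qed.

Lemma orthoproj_sub n (P rho : 'M[C]_n) : orthoproj P -> orthoproj rho ->
  P *m rho = rho -> rho *m P = rho -> orthoproj (P - rho).
Proof.
move=> [Pa PP] [ra rr] Pr rP; split; first by rewrite hadjB Pa ra.
by rewrite mulmxBl !mulmxBr PP rr Pr rP subrr subr0.
Qed.

(** On the sum of an eigenspace and a subspace orthogonal to it, the quadratic
    form of K has no cross terms. *)
Lemma quad_add n (K a b : 'M[C]_n) (mu : R) (x : 'cV_n) : adj a = a -> adj K = K ->
  K *m a = mu%:C *: a -> a *m b = 0 ->
  rip ((a + b) *m x) (K *m ((a + b) *m x)) =
    mu * nsq (a *m x) + rip (b *m x) (K *m (b *m x)) /\
  nsq ((a + b) *m x) = nsq (a *m x) + nsq (b *m x).
Proof.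
move=> aa Ka Kam ab.
have o : rip (a *m x) (b *m x) = 0.
  by rewrite ripC rip_adj aa mulmxA ab mul0mx rip0l.
have o' : rip (a *m x) (K *m (b *m x)) = 0.
  by rewrite rip_adj Ka mulmxA Kam -scalemxAl ripZl o mulr0.
rewrite /nsq mulmxDl mulmxDr !ripDl !ripDr o o' [rip (b *m x) (a *m x)]ripC o.
rewrite [K *m (a *m x)]mulmxA Kam -scalemxAl !ripZr [rip (b *m x) (a *m x)]ripC o.
by rewrite mulr0 !addr0 !add0r.
Qed.

Definition pfam P N : famhom (subr (imfam A P)) (subr (imfam A N)) :=
  fun l => (linfun (vsproj (fixsp (N l))) \o linfun (mulmx (N l)) \o
           linfun (@vsval _ _ (fixsp (P l))))%VF.

Lemma pfamE P N l x : orthoproj (N l) -> vsval (pfam P N l x) = N l *m vsval x.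
Proof.
move=> [_ NN]; have fN : N l *m vsval x \in fixsp (N l).
  by apply/fixspP; rewrite mulmxA NN.
apply: etrans (vsprojK fN); congr (vsval _).
apply: etrans (comp_lfunE _ _ _) _; apply: etrans (comp_lfunE _ _ _) _.
apply: etrans (lfunE _ _) _; congr (vsproj _ _).
by apply: etrans (lfunE _ _) _; congr (_ *m _); exact: lfunE.
Qed.

Lemma iso_split P rho P' : reducing A P -> reducing A rho -> reducing A P' ->
  (forall l, P l = rho l + P' l) -> (forall l, rho l *m P' l = 0) ->
  isomorphic (subr (imfam A P)) (dsum2 (subr (imfam A rho)) (subr (imfam A P'))).
Proof.
move=> Pr rr Pr' PE rP'; have [Po PA] := Pr; have [ro rA] := rr; have [Po' PA'] := Pr'.
have P'r l : P' l *m rho l = 0.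
  have := congr1 (@adj R _ _) (rP' l); rewrite hadjM hadj0.
  by have [-> _] := ro l; have [-> _] := Po' l.
have homp N : reducing A N -> is_hom (pfam P N).
  move=> [No NA] a x; have sN := imfam_subrepr NA; have sP := imfam_subrepr PA.
  apply: val_inj; apply: etrans (pfamE _ (No _)) _.
  apply: esym; apply: etrans (subrE sN _) _; rewrite (pfamE x (No _)) (subrE sP).
  by rewrite !arrowE !mulmxA NA.
apply: (@iso_dsum2 _ _ _ _ _ (pfam P rho) (pfam P P')); [exact: homp | exact: homp | |].
- move=> l z p1 p2.
  have h1 : rho l *m vsval z = 0 by rewrite -(pfamE z (ro l)) p1.
  have h2 : P' l *m vsval z = 0 by rewrite -(pfamE z (Po' l)) p2.
  have zE : vsval z = 0.
    by have /fixspP <- := subvsP z; rewrite PE mulmxDl h1 h2 addr0.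
  exact: val_inj.
- move=> l x y.
  have /fixspP rx := subvsP x; have /fixspP Py := subvsP y.
  have r0 : P' l *m vsval x = 0 by rewrite -rx mulmxA P'r mul0mx.
  have y0 : rho l *m vsval y = 0 by rewrite -Py mulmxA rP' mul0mx.
  have zP : vsval x + vsval y \in fixsp (P l).
    by apply/fixspP; rewrite PE mulmxDl !mulmxDr rx Py r0 y0 addr0 add0r.
  exists (vsproj (fixsp (P l)) (vsval x + vsval y)); split; apply: val_inj.
    apply: etrans (pfamE _ (ro l)) _; apply: etrans (congr1 _ (vsprojK zP)) _.
    by rewrite mulmxDr rx y0 addr0.
  apply: etrans (pfamE _ (Po' l)) _; apply: etrans (congr1 _ (vsprojK zP)) _.
  by rewrite mulmxDr Py r0 add0r.
Qed.

(** N cuts out the part of P on which H is at most - lam; on the rest H is at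
    least - lam + dlt. The gap dlt is what the dichotomy of solutions
    needs. *)
Definition dominated lam P N (dlt : R) : Prop :=
  [/\ reducing A N, forall l, P l *m N l = N l,
      forall l (x : 'cV_(v l)), rip (N l *m x) (H l *m (N l *m x)) <= - lam * nsq (N l *m x)
    & forall l (x : 'cV_(v l)), (- lam + dlt) * nsq ((P l - N l) *m x) <=
        rip ((P l - N l) *m x) (H l *m ((P l - N l) *m x))].

(** Split off minimal summands one at a time. On each, H is minus the slope, so
    that the part where H is at most - lam is the sum of the pieces of slope at
    least lam, and its excess is the sum of their nonnegative excesses. *)
Lemma decompose n P : reducing A P -> (rk P <= n)%N ->
  exists e : seq (qrep C Q), [/\ all_stable alpha e,
    isomorphic (subr (imfam A P)) (dsum e)
  & forall lam, exists N dlt, [/\ 0 < dlt, dominated lam P N dlt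
    & posexcess alpha lam e = excess alpha lam (fun l => \dim (fixsp (N l)))]].
Proof.
elim: n P => [|n IHn] P Pr Pn.
  have P0 : forall l, P l = 0.
    by have [Po _] := Pr; apply: rk_eq0 => //; apply/eqP; rewrite -leqn0.
  have f0 (l : vertex Q) : fixsp (0 : 'M[C]_(v l)) = 0%VS.
    apply/eqP; rewrite -subv0; apply/subvP => x /fixspP.
    by rewrite mul0mx => <-; rewrite mem0v.
  exists [::]; split=> //.
    apply: iso_dim0 => l; last by rewrite /dimvec dimvf dim_matrix.
    by rewrite dimvec_imfam P0 f0 dimv0.
  move=> lam; exists (fun l => 0), 1; split=> //; last first.
    by rewrite /posexcess big_nil excess0 // => l; rewrite f0 dimv0.
  split=> [|l|l x|l x]; rewrite ?P0 ?mulmx0 ?subrr ?mul0mx ?mulmx0 /nsq ?rip0r ?mulr0 //.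
  split=> [l|a]; last by rewrite mul0mx mulmx0.
  by split; rewrite ?hadj0 ?mul0mx.
have [P0|P0] := posnP (rk P); first by apply: IHn => //; rewrite P0.
have [rho [rmin rP]] := minimal_exists Pr P0.
have [mu Hr] := minimal_scalar crit rmin.
have [rr r0 _] := rmin.
have rst := minimal_stable rmin Hr.
have [Po PA] := Pr; have [ro rA] := rr.
have Prr l : P l *m rho l = rho l by have [] := orthoproj_le (Po l) (ro l) (rP l).
have rPr l : rho l *m P l = rho l by have [] := orthoproj_le (Po l) (ro l) (rP l).
pose P' : mxfamily R v := fun l => P l - rho l.
have Po' l : orthoproj (P' l) by apply: orthoproj_sub.
have Pr' : reducing A P'.
  by split=> // a; rewrite /P' mulmxBl mulmxBr PA rA.
have PE l : P l = rho l + P' l by rewrite /P' addrC subrK.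
have rP' l : rho l *m P' l = 0.
  by rewrite /P' mulmxBr rPr; have [_ ->] := ro l; rewrite subrr.
have rkE : rk P = (rk rho + rk P')%N.
  rewrite /rk -big_split; apply: eq_bigr => l _; rewrite PE.
  by apply: dim_orthoproj_add => //; rewrite -PE.
have [e [es eiso eN]] := IHn P' Pr' (rest_rank_bound rkE r0 Pn).
exists (subr (imfam A rho) :: e); split.
- by apply/andP; split=> //; apply/asboolP.
- apply: iso_trans (iso_split Pr rr Pr' PE rP') _.
  by apply: dsum2_iso => //; apply: iso_refl.
move=> lam; have [N [dlt [d0 [Nr PN NH NH'] pe]]] := eN lam.
have [No NA] := Nr.
have rN l : rho l *m N l = 0 by rewrite -PN mulmxA rP' mul0mx.
have Nrho l : N l *m rho l = 0.
  have := congr1 (@adj R _ _) (rN l); rewrite hadjM hadj0.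
  by have [-> _] := ro l; have [-> _] := No l.
have ra l : adj (rho l) = rho l by have [] := ro l.
have Ha l : adj (H l) = H l by apply: hmom_herm.
have ex0 := reducing_excess rr Hr.
have rkr : (0 < rank (fun l => \dim (fixsp (rho l))))%N by [].
have slr := rslope_excess0 rkr ex0.
have exr : excess alpha lam (dimvec (subr (imfam A rho))) =
    excess alpha lam (fun l => \dim (fixsp (rho l))).
  by apply: excess_eq => l; rewrite dimvec_imfam.
(* A piece of slope below lam joins the complement of N and may shrink the gap;
   one of slope at least lam joins N. *)
have [lt|ge] := ltP (- mu) lam.
  exists N, (Num.min dlt (lam + mu)); split.
  - by rewrite lt_min d0 -[mu]opprK subr_gt0.
  - split; [exact: Nr | move=> l | exact: NH | move=> l x].
      by rewrite PE mulmxDl rN PN add0r.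
    have -> : P l - N l = rho l + (P' l - N l) by rewrite addrA -PE.
    have rPN : rho l *m (P' l - N l) = 0 by rewrite mulmxBr rP' rN subrr.
    have [-> ->] := quad_add x (ra l) (Ha l) (Hr l) rPN.
    rewrite mulrDr; apply: lerD.
      apply: (ler_wpM2r (nsq_ge0 _)).
      by rewrite addrC lerBlDr addrC ge_min lexx orbT.
    apply: le_trans (NH' l x); apply: (ler_wpM2r (nsq_ge0 _)).
    by rewrite lerD2l ge_min lexx.
  - rewrite /posexcess big_cons exr max_r.
      by rewrite add0r; exact: pe.
    by rewrite (excess_le0 alpha _ rkr) slr; exact: ltW.
exists (fun l => rho l + N l), dlt; split; first exact: d0.
  have NrN l : orthoproj (rho l + N l) by apply: orthoproj_add.
  split.
  - by split=> [l|a]; [exact: NrN | rewrite mulmxDl mulmxDr rA NA].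
  - move=> l; rewrite mulmxDr Prr; congr (_ + _).
    by rewrite PE mulmxDl rN PN add0r.
  - move=> l x; have [-> ->] := quad_add x (ra l) (Ha l) (Hr l) (rN l).
    rewrite mulrDr; apply: lerD (NH l x).
    by apply: (ler_wpM2r (nsq_ge0 _)); rewrite lerNr.
  - move=> l x; have -> : P l - (rho l + N l) = P' l - N l by rewrite /P' opprD addrA.
    exact: NH'.
rewrite /posexcess big_cons exr max_l; last first.
  by rewrite leNgt (excess_lt0 alpha _ rkr) slr -leNgt.
apply: etrans (congr1 _ pe) _; apply/esym/excess_add => l.
by apply: dim_orthoproj_add => //; apply: orthoproj_add.
Qed.

End Decompose.

(** * Real derivatives and antiderivatives *)

Section RealCalculus.
Variable R : realType.
Implicit Types (f g : R -> R) (t a b : R).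

(** The derivative together with its value, so that the rules compose as
    terms. *)
Definition rder f t a : Prop := is_derive t 1 f a.

Lemma rderD f g t a b : rder f t a -> rder g t b ->
  rder (fun s => f s + g s) t (a + b).
Proof. by move=> fa gb; exact: is_deriveD. Qed.

Lemma rderN f t a : rder f t a -> rder (fun s => - f s) t (- a).
Proof. by move=> fa; exact: is_deriveN. Qed.

Lemma rderM f g t a b : rder f t a -> rder g t b ->
  rder (fun s => f s * g s) t (a * g t + f t * b).
Proof.
move=> fa gb; apply: (is_derive_eq (is_deriveM fa gb)).
by change (f t * b + g t * a = a * g t + f t * b); ring.
Qed.

Lemma rder_cst t (c : R) : rder (fun=> c) t 0.
Proof. exact: is_derive_cst. Qed.

Lemma rder_id t : rder (fun s => s) t 1.
Proof. exact: is_derive_id. Qed.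

Lemma rder_sum I (r : seq I) (P : pred I) (f : I -> R -> R) t (a : I -> R) :
  (forall i, P i -> rder (f i) t (a i)) ->
  rder (fun s => \sum_(i <- r | P i) f i s) t (\sum_(i <- r | P i) a i).
Proof.
move=> h; elim: r => [|i r IHr].
  by rewrite big_nil; under eq_fun do rewrite big_nil; apply: rder_cst.
rewrite big_cons; under eq_fun do rewrite big_cons.
by case: ifP => // Pi; apply: rderD => //; apply: h.
Qed.

Lemma rder_eq f t a b : rder f t a -> a = b -> rder f t b.
Proof. by move=> fa <-. Qed.

Lemma rder_near f g t a : (\forall s \near t, f s = g s) -> rder f t a -> rder g t a.
Proof.
move=> fg fa; have [fd fv] := fa; split.
  by have := near_eq_derivable fg fd.
by rewrite -fv; apply/esym/near_eq_derive.
Qed.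

Lemma rder_exp (k t : R) : rder (fun s => expR (k * s)) t (k * expR (k * t)).
Proof.
have h : rder (fun s => k * s) t k.
  by apply: (rder_eq (rderM (rder_cst t k) (rder_id t))); rewrite mul0r add0r mulr1.
by apply: rder_eq (is_derive1_comp (f := expR) _ h) _; rewrite /GRing.scale /= mulrC.
Qed.

Lemma rder_cont f t a : rder f t a -> {for t, continuous f}.
Proof. by move=> [fd _]; apply: differentiable_continuous; apply/derivable1_diffP. Qed.

Lemma nondecreasing_from f f' T : continuous f ->
  (forall t, T < t -> rder f t (f' t)) -> (forall t, T < t -> 0 <= f' t) ->
  forall s t, T <= s -> s <= t -> f s <= f t.
Proof.
move=> fc fd f0 s t Ts st.
apply: (@ger0_derive1_le _ f s t _ _ true false) => //.
- by move=> x; rewrite in_itv /= => /andP[sx _]; have [] := fd x (le_lt_trans Ts sx).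
- move=> x; rewrite in_itv /= => /andP[sx _].
  have Tx := le_lt_trans Ts sx.
  by rewrite derive1E; have [_ ->] := fd x Tx; apply: f0.
- by apply: continuous_subspaceT.
- by rewrite in_itv /= lexx.
- by rewrite in_itv /= st lexx.
Qed.

(** The equations live on [0, +oo[. Extending solutions by constants to the left
    makes them continuous on the whole line and dispenses with one-sided
    limits at 0. The integral starts at -1 to leave room around 0. *)
Lemma antiderivative f : continuous f ->
  exists F : R -> R, [/\ continuous F, forall t, t <= 0 -> F t = 0
    & forall t, 0 < t -> rder F t (f t)].
Proof.
move=> fc; pose G (x : R) := (\int[lebesgue_measure]_(t in [set` `[-1, x]]) f t)%R.
have GP x : -1 < x -> rder G x (f x).
  move=> x1; have xu : x < x + 1 by rewrite ltrDl.
  have [] := @continuous_FTC1 _ f (BLeft (-1)) x (x + 1) xu _ _ (fc x).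
  - apply: continuous_compact_integrable; first exact: segment_compact.
    exact: continuous_subspaceT.
  - by rewrite /= lte_fin.
  - by rewrite derive1E.
pose F t := G (Num.max t 0) - G 0.
have gt0 (t : R) : 0 <= t -> -1 < t by apply: lt_le_trans; rewrite ltrN10.
exists F; split.
- move=> t; apply: cvgB; last exact: cvg_cst.
  apply: (@continuous_comp _ _ _ (fun t => Num.max t 0) G).
    exact: (@continuous_max _ _ (fun s => s) (fun=> 0) t (@cvg_id _ _) (@cvg_cst _ _ _ _ _)).
  by apply: rder_cont (GP _ _); apply: gt0; rewrite le_max lexx orbT.
- by move=> t t0; rewrite /F max_r // subrr.
- move=> t t0; apply: (@rder_near (fun s => G s - G 0)).
    near=> s; rewrite /F max_l //; apply: ltW.
    by near: s; apply: lt_nbhsr.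
  apply: (rder_eq (rderD (GP t _) (rder_cst t (- G 0)))); last by rewrite addr0.
  exact/gt0/ltW.
Unshelve. all: by end_near. Qed.

End RealCalculus.

(** * Linear differential equations *)

(** Picard iteration for y' = L y with bounded continuous coefficients. In the
    norm weighted by exp (- k t), with k large against the coefficients, the
    integral operator contracts by 1/2 on the whole half-line, so that no
    gluing of local solutions is required. *)
Section LinearODE.
Variable R : realType.
Implicit Types (f g : R -> R) (t a b c : R).

Local Notation hlf n := ((2^-1 : R) ^+ n).

Lemma half_exp_gt0 n : 0 < hlf n. Proof. by rewrite exprn_gt0 // invr_gt0. Qed.
Lemma half_exp_ge0 n : 0 <= hlf n. Proof. exact/ltW/half_exp_gt0. Qed.
Lemma half_expS n : hlf n = 2 * hlf n.+1.
Proof. by rewrite exprS mulrA mulfV ?mul1r // pnatr_eq0. Qed.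

Lemma half_exp_small x a : 0 <= a -> (forall n, x <= a * hlf n) -> x <= 0.
Proof.
move=> a0 hx; rewrite leNgt; apply/negP => x0.
have [n nP] : exists n : nat, a / x < n%:R.
  by exists (Num.truncn (a / x)).+1; apply: truncnS_gt.
have n2 : (n%:R : R) <= 2 ^+ n by rewrite -natrX ler_nat ltnW // ltn_expl.
have p2 : 0 < (2 : R) ^+ n by rewrite exprn_gt0.
have := hx n; rewrite exprVn ler_pdivlMr // => hx'.
move: nP; rewrite ltr_pdivrMr // => nP.
have : a < x * 2 ^+ n by apply: lt_le_trans nP _; rewrite mulrC ler_wpM2l // ltW.
by rewrite ltNge hx'.
Qed.

(** The sequences u n - 2 c / 2^n and u n + 2 c / 2^n are monotone and enclose
    the limit. *)
Lemma geometric_limit (u : nat -> R) c : (forall n, `|u n.+1 - u n| <= c * hlf n) ->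
  exists l, forall n, `|l - u n| <= 2 * c * hlf n.
Proof.
move=> uc; pose lo n := u n - 2 * c * hlf n; pose hi n := u n + 2 * c * hlf n.
have c0 : 0 <= c.
  by have := le_trans (normr_ge0 _) (uc 0%N); rewrite expr0 mulr1.
have lohi n : lo n <= hi n.
  have : 0 <= c * hlf n by rewrite mulr_ge0 ?half_exp_ge0.
  by rewrite /lo /hi; lra.
have lo_inc n m : lo n <= lo (n + m)%N.
  elim: m => [|m IHm]; first by rewrite addn0.
  apply: (le_trans IHm); rewrite addnS /lo.
  by have := uc (n + m)%N; rewrite (half_expS (n + m)) ler_norml => /andP[]; lra.
have hi_dec n m : hi (n + m)%N <= hi n.
  elim: m => [|m IHm]; first by rewrite addn0.
  apply: le_trans IHm; rewrite addnS /hi.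
  by have := uc (n + m)%N; rewrite (half_expS (n + m)) ler_norml => /andP[]; lra.
have lh n m : lo n <= hi m.
  apply: le_trans (lo_inc n m) _; apply: le_trans (lohi _) _.
  by rewrite addnC; apply: hi_dec.
have ub m : ubound (range lo) (hi m) by move=> _ [n _ <-].
have ne : range lo !=set0 by exists (lo 0%N), 0%N.
exists (sup (range lo)) => n.
have h1 : lo n <= sup (range lo).
  by apply: ub_le_sup; [exists (hi 0%N) | exists n].
have h2 : sup (range lo) <= hi n by apply: ge_sup.
by rewrite ler_norml; move: h1 h2; rewrite /lo /hi => h1 h2; apply/andP; split; lra.
Qed.

(** c exp (k t) dominates both f and - f at 0 and grows faster. *)
Lemma exp_bound f f' k c : 0 <= c -> continuous f -> f 0 = 0 ->
  (forall t, 0 < t -> rder f t (f' t)) ->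
  (forall t, 0 < t -> `|f' t| <= c * k * expR (k * t)) ->
  forall t, 0 <= t -> `|f t| <= c * expR (k * t).
Proof.
move=> c0 fc f0 fd fb t t0.
have ec : continuous (fun s : R => c * expR (k * s)).
  move=> s; apply: cvgM; first exact: cvg_cst.
  exact: rder_cont (rder_exp k s).
have ed s : rder (fun s => c * expR (k * s)) s (c * k * expR (k * s)).
  by apply: (rder_eq (rderM (rder_cst s c) (rder_exp k s))); rewrite mul0r add0r mulrA.
have up : c * expR (k * 0) + f 0 <= c * expR (k * t) + f t.
  apply: (@nondecreasing_from _ (fun s => c * expR (k * s) + f s)
    (fun s => c * k * expR (k * s) + f' s) 0) => //.
  - by move=> s; apply: cvgD; [exact: ec | exact: fc].
  - by move=> s s0; apply: rderD; [exact: ed | exact: fd].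
  - by move=> s s0; have := fb s s0; rewrite ler_norml => /andP[]; lra.
have dn : c * expR (k * 0) - f 0 <= c * expR (k * t) - f t.
  apply: (@nondecreasing_from _ (fun s => c * expR (k * s) - f s)
    (fun s => c * k * expR (k * s) - f' s) 0) => //.
  - by move=> s; apply: cvgB; [exact: ec | exact: fc].
  - by move=> s s0; apply: rderD; [exact: ed | apply: rderN; exact: fd].
  - by move=> s s0; have := fb s s0; rewrite ler_norml => /andP[]; lra.
move: up dn; rewrite f0 mulr0 expR0 mulr1 => up dn.
by rewrite ler_norml; apply/andP; split; lra.
Qed.

Lemma continuous_approx f t : (forall e, 0 < e -> exists g, {for t, continuous g} /\
   \forall s \near t, `|f s - g s| <= e) -> {for t, continuous f}.
Proof.
move=> fg; apply/cvgrPdist_le => e e0.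
have [|g [gc fge]] := fg (e / 3); first by rewrite divr_gt0.
have ft := nbhs_singleton fge.
have gt : \forall s \near t, `|g t - g s| <= e / 3.
  by move/cvgrPdist_le : gc; apply; rewrite divr_gt0.
near=> s.
have h1 : `|f s - g s| <= e / 3 by near: s.
have h2 : `|g t - g s| <= e / 3 by near: s.
have -> : f t - f s = (f t - g t) + (g t - g s) + (g s - f s) by ring.
have -> : e = e / 3 + e / 3 + e / 3 by lra.
have h3 : `|g s - f s| <= e / 3 by rewrite distrC.
apply: le_trans (ler_normD _ _) _; apply: lerD => //.
by apply: le_trans (ler_normD _ _) _; apply: lerD.
Unshelve. all: by end_near. Qed.

Variables (I : finType) (L : I -> I -> R -> R) (K : R) (x0 : I -> R).
Hypothesis Lc : forall i j, continuous (L i j).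
Hypothesis Lb : forall i j t, `|L i j t| <= K.

Let vf (y : I -> R -> R) i t : R := \sum_j L i j t * y j t.

Lemma vf_continuous y i : (forall i, continuous (y i)) -> continuous (vf y i).
Proof.
move=> yc t; have h j : L i j s * y j s @[s --> t] --> L i j t * y j t.
  by apply: cvgM; [exact: Lc | exact: yc].
exact: (rcvg_sum (FF := nbhs_pfilter t) (fun j _ => h j)).
Qed.

Lemma vf_bound y i t a : 0 <= K -> (forall j, `|y j t| <= a) -> `|vf y i t| <= #|I|%:R * K * a.
Proof.
move=> K0 ya; apply: le_trans (ler_norm_sum _ _ _) _.
have -> : #|I|%:R * K * a = \sum_(j : I) K * a.
  by rewrite sumr_const -mulrA mulr_natl cardE.
by apply: ler_sum => j _; rewrite normrM; apply: ler_pM.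
Qed.

Lemma linear_ode : exists y : I -> R -> R, [/\ forall i, continuous (y i),
  forall i t, t <= 0 -> y i t = x0 i
  & forall i t, 0 < t -> rder (y i) t (\sum_j L i j t * y j t)].
Proof.
(* one antiderivative operator, fixed once for all functions *)
have [AD ADP] : exists AD : (R -> R) -> (R -> R), forall f, continuous f ->
   [/\ continuous (AD f), forall t, t <= 0 -> AD f t = 0
    & forall t, 0 < t -> rder (AD f) t (f t)].
  apply: (@dep_choice _ (fun=> R -> R) (fun f F => continuous f ->
   [/\ continuous F, forall t, t <= 0 -> F t = 0
    & forall t, 0 < t -> rder F t (f t)])) => f.
  have [fc|nfc] := pselect (continuous f); last by exists f.
  by have [F FP] := antiderivative fc; exists F.
have [I0|I0] := posnP #|I|.
  exists (fun i t => x0 i); split=> // i; first by move=> t; exact: cvg_cst.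
  by have := fintype0 i I0.
have [i0 _] : exists i : I, true by move: I0 => /card_gt0P [i _]; exists i.
have K0 : 0 <= K by apply: le_trans (Lb i0 i0 0).
pose G (y : I -> R -> R) i t := x0 i + AD (vf y i) t.
have Gc y : (forall i, continuous (y i)) -> forall i, continuous (G y i).
  move=> yc i t; apply: cvgD; first exact: cvg_cst.
  by have [h _ _] := ADP _ (vf_continuous (i := i) yc); exact: h.
have G0 y i t : (forall i, continuous (y i)) -> t <= 0 -> G y i t = x0 i.
  move=> yc t0; have [_ h _] := ADP _ (vf_continuous (i := i) yc).
  by rewrite /G h // addr0.
have Gd y i t : (forall i, continuous (y i)) -> 0 < t -> rder (G y i) t (vf y i t).
  move=> yc t0; have [_ _ h] := ADP _ (vf_continuous (i := i) yc).
  by apply: (rder_eq (rderD (rder_cst t (x0 i)) (h t t0))); rewrite add0r.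
pose N := #|I|%:R * K; pose k := 2 * N + 1.
have N0 : 0 <= N by rewrite mulr_ge0.
have k0 : 1 <= k by rewrite /k; lra.
have kge0 : 0 <= k := le_trans ler01 k0.
(* the contraction by 1/2 in the weighted norm *)
have Gdiff y z c : (forall i, continuous (y i)) -> (forall i, continuous (z i)) -> 0 <= c ->
    (forall i t, 0 < t -> `|y i t - z i t| <= 2 * c * expR (k * t)) ->
    forall i t, 0 <= t -> `|G y i t - G z i t| <= c * expR (k * t).
  move=> yc zc c0 yz i t t0.
  apply: (@exp_bound (fun t => G y i t - G z i t) (fun t => vf y i t - vf z i t)) => //.
  - by move=> s; apply: cvgB; apply: Gc.
  - by rewrite !G0 // subrr.
  - by move=> s s0; apply: rderD; [exact: Gd | apply: rderN; exact: Gd].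
  - move=> s s0; have -> : vf y i s - vf z i s = vf (fun i t => y i t - z i t) i s.
      by rewrite /vf -sumrB; apply: eq_bigr => j _; rewrite mulrBr.
    apply: le_trans (vf_bound i K0 (fun j => yz j s s0)) _.
    rewrite -/N mulrA; apply: ler_wpM2r; first exact: expR_ge0.
    by rewrite /k; nra.
pose Y n := iter n G (fun i _ => x0 i).
have Yc n i : continuous (Y n i).
  elim: n i => [|n IHn] i; first by move=> t; exact: cvg_cst.
  exact: Gc.
have Y0 n i t : t <= 0 -> Y n i t = x0 i.
  by case: n => [//|n] t0; apply: G0.
pose S := N * \sum_j `|x0 j|.
have S0 : 0 <= S by rewrite mulr_ge0 // sumr_ge0.
have step n : forall i t, 0 <= t -> `|Y n.+1 i t - Y n i t| <= S * hlf n * expR (k * t).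
  elim: n => [|n IHn] i t t0.
    rewrite expr0 mulr1 /Y /=.
    apply: (@exp_bound (fun t => G (fun i _ => x0 i) i t - x0 i) (vf (fun i _ => x0 i) i)) => //.
    - move=> s; apply: cvgB; last exact: cvg_cst.
      by apply: Gc => j u; exact: cvg_cst.
    - by rewrite G0 ?subrr // => j u; exact: cvg_cst.
    - move=> s s0; have Gs : rder (G (fun i _ => x0 i) i) s (vf (fun i _ => x0 i) i s).
        by apply: Gd => // j u; exact: cvg_cst.
      by apply: (rder_eq (rderD Gs (rder_cst s (- x0 i)))); rewrite addr0.
    - move=> s s0.
      have xb j : `|x0 j| <= \sum_j `|x0 j|.
        by apply: (term_le_sum (f := fun j => `|x0 j|)).
      apply: le_trans (vf_bound (y := fun i _ => x0 i) (t := s) i K0 xb) _.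
      apply: (@le_trans _ _ (S * k)); first by rewrite ler_peMr.
      rewrite ler_peMr ?(mulr_ge0 S0 kge0) //.
      by rewrite -expR0 ler_expR; apply: mulr_ge0 kge0 (ltW s0).
  apply: (Gdiff (Y n.+1) (Y n)) => //; first exact: (mulr_ge0 S0 (half_exp_ge0 _)).
  by move=> j s s0; have := IHn j s (ltW s0); rewrite (half_expS n); rewrite mulrCA mulrA.
pose m (t : R) := Num.max t 0.
have step' n i t : `|Y n.+1 i t - Y n i t| <= S * expR (k * m t) * hlf n.
  rewrite /m; have [t0|t0] := leP t 0.
    rewrite !Y0 // subrr normr0.
    exact: mulr_ge0 (mulr_ge0 S0 (expR_ge0 _)) (half_exp_ge0 n).
  by rewrite mulrAC; apply: step; exact: ltW.
have /dep_choice [y yP] : forall i, exists y : R -> R, forall t n,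
    `|y t - Y n i t| <= 2 * (S * expR (k * m t)) * hlf n.
  move=> i; apply: (@dep_choice _ (fun=> R) (fun t l => forall n,
    `|l - Y n i t| <= 2 * (S * expR (k * m t)) * hlf n)).
  by move=> t; apply: geometric_limit => n; apply: step'.
have yc i : continuous (y i).
  move=> t; apply: continuous_approx => e e0.
  pose E := 2 * (S * expR (k * (m t + 1))).
  have E0 : 0 <= E by exact: mulr_ge0 (ler0n _ 2) (mulr_ge0 S0 (expR_ge0 _)).
  have [n nE] : exists n, E * hlf n <= e.
    apply: contrapT => nn; have : e <= 0.
      apply: (half_exp_small E0) => n; rewrite leNgt; apply/negP => lt.
      by apply: nn; exists n; exact: ltW.
    by rewrite leNgt e0.
  exists (Y n i); split; first exact: Yc.
  near=> s; apply: le_trans (yP i s n) _; apply: le_trans nE.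
  apply: ler_wpM2r; first exact: half_exp_ge0.
  rewrite /E ler_pM2l // ler_wpM2l // ler_expR; apply: (ler_wpM2l kge0).
  have st : s < t + 1 by near: s; apply: lt_nbhsl; rewrite ltrDl.
  by rewrite /m ge_max; apply/andP; split;
    have := le_max t t 0; have := le_max 0 t 0; rewrite !lexx ?orbT /=; lra.
have yG i t : y i t = G y i t.
  have [t0|t0] := leP t 0.
    rewrite G0 //; apply/eqP; rewrite -subr_eq0 -normr_le0.
    apply: (@half_exp_small _ (2 * (S * expR (k * m t))));
    first exact: mulr_ge0 (ler0n _ 2) (mulr_ge0 S0 (expR_ge0 _)).
    by move=> n; have := yP i t n; rewrite Y0.
  apply/eqP; rewrite -subr_eq0 -normr_le0.
  apply: (@half_exp_small _ (2 * (S * expR (k * t))));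
    first exact: mulr_ge0 (ler0n _ 2) (mulr_ge0 S0 (expR_ge0 _)).
  move=> n; have mt : m t = t by rewrite /m max_l // ltW.
  have h1 := yP i t n.+1; rewrite mt in h1.
  have h2 : `|G y i t - Y n.+1 i t| <= S * hlf n * expR (k * t).
    apply: (Gdiff y (Y n)) => //; last exact: ltW.
      by rewrite mulr_ge0 // half_exp_ge0.
    move=> j s s0; have := yP j s n; rewrite /m max_l ?(ltW s0) //.
    by rewrite -!mulrA [hlf n * _]mulrC.
  have -> : y i t - G y i t = (y i t - Y n.+1 i t) - (G y i t - Y n.+1 i t) by ring.
  apply: le_trans (ler_normB _ _) _; apply: le_trans (lerD h1 h2) _.
  by rewrite [hlf n](half_expS n); set E := expR _; set H := hlf n.+1; lra.
exists y; split=> //.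
  by move=> i t t0; rewrite yG; apply: G0.
move=> i t t0; have -> : y i = G y i by apply/funext => s; apply: yG.
exact: Gd.
Unshelve. all: by end_near. Qed.

End LinearODE.

(** * The gradient of the energy *)

Section ComplexCalculus.
Variable R : realType.
Local Notation C := R[i].
Implicit Types (t : R).

Definition cder (f : R -> C) t (d : C) : Prop :=
  rder (fun s => Re (f s)) t (Re d) /\ rder (fun s => Im (f s)) t (Im d).

Lemma cder_cst t c : cder (fun=> c) t 0.
Proof. by split; exact: rder_cst. Qed.

Lemma cderD f g t a b : cder f t a -> cder g t b -> cder (fun s => f s + g s) t (a + b).
Proof.
move=> [fr fi] [gr gi]; split.
  by rewrite cReD; under eq_fun do rewrite cReD; apply: rderD.
by rewrite cImD; under eq_fun do rewrite cImD; apply: rderD.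
Qed.

Lemma cderN f t a : cder f t a -> cder (fun s => - f s) t (- a).
Proof.
move=> [fr fi]; split.
  by rewrite cReN; under eq_fun do rewrite cReN; apply: rderN.
by rewrite cImN; under eq_fun do rewrite cImN; apply: rderN.
Qed.

Lemma cderM f g t a b : cder f t a -> cder g t b ->
  cder (fun s => f s * g s) t (a * g t + f t * b).
Proof.
move=> [fr fi] [gr gi]; split.
  under eq_fun do rewrite cReM.
  apply: (rder_eq (rderD (rderM fr gr) (rderN (rderM fi gi)))).
  by rewrite cReD !cReM; ring.
under eq_fun do rewrite cImM.
apply: (rder_eq (rderD (rderM fr gi) (rderM fi gr))).
by rewrite cImD !cImM; ring.
Qed.

Lemma cderJ f t a : cder f t a -> cder (fun s => Num.conj (f s)) t (Num.conj a).
Proof.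
move=> [fr fi]; split.
  by rewrite cReJ; under eq_fun do rewrite cReJ.
by rewrite cImJ; under eq_fun do rewrite cImJ; apply: rderN.
Qed.

Lemma cder_sum I (r : seq I) (P : pred I) (f : I -> R -> C) t (a : I -> C) :
  (forall i, P i -> cder (f i) t (a i)) ->
  cder (fun s => \sum_(i <- r | P i) f i s) t (\sum_(i <- r | P i) a i).
Proof.
move=> h; split.
  rewrite cRe_sum; under eq_fun do rewrite cRe_sum.
  by apply: rder_sum => i /h [].
rewrite cIm_sum; under eq_fun do rewrite cIm_sum.
by apply: rder_sum => i /h [].
Qed.

Definition mder m n (f : R -> 'M[C]_(m, n)) t (D : 'M[C]_(m, n)) : Prop :=
  forall i j, cder (fun s => f s i j) t (D i j).

Lemma mder_eq m n (f : R -> 'M[C]_(m, n)) t D D' : mder f t D -> D = D' -> mder f t D'.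
Proof. by move=> h <-. Qed.

Lemma mder_cst m n t (M : 'M[C]_(m, n)) : mder (fun=> M) t 0.
Proof. by move=> i j; rewrite mxE; apply: cder_cst. Qed.

Lemma mderD m n (f g : R -> 'M[C]_(m, n)) t D E : mder f t D -> mder g t E ->
  mder (fun s => f s + g s) t (D + E).
Proof.
by move=> fD gE i j; rewrite mxE; under eq_fun do rewrite mxE; apply: cderD.
Qed.

Lemma mderN m n (f : R -> 'M[C]_(m, n)) t D : mder f t D ->
  mder (fun s => - f s) t (- D).
Proof.
by move=> fD i j; rewrite mxE; under eq_fun do rewrite mxE; apply: cderN.
Qed.

Lemma mderB m n (f g : R -> 'M[C]_(m, n)) t D E : mder f t D -> mder g t E ->
  mder (fun s => f s - g s) t (D - E).
Proof. by move=> fD gE; apply: mderD => //; apply: mderN. Qed.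

Lemma mderZ m n (c : R -> C) (f : R -> 'M[C]_(m, n)) t a D : cder c t a -> mder f t D ->
  mder (fun s => c s *: f s) t (a *: f t + c t *: D).
Proof.
by move=> ca fD i j; rewrite !mxE; under eq_fun do rewrite mxE; apply: cderM.
Qed.

Lemma mderM m n p (f : R -> 'M[C]_(m, n)) (g : R -> 'M[C]_(n, p)) t D E :
  mder f t D -> mder g t E -> mder (fun s => f s *m g s) t (D *m g t + f t *m E).
Proof.
move=> fD gE i j; rewrite !mxE -big_split /=; under eq_fun do rewrite mxE.
by apply: cder_sum => k _; apply: cderM.
Qed.

Lemma mder_sum m n I (r : seq I) (P : pred I) (f : I -> R -> 'M[C]_(m, n)) t D :
  (forall i, P i -> mder (f i) t (D i)) ->
  mder (fun s => \sum_(i <- r | P i) f i s) t (\sum_(i <- r | P i) D i).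
Proof.
move=> h i j; rewrite summxE; under eq_fun do rewrite summxE.
by apply: cder_sum => k Pk; apply: h.
Qed.

Lemma mder_adj m n (f : R -> 'M[C]_(m, n)) t D : mder f t D ->
  mder (fun s => adj (f s)) t (adj D).
Proof.
by move=> fD i j; rewrite !mxE; under eq_fun do rewrite !mxE; apply: cderJ.
Qed.

Lemma rder_rip m n (f g : R -> 'M[C]_(m, n)) t D E : mder f t D -> mder g t E ->
  rder (fun s => rip (f s) (g s)) t (rip D (g t) + rip (f t) E).
Proof.
move=> fD gE; rewrite !ripE -big_split /=; under eq_fun do rewrite ripE.
apply: rder_sum => j _; rewrite -big_split /=; apply: rder_sum => i _.
have [h1 h2] := fD i j; have [k1 k2] := gE i j.
by apply: (rder_eq (rderD (rderM h1 k1) (rderM h2 k2))); ring.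
Qed.

Lemma rder_nsq m n (f : R -> 'M[C]_(m, n)) t D : mder f t D ->
  rder (fun s => nsq (f s)) t (2 * rip (f t) D).
Proof.
by move=> fD; apply: (rder_eq (rder_rip fD fD)); rewrite (ripC D); ring.
Qed.

Lemma cvg_rip T (F : set_system T) {FF : ProperFilter F} m n (f g : T -> 'M[C]_(m, n)) A B :
  mcvg F f A -> mcvg F g B -> rip (f t) (g t) @[t --> F] --> rip A B.
Proof.
move=> fA gB; rewrite ripE; under eq_fun do rewrite ripE.
apply: rcvg_sum => j _; apply: rcvg_sum => i _.
by have [h1 h2] := fA i j; have [k1 k2] := gB i j; apply: cvgD; apply: cvgM.
Qed.

End ComplexCalculus.

Section Gradient.
Variables (R : realType) (Q : quiver) (v : vertex Q -> nat) (alpha : vertex Q -> R[i]).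
Hypothesis alpha_imag : forall l, Re (alpha l) = 0.
Local Notation C := R[i].
Implicit Types A B : Rep R v.

(** The transport is the identity once l is replaced by g a. *)
Lemma mder_conform (g : arrow Q -> vertex Q) l a (X : R -> 'M[C]_(v (g a))) t D :
  g a = l -> mder X t D ->
  mder (fun s => conform_mx 0 (X s) : 'M[C]_(v l)) t (conform_mx 0 D).
Proof.
by case: l /; rewrite conform_mx_id; under eq_fun do rewrite conform_mx_id.
Qed.

Lemma mcvg_conform T (F : set_system T) {FF : ProperFilter F}
    (g : arrow Q -> vertex Q) l a (X : T -> 'M[C]_(v (g a))) D :
  g a = l -> mcvg F X D ->
  mcvg F (fun s => conform_mx 0 (X s) : 'M[C]_(v l)) (conform_mx 0 D).
Proof.
by case: l /; rewrite conform_mx_id; under eq_fun do rewrite conform_mx_id.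
Qed.

Lemma mcvg_hmom T (F : set_system T) {FF : ProperFilter F} (A : T -> Rep R v) B :
  (forall a, mcvg F (fun t => A t a) (B a)) ->
  forall l, mcvg F (fun t => hmom alpha (A t) l) (hmom alpha B l).
Proof.
move=> AB l; rewrite /hmom; apply: mcvgD; last exact: mcvg_cst.
apply: mcvgZ; first exact: ccvg_cst.
apply: mcvgD; last apply: mcvgN; apply: mcvg_sum => a /eqP e; apply: (mcvg_conform e).
  by apply: mcvgM => //; apply: mcvg_adj.
by apply: mcvgM => //; apply: mcvg_adj.
Qed.

(** The differential of [hmom] at A in the direction B. *)
Definition dhmom A B l : 'M[C]_(v l) :=
  (- 2^-1)%:C *: (\sum_(a | tgt a == l) conform_mx 0 (B a *m adj (A a) + A a *m adj (B a))
   - \sum_(a | src a == l) conform_mx 0 (adj (B a) *m A a + adj (A a) *m B a)).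

Lemma mder_hmom (A : R -> Rep R v) t B :
  (forall a, mder (fun s => A s a) t (B a)) ->
  forall l, mder (fun s => hmom alpha (A s) l) t (dhmom (A t) B l).
Proof.
move=> AB l; rewrite /hmom.
have h : mder (fun s => \sum_(a | tgt a == l) conform_mx 0 (A s a *m adj (A s a))
   - \sum_(a | src a == l) conform_mx 0 (adj (A s a) *m A s a) : 'M[C]_(v l)) t
  (\sum_(a | tgt a == l) conform_mx 0 (B a *m adj (A t a) + A t a *m adj (B a))
   - \sum_(a | src a == l) conform_mx 0 (adj (B a) *m A t a + adj (A t a) *m B a)).
  apply: mderB; apply: mder_sum => a /eqP e; apply: (mder_conform e).
    by apply: mderM => //; apply: mder_adj.
  by apply: mderM => //; apply: mder_adj.
apply: (mder_eq (mderB (mderZ (cder_cst t _) h) (mder_cst t _))).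
by rewrite scale0r add0r subr0.
Qed.

Lemma energyE A : energy alpha A = \sum_l nsq (hmom alpha A l).
Proof.
rewrite /energy cRe_sum; apply: eq_bigr => l _.
rewrite -(hmomE alpha_imag) /nsq /rip.
set X := moment A l - _; have -> : adj ('i *: X) = - 'i *: adj X.
  apply/matrixP => i j; rewrite !mxE rmorphM; congr (_ * _); exact: conjCi.
by rewrite -scalemxAl -scalemxAr scalerA mulNr -expr2 sqrCi opprK scale1r.
Qed.

(** The gradient of the energy is minus twice the infinitesimal action of the
    hermitian H on A; the flow thus moves along the orbit of the complex
    group. *)
Definition grad A : Rep R v :=
  fun a => (- 2%:R)%:C *: (hmom alpha A (tgt a) *m A a - A a *m hmom alpha A (src a)).

(** The moment map property, summed over the vertices: moving H next to A in the
    trace turns pairings with the differential of H into pairings with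
    B. *)
Lemma rip_dhmom A B :
  \sum_l 2 * rip (hmom alpha A l) (dhmom A B l) = \sum_a rip (grad A a) (B a).
Proof.
pose ph l (X : 'M[C]_(v l)) := rip (hmom alpha A l) X.
have phD l x y : ph l (x + y) = ph l x + ph l y by exact: ripDr.
have -> : \sum_l 2 * rip (hmom alpha A l) (dhmom A B l) =
   - (\sum_l ph l (\sum_(a | tgt a == l) conform_mx 0 (B a *m adj (A a) + A a *m adj (B a)))
   - \sum_l ph l (\sum_(a | src a == l) conform_mx 0 (adj (B a) *m A a + adj (A a) *m B a))).
  rewrite -sumrB -sumrN; apply: eq_bigr => l _; rewrite /dhmom ripZr ripDr ripNr /ph.
  by rewrite mulrA mulrN mulfV ?pnatr_eq0 // mulN1r.
rewrite (sum_conform (g := @tgt Q) (fun a => B a *m adj (A a) + A a *m adj (B a)) phD).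
rewrite (sum_conform (g := @src Q) (fun a => adj (B a) *m A a + adj (A a) *m B a) phD).
rewrite -sumrB -sumrN; apply: eq_bigr => a _; rewrite /ph /grad !ripDr ripZl.
rewrite (ripDl (hmom alpha A (tgt a) *m A a)) ripNl.
have h := hmom_herm alpha A.
have -> : rip (hmom alpha A (tgt a)) (B a *m adj (A a)) = rip (hmom alpha A (tgt a) *m A a) (B a).
  by rewrite /rip hadjM h mulmxA mxtrace_mulC mulmxA.
have -> : rip (hmom alpha A (tgt a)) (A a *m adj (B a)) = rip (hmom alpha A (tgt a) *m A a) (B a).
  by rewrite [RHS]ripC /rip h mulmxA mxtrace_mulC.
have -> : rip (hmom alpha A (src a)) (adj (B a) *m A a) = rip (A a *m hmom alpha A (src a)) (B a).
  by rewrite [RHS]ripC /rip h mxtrace_mulC mulmxA.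
have -> : rip (hmom alpha A (src a)) (adj (A a) *m B a) = rip (A a *m hmom alpha A (src a)) (B a).
  by rewrite /rip hadjM h mulmxA.
by ring.
Qed.

(** A gradient is determined by its pairings with all directions B, here with
    the difference B = X - grad A itself. *)
Lemma is_gradientE A X : is_gradient (energy alpha) A X -> forall a, X a = grad A a.
Proof.
move=> gX.
have eq B : \sum_a rip (X a) (B a) = \sum_a rip (grad A a) (B a).
  have := gX B; rewrite /Rep_inner cRe_sum => [[_ <-]].
  have dA a : mder (fun s => Rep_shift A s B a) 0 (B a).
    have cs : cder (fun s : R => s%:C) 0 1 by split; [exact: rder_id | exact: rder_cst].
    apply: (mder_eq (mderD (mder_cst 0 (A a)) (mderZ cs (mder_cst 0 (B a))))).
    by rewrite scaler0 addr0 add0r scale1r.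
  have s0 : Rep_shift A 0 B = A.
    by apply: functional_extensionality_dep => a; rewrite /Rep_shift scale0r addr0.
  have dE : rder (fun s => energy alpha (Rep_shift A s B)) 0 (\sum_a rip (grad A a) (B a)).
    under eq_fun do rewrite energyE.
    rewrite -rip_dhmom; apply: rder_sum => l _.
    have := rder_nsq (@mder_hmom _ 0 _ dA l).
    by rewrite s0.
  by have [_] := dE.
have z : \sum_a nsq (X a - grad A a) = 0.
  have e := eq (fun a => X a - grad A a).
  have -> : \sum_a nsq (X a - grad A a) =
      \sum_a rip (X a) (X a - grad A a) - \sum_a rip (grad A a) (X a - grad A a).
    by rewrite -sumrB; apply: eq_bigr => a _; rewrite {1}/nsq ripDl ripNl.
  by rewrite e subrr.
move=> a; apply/eqP; rewrite -subr_eq0; apply/eqP/nsq_eq0.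
move/eqP: z; rewrite psumr_eq0; last by move=> b _; apply: nsq_ge0.
by move=> /allP /(_ a (mem_index_enum a)) /eqP.
Qed.

End Gradient.

(** * Bounds for linear matrix equations *)

Section Estimates.
Variable R : realType.
Local Notation C := R[i].
Implicit Types (t : R).

Lemma bounded_half_line (u : R -> R) (l : R) : continuous u -> (forall t, t <= 0 -> u t = u 0) ->
  u t @[t --> +oo] --> l -> exists K, forall t, `|u t| <= K.
Proof.
move=> uc u0 ul.
have [T TP] : exists T, forall t, T < t -> `|l - u t| <= 1.
  by move/cvgrPdist_le : ul => /(_ 1 ltr01) [T [_ TP]]; exists T.
have [a0|a0] := leP T 0.
  exists (Num.max `|u 0| (`|l| + 1)) => t; rewrite le_max.
  have [t0|t0] := leP t 0; first by rewrite u0 // lexx.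
  apply/orP; right; have := TP t (le_lt_trans a0 t0) => h.
  have -> : u t = l - (l - u t) by ring.
  by apply: le_trans (ler_normB _ _) _; rewrite lerD2l.
have [c cP cmax] : exists2 c, c \in `[0, T] & forall t, t \in `[0, T] -> `|u t| <= `|u c|.
  apply: (@EVT_max _ (fun t => `|u t|)); first exact: ltW.
  apply: continuous_subspaceT => t; apply: continuous_comp; first exact: uc.
  exact: norm_continuous.
exists (Num.max `|u c| (`|l| + 1)) => t; rewrite le_max.
have [t0|t0] := leP t T.
  apply/orP; left; have [tn|tp] := leP t 0.
    by rewrite u0 //; apply: cmax; rewrite in_itv /= lexx ltW.
  by apply: cmax; rewrite in_itv /= t0 ltW.
apply/orP; right; have := TP t t0 => h.
have -> : u t = l - (l - u t) by ring.
by apply: le_trans (ler_normB _ _) _; rewrite lerD2l.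
Qed.

(** The bound that comes with entrywise convergence; [quad_bound] turns it into
    one for the quadratic form. *)
Definition entry_le m n (X : 'M[C]_(m, n)) (K : R) : Prop :=
  forall i j, `|Re (X i j)| <= K /\ `|Im (X i j)| <= K.

Lemma mx_bounded m n (X : R -> 'M[C]_(m, n)) L :
  (forall t, mcvg (nbhs t) X (X t)) -> (forall t, t <= 0 -> X t = X 0) ->
  mcvg +oo X L -> exists K, forall t, entry_le (X t) K.
Proof.
move=> Xc X0 XL.
have bd (i : 'I_m) (j : 'I_n) : exists K, forall t, `|Re (X t i j)| + `|Im (X t i j)| <= K.
  have [K1 K1P] : exists K, forall t, `|Re (X t i j)| <= K.
    apply: (@bounded_half_line (fun t => Re (X t i j)) (Re (L i j))).
    - by move=> t; have [h _] := Xc t i j.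
    - by move=> t t0; rewrite X0.
    - by have [h _] := XL i j.
  have [K2 K2P] : exists K, forall t, `|Im (X t i j)| <= K.
    apply: (@bounded_half_line (fun t => Im (X t i j)) (Im (L i j))).
    - by move=> t; have [_ h] := Xc t i j.
    - by move=> t t0; rewrite X0.
    - by have [_ h] := XL i j.
  by exists (K1 + K2) => t; apply: lerD.
have bd' (i : 'I_m) : exists K : 'I_n -> R, forall j t, `|Re (X t i j)| + `|Im (X t i j)| <= K j.
  exact: (dep_choice (fun j => bd i j)).
have [K KP] := dep_choice bd'.
have K0 i j : 0 <= K i j by apply: le_trans (KP i j 0); rewrite addr_ge0.
exists (\sum_i \sum_j K i j) => t i j.
have h : `|Re (X t i j)| + `|Im (X t i j)| <= \sum_i \sum_j K i j.
  apply: le_trans (KP i j t) _.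
  apply: le_trans (term_le_sum i (fun i => sumr_ge0 _ (fun j _ => K0 i j))).
  exact: (term_le_sum j (K0 i)).
have h1 := normr_ge0 (Re (X t i j)); have h2 := normr_ge0 (Im (X t i j)).
by split; apply: le_trans h; rewrite ?lerDl ?lerDr.
Qed.

Lemma entry_prod_bound (K a b c d e f : R) : `|a| <= K -> `|b| <= K ->
  `|(c * (a * e - b * f) + d * (a * f + b * e))| <= K * (c ^+ 2 + d ^+ 2 + (e ^+ 2 + f ^+ 2)).
Proof.
move=> aK bK.
have -> : c * (a * e - b * f) + d * (a * f + b * e) =
  a * (c * e + d * f) + b * (d * e - c * f) by ring.
apply: le_trans (ler_normD _ _) _; rewrite !normrM.
set S := c ^+ 2 + d ^+ 2 + (e ^+ 2 + f ^+ 2).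
have s1 : `|c * e + d * f| <= S / 2.
  by rewrite ler_norml /S; apply/andP; split; have := sqr_ge0 (c - e); have := sqr_ge0 (d - f);
    have := sqr_ge0 (c + e); have := sqr_ge0 (d + f); rewrite !sqrrD ?sqrrB; lra.
have s2 : `|d * e - c * f| <= S / 2.
  by rewrite ler_norml /S; apply/andP; split; have := sqr_ge0 (d - e); have := sqr_ge0 (c - f);
    have := sqr_ge0 (d + e); have := sqr_ge0 (c + f); rewrite !sqrrD ?sqrrB; lra.
have -> : K * S = K * (S / 2) + K * (S / 2) by lra.
by apply: lerD; apply: ler_pM.
Qed.

Lemma sum_const_add n (K a : R) (f : 'I_n -> R) :
  \sum_k K * (a + f k) = K * (n%:R * a + \sum_k f k).
Proof.
by rewrite -mulr_sumr big_split /= sumr_const card_ord mulr_natl.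
Qed.

Lemma sum_add_const n (K c a : R) (f : 'I_n -> R) :
  \sum_k K * (c * f k + a) = K * (c * \sum_k f k + n%:R * a).
Proof.
by rewrite -mulr_sumr big_split /= sumr_const card_ord mulr_natl mulr_sumr.
Qed.

Lemma quad_bound m n p (B : 'M[C]_(m, n)) (X : 'M[C]_(m, p)) (Y : 'M[C]_(n, p)) K :
  entry_le B K -> `|rip X (B *m Y)| <= K * (n%:R * nsq X + m%:R * nsq Y).
Proof.
move=> BK.
have -> : rip X (B *m Y) = \sum_j \sum_i \sum_k
   (Re (X i j) * (Re (B i k) * Re (Y k j) - Im (B i k) * Im (Y k j)) +
    Im (X i j) * (Re (B i k) * Im (Y k j) + Im (B i k) * Re (Y k j))).
  rewrite ripE; apply: eq_bigr => j _; apply: eq_bigr => i _.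
  rewrite mxE cRe_sum cIm_sum !mulr_sumr -big_split; apply: eq_bigr => k _ /=.
  by rewrite cReM cImM.
have -> : K * (n%:R * nsq X + m%:R * nsq Y) = \sum_j \sum_(i < m) \sum_(k < n)
   K * (Re (X i j) ^+ 2 + Im (X i j) ^+ 2 + (Re (Y k j) ^+ 2 + Im (Y k j) ^+ 2)).
  rewrite !nsqE !mulr_sumr -big_split mulr_sumr; apply: eq_bigr => j _ /=.
  under [RHS]eq_bigr => i _ do rewrite sum_const_add.
  by rewrite sum_add_const.
apply: le_trans (ler_norm_sum _ _ _) _; apply: ler_sum => j _.
apply: le_trans (ler_norm_sum _ _ _) _; apply: ler_sum => i _.
apply: le_trans (ler_norm_sum _ _ _) _; apply: ler_sum => k _.
by have [h1 h2] := BK i k; apply: entry_prod_bound.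
Qed.

Lemma nsq_cont m n (X : R -> 'M[C]_(m, n)) t : mcvg (nbhs t) X (X t) ->
  {for t, continuous (fun s => nsq (X s))}.
Proof. by move=> Xc; exact: (cvg_rip Xc Xc). Qed.

(** The derivative of |X|^2 is at most c |X|^2 in absolute value, so that
    |X|^2 exp (- c t) decreases and |X|^2 exp (c t) increases. The first bound
    gives uniqueness of solutions, the second their injectivity. *)
Lemma linear_growth n p (B : R -> 'M[C]_n) (X : R -> 'M[C]_(n, p)) K :
  (forall t, entry_le (B t) K) -> (forall t, mcvg (nbhs t) X (X t)) ->
  (forall t, 0 < t -> mder X t (B t *m X t)) ->
  exists c : R, forall t, 0 <= t ->
    nsq (X t) <= nsq (X 0) * expR (c * t) /\ nsq (X 0) <= nsq (X t) * expR (c * t).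
Proof.
move=> BK Xc Xd; pose c := 2 * (K * (n%:R + n%:R)); exists c => t t0.
have b s : `|2 * rip (X s) (B s *m X s)| <= c * nsq (X s).
  rewrite normrM (ger0_norm (ler0n _ 2)) /c -mulrA ler_pM2l // -mulrA mulrDl.
  exact: quad_bound.
have ec (k : R) : continuous (fun s => nsq (X s) * expR (k * s)).
  by move=> s; apply: cvgM; [exact: nsq_cont | exact: rder_cont (rder_exp k s)].
have ed k s : 0 < s -> rder (fun s => nsq (X s) * expR (k * s)) s
    ((2 * rip (X s) (B s *m X s) + k * nsq (X s)) * expR (k * s)).
  move=> s0; apply: (rder_eq (rderM (rder_nsq (Xd s s0)) (rder_exp k s))); ring.
split.
  have h : - (nsq (X 0) * expR (- c * 0)) <= - (nsq (X t) * expR (- c * t)).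
    apply: (@nondecreasing_from _ (fun s => - (nsq (X s) * expR (- c * s)))
     (fun s => - ((2 * rip (X s) (B s *m X s) + - c * nsq (X s)) * expR (- c * s))) 0) => //.
    - by move=> s; apply: cvgN; exact: ec.
    - by move=> s s0; apply: rderN; exact: ed.
    - move=> s s0; rewrite -mulNr mulr_ge0 ?expR_ge0 //.
      by have := b s; rewrite ler_norml => /andP[_]; lra.
  move: h; rewrite mulr0 expR0 mulr1 lerN2 => h.
  have := ler_wpM2r (expR_ge0 (c * t)) h.
  by rewrite -mulrA -expRD mulNr addNr expR0 mulr1.
have h : nsq (X 0) * expR (c * 0) <= nsq (X t) * expR (c * t).
  apply: (@nondecreasing_from _ (fun s => nsq (X s) * expR (c * s))
     (fun s => (2 * rip (X s) (B s *m X s) + c * nsq (X s)) * expR (c * s))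
     0 _ _ _ 0 t (lexx 0) t0).
  - exact: (ec c).
  - by move=> s s0; exact: ed.
  - move=> s s0; rewrite mulr_ge0 ?expR_ge0 //.
    by have := b s; rewrite ler_norml => /andP[+ _]; lra.
by move: h; rewrite mulr0 expR0 mulr1.
Qed.

(** The complex system is solved as a real one of twice the size, one column at
    a time; in the index (i, b), the boolean b selects imaginary parts. *)
Lemma linear_ode_mx n (B : R -> 'M[C]_n) K :
  (forall t, mcvg (nbhs t) B (B t)) -> (forall t, entry_le (B t) K) ->
  exists g : R -> 'M[C]_n, [/\ forall t, mcvg (nbhs t) g (g t),
    forall t, t <= 0 -> g t = 1%:M & forall t, 0 < t -> mder g t (B t *m g t)].
Proof.
move=> Bc BK.
pose L (i j : 'I_n * bool) t : R :=
  if i.2 then (if j.2 then Re (B t i.1 j.1) else Im (B t i.1 j.1))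
  else (if j.2 then - Im (B t i.1 j.1) else Re (B t i.1 j.1)).
have Lc i j : continuous (L i j).
  move=> t; have [h1 h2] := Bc t i.1 j.1; rewrite /L.
  by case: i.2; case: j.2 => //; apply: cvgN.
have Lb i j t : `|L i j t| <= K.
  have [h1 h2] := BK t i.1 j.1; rewrite /L.
  by case: i.2; case: j.2; rewrite ?normrN.
have col_sol (k : 'I_n) : exists y : 'I_n * bool -> R -> R, [/\ forall i, continuous (y i),
  forall i t, t <= 0 -> y i t = if i.2 then 0 else (i.1 == k)%:R
  & forall i t, 0 < t -> rder (y i) t (\sum_j L i j t * y j t)].
  exact: (linear_ode (fun i => if i.2 then 0 else (i.1 == k)%:R) Lc Lb).
have [y yP] := dep_choice col_sol.
pose g t := \matrix_(i < n, k < n) (y k (i, false) t +i* y k (i, true) t).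
exists g; split.
- move=> t i k; have [yc _ _] := yP k; rewrite /g mxE; under eq_fun do rewrite mxE.
  by split; apply: yc.
- move=> t t0; apply/matrixP => i k; have [_ y0 _] := yP k; rewrite !mxE !y0 //=.
  by apply: C_eq => /=; case: eqP.
- move=> t t0 i k; have [_ _ yd] := yP k.
  have sumE (f : 'I_n * bool -> R) : \sum_j f j = \sum_(j < n) (f (j, true) + f (j, false)).
    transitivity (\sum_(p : 'I_n * bool) f (p.1, p.2)); first by apply: eq_bigr => -[].
    rewrite -(pair_big xpredT xpredT (fun j b => f (j, b))) /=.
    by apply: eq_bigr => j _; rewrite big_bool.
  split.
    under eq_fun do rewrite mxE /=; apply: (rder_eq (yd (i, false) t t0)).
    rewrite sumE mxE cRe_sum; apply: eq_bigr => j _; rewrite /L /= mxE cReM /=; ring.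
  under eq_fun do rewrite mxE /=; apply: (rder_eq (yd (i, true) t t0)).
  rewrite sumE mxE cIm_sum; apply: eq_bigr => j _; rewrite /L /= mxE cImM /=; ring.
Qed.

(** If L > 0, then u gains more than 2 over an interval of length 6 / L far
    out, where it stays within 1 of its limit. *)
Lemma derivative_limit0 (u u' : R -> R) (l L : R) : continuous u ->
  (forall t, 0 < t -> rder u t (u' t)) ->
  u t @[t --> +oo] --> l -> u' t @[t --> +oo] --> L -> L <= 0.
Proof.
move=> uc ud ul u'L; rewrite leNgt; apply/negP => L0.
have [T TP] : exists T, forall t, T < t -> L / 2 <= u' t.
  have L2 : 0 < L / 2 by rewrite divr_gt0.
  move/cvgrPdist_le : u'L => /(_ _ L2) [T [_ TP]]; exists T => t /TP /=.
  by rewrite ler_norml => /andP[]; lra.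
have [T1 T1P] : exists T, forall t, T < t -> `|l - u t| <= 1.
  by move/cvgrPdist_le : ul => /(_ 1 ltr01) [T1 [_ TP1]]; exists T1.
pose a := Num.max (Num.max T T1) 0 + 1.
have [aT aT1 a0] : [/\ T < a, T1 < a & 0 < a].
  have m1 : T <= Num.max (Num.max T T1) 0 by rewrite !le_max lexx.
  have m2 : T1 <= Num.max (Num.max T T1) 0 by rewrite !le_max lexx !orbT.
  have m3 : 0 <= Num.max (Num.max T T1) 0 by rewrite le_max lexx orbT.
  by rewrite /a; split; lra.
pose d := 2 * (3 / L).
have d0 : 0 <= d by rewrite !mulr_ge0 // invr_ge0 ltW.
have h : u a - (L / 2) * a <= u (a + d) - (L / 2) * (a + d).
  apply: (@nondecreasing_from _ (fun s => u s - (L / 2) * s) (fun s => u' s - L / 2) a) => //.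
  - move=> s; apply: cvgB; first exact: uc.
    by apply: cvgM; [exact: cvg_cst | exact: cvg_id].
  - move=> s sa; have s0 : 0 < s by apply: lt_trans sa.
    apply: (rder_eq (rderD (ud s s0) (rderN (rderM (rder_cst s (L / 2)) (rder_id s))))).
    by rewrite mul0r add0r mulr1.
  - by move=> s sa; rewrite subr_ge0; apply: TP; apply: lt_trans sa.
  - by rewrite lerDl.
have h1 := T1P a aT1.
have h2 : `|l - u (a + d)| <= 1 by apply: T1P; apply: lt_le_trans aT1 _; rewrite lerDl.
have e : L / 2 * d = 3 by rewrite /d; field; rewrite gt_eqF.
have e2 : L / 2 * (a + d) = L / 2 * a + 3 by rewrite [LHS]mulrDr e.
move: h h1 h2; rewrite e2 !ler_norml => h /andP[h1 h1'] /andP[h2 h2']; lra.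
Qed.

End Estimates.

(** * Exponential dichotomy *)

(** A subspace of maximal dimension on which P holds contains all of P. *)
Lemma vspace_of_pred (K : fieldType) (V : vectType K) (P : V -> Prop) :
  P 0 -> (forall c x y, P x -> P y -> P (c *: x + y)) ->
  exists U : {vspace V}, forall x, x \in U <-> P x.
Proof.
move=> P0 Plin.
pose ok d := `[< exists U : {vspace V}, \dim U = d /\ forall x, x \in U -> P x >].
have ok0 : exists d, ok d.
  exists 0%N; apply/asboolP; exists 0%VS; rewrite dimv0; split=> // x.
  by rewrite memv0 => /eqP ->.
have bd d : ok d -> (d <= \dim {: V})%N.
  by move=> /asboolP [U [<- _]]; apply: dimvS; exact: subvf.
have [d /asboolP [U [Ud UP]] dmax] := ex_maxnP ok0 bd.
exists U => x; split=> [/UP //|Px]; apply: contrapT => xU.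
have lt : (\dim U < \dim (<[x]> + U))%N.
  rewrite ltnNge; apply/negP => le; apply: xU.
  have /eqP -> : U == (<[x]> + U)%VS by rewrite eqEdim addvSr le.
  by apply: (subvP (addvSl _ _)); exact: memv_line.
have okU : ok (\dim (<[x]> + U)).
  apply/asboolP; exists (<[x]> + U)%VS; split=> // _ /memv_addP [_ /vlineP [c ->] [u uU ->]].
  by apply: Plin => //; apply: UP.
by have := dmax _ okU; rewrite -Ud leqNgt lt.
Qed.

(** The elementary inequalities behind the dichotomy. In the first two, A is the
    squared norm of a component of a solution, S that of the solution, r the
    quadratic form of the limit of H on the component, and p the error made by
    replacing H by its limit; in the others, A and B are the squared norms of
    the slow and fast components. *)
Section Speeds.
Variables (R : realType) (lam dlt r A S p : R).

Lemma slow_speed : r <= - lam * A -> `|p| <= dlt / 8 * S ->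
  4 * (r + (lam - dlt / 2) * A) + 4 * p <= - 2 * dlt * A + dlt / 2 * S.
Proof. by move=> h; rewrite ler_norml => /andP[_ h']; lra. Qed.

Lemma fast_speed : (- lam + dlt) * A <= r -> `|p| <= dlt / 8 * S ->
  2 * dlt * A - dlt / 2 * S <= 4 * (r + (lam - dlt / 2) * A) + 4 * p.
Proof. by move=> h; rewrite ler_norml => /andP[h' _]; lra. Qed.

Lemma gap_speed (a' b' B : R) : 0 < dlt -> 0 <= A ->
  a' <= - 2 * dlt * A + dlt / 2 * (A + B) -> 2 * dlt * B - dlt / 2 * (A + B) <= b' ->
  dlt * (B - A) <= b' - a'.
Proof.
move=> d0 A0; have dA : 0 <= dlt * A by rewrite mulr_ge0 // ltW.
lra.
Qed.

Lemma gap_speed0 (a' b' B : R) : 0 < dlt -> 0 <= A -> 0 <= B ->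
  a' <= - 2 * dlt * A + dlt / 2 * (A + B) -> 2 * dlt * B - dlt / 2 * (A + B) <= b' ->
  0 <= b' - a'.
Proof.
move=> d0 A0 B0; have : 0 <= dlt * A by rewrite mulr_ge0 // ltW.
have : 0 <= dlt * B by rewrite mulr_ge0 // ltW.
lra.
Qed.

Lemma slow_decay (a' B : R) : 0 < dlt -> 0 <= A -> B - A <= 0 ->
  a' <= - 2 * dlt * A + dlt / 2 * (A + B) -> a' <= 0.
Proof.
move=> d0 A0 BA; have : 0 <= dlt * A by rewrite mulr_ge0 // ltW.
have : dlt * (B - A) <= 0 by rewrite pmulr_rle0.
lra.
Qed.

End Speeds.

Section Auxiliary.
Variable R : realType.
Local Notation C := R[i].

Lemma nsq_comb_le m n p (Z : 'M[C]_(m, n)) (c : C) (x y : 'M[C]_(n, p)) :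
  nsq (Z *m (c *: x + y)) <=
  2 * ((Re c ^+ 2 + Im c ^+ 2) * nsq (Z *m x) + nsq (Z *m y)).
Proof.
rewrite mulmxDr -scalemxAr; move: (Z *m x) (Z *m y) => u w.
rewrite !nsqE mulr_sumr -big_split mulr_sumr; apply: ler_sum => j _ /=.
rewrite mulr_sumr -big_split mulr_sumr; apply: ler_sum => i _ /=.
rewrite !mxE cReD cImD cReM cImM.
move: (Re c) (Im c) (Re (u i j)) (Im (u i j)) (Re (w i j)) (Im (w i j)) => a b p1 p2 q1 q2.
rewrite -subr_ge0.
have -> : 2 * ((a ^+ 2 + b ^+ 2) * (p1 ^+ 2 + p2 ^+ 2) + (q1 ^+ 2 + q2 ^+ 2)) -
   ((a * p1 - b * p2 + q1) ^+ 2 + (a * p2 + b * p1 + q2) ^+ 2) =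
   (a * p1 - b * p2 - q1) ^+ 2 + (a * p2 + b * p1 - q2) ^+ 2 by ring.
by rewrite addr_ge0 ?sqr_ge0.
Qed.

Lemma affine_le_shift (p q k s t : R) : p - k * s <= q - k * t -> p + k * (t - s) <= q.
Proof. lra. Qed.

Lemma escape_time (p k K t m : R) : 0 < k -> t <= m -> 0 < p ->
  K < p + k * (m + K / k - t).
Proof.
move=> k0 tm p0; have e : k * (K / k) = K by rewrite mulrC divfK ?gt_eqF.
have km : 0 <= k * (m - t) by rewrite mulr_ge0 ?subr_ge0 // ltW.
have -> : k * (m + K / k - t) = k * (m - t) + k * (K / k) by ring.
by rewrite e; lra.
Qed.

Lemma sub_le_add_ge0 (a b : R) : 0 <= a -> 0 <= b -> b - a <= a + b.
Proof. lra. Qed.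

Lemma add_le_double (a a0 b : R) : a <= a0 -> b - a <= 0 -> a + b <= 2 * a0.
Proof. lra. Qed.

Lemma norm_le1_of_sumsqr (a b : R) : a ^+ 2 + b ^+ 2 <= 1 -> `|a| <= 1 /\ `|b| <= 1.
Proof.
move=> h; have a2 := sqr_ge0 a; have b2 := sqr_ge0 b.
by split; rewrite -ler_sqr ?nnegrE // expr1n real_normK ?num_real //; lra.
Qed.

Lemma dim_cap_gt0 (k1 k2 w m nn n s c : nat) : (k1 + w = n)%N -> (n <= k2 + m)%N ->
  (nn + m = n)%N -> (w < nn)%N -> (s + c = k1 + k2)%N -> (s <= n)%N -> (0 < c)%N.
Proof. lia. Qed.

End Auxiliary.

(** Solutions of Y' = (2 H + 2 lam') Y, where H tends to Hi and lam' lies midway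
    in the gap (lam - dlt, lam): for H = Hi they would decay on the image of N
    and grow on its complement, both at rate dlt. For H the vectors
    whose solution stays bounded need not form that image, but they form a
    subspace of the same dimension. *)
Section Dichotomy.
Variables (R : realType) (n : nat).
Local Notation C := R[i].
Variables (H : R -> 'M[C]_n) (Hi N : 'M[C]_n) (Y : R -> 'M[C]_n) (lam dlt : R).
Hypothesis dlt0 : 0 < dlt.
Hypothesis No : orthoproj N.
Hypothesis NH : N *m Hi = Hi *m N.
Local Notation M := (1%:M - N).
Hypothesis slow : forall x : 'cV_n, rip (N *m x) (Hi *m (N *m x)) <= - lam * nsq (N *m x).
Hypothesis fast : forall x : 'cV_n,
  (- lam + dlt) * nsq (M *m x) <= rip (M *m x) (Hi *m (M *m x)).
Hypothesis HHi : mcvg +oo H Hi.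
Hypothesis Yc : forall t : R, mcvg (nbhs t) Y (Y t).
Local Notation lam' := (lam - dlt / 2).
Hypothesis Yd : forall t : R, 0 < t ->
  mder Y t ((2%:C *: H t + (2 * lam')%:C%:M) *m Y t).
Hypothesis Yi : forall (t : R) (x : 'cV_n), 0 <= t -> Y t *m x = 0 -> x = 0.

Lemma orthoproj_compl : orthoproj M.
Proof.
have [Na NN] := No; split; first by rewrite hadjB hadj1 Na.
by rewrite mulmxBl !mulmxBr !mul1mx mulmx1 NN subrr subr0.
Qed.

Lemma dim_cV : \dim {: 'cV[C]_n} = n.
Proof. by rewrite dimvf dim_matrix; exact: muln1. Qed.

Lemma dim_fixsp1 : \dim (fixsp (1%:M : 'M[C]_n)) = n.
Proof.
have -> : fixsp (1%:M : 'M[C]_n) = fullv.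
  by apply/vspaceP => x; rewrite memvf; apply/fixspP; rewrite mul1mx.
exact: dim_cV.
Qed.

Lemma dim_compl : (\dim (fixsp N) + \dim (fixsp M))%N = n.
Proof.
rewrite -dim_orthoproj_add //; last 2 first.
- exact: orthoproj_compl.
- by rewrite addrC subrK; split; rewrite ?hadj1 ?mul1mx.
by rewrite addrC subrK; exact: dim_fixsp1.
Qed.

Lemma nsq_add_orth (p d : 'cV[C]_n) : rip p d = 0 -> nsq (p + d) = nsq p + nsq d.
Proof. by move=> o; rewrite /nsq ripDl !ripDr o (ripC d) o addr0 add0r. Qed.

Lemma nsq_split (y : 'cV[C]_n) : nsq y = nsq (N *m y) + nsq (M *m y).
Proof.
have [Na NN] := No.
have o : rip (N *m y) (M *m y) = 0.
  by rewrite ripC rip_adj Na mulmxA mulmxBr NN mulmx1 subrr mul0mx rip0l.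
by rewrite -(nsq_add_orth o) -mulmxDl addrC subrK mul1mx.
Qed.

Lemma rip_proj (P : 'M[C]_n) (y w : 'cV[C]_n) : orthoproj P ->
  rip (P *m y) (P *m w) = rip (P *m y) w.
Proof. by move=> [Pa PP]; rewrite rip_adj Pa mulmxA PP. Qed.

(** The off-diagonal blocks of Hi vanish. *)
Lemma rip_proj_comm (P : 'M[C]_n) (y : 'cV[C]_n) : orthoproj P -> P *m Hi = Hi *m P ->
  rip (P *m y) (Hi *m y) = rip (P *m y) (Hi *m (P *m y)).
Proof.
by move=> Po PH; rewrite -(rip_proj _ _ Po) mulmxA PH -mulmxA.
Qed.

(* the squared norms of the slow and fast components, and their derivatives *)
Let a (x : 'cV[C]_n) t := nsq (N *m (Y t *m x)).
Let b (x : 'cV[C]_n) t := nsq (M *m (Y t *m x)).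
Let dY (x : 'cV[C]_n) t := (2%:C *: H t + (2 * lam')%:C%:M) *m (Y t *m x).
Let a' (x : 'cV[C]_n) t := 2 * rip (N *m (Y t *m x)) (dY x t).
Let b' (x : 'cV[C]_n) t := 2 * rip (M *m (Y t *m x)) (dY x t).

Lemma der_proj (P : 'M[C]_n) (x : 'cV[C]_n) (t : R) : orthoproj P -> 0 < t ->
  rder (fun s => nsq (P *m (Y s *m x))) t
    (2 * rip (P *m (Y t *m x)) ((2%:C *: H t + (2 * lam')%:C%:M) *m (Y t *m x))).
Proof.
move=> Po t0.
have h : mder (fun s => P *m (Y s *m x)) t (P *m ((2%:C *: H t + (2 * lam')%:C%:M) *m (Y t *m x))).
  apply: (mder_eq (mderM (mder_cst t P) (mderM (Yd t0) (mder_cst t x)))).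
  by rewrite mul0mx add0r mulmx0 addr0 -mulmxA.
by apply: (rder_eq (rder_nsq h)); rewrite rip_proj.
Qed.

Lemma cont_proj (P : 'M[C]_n) (x : 'cV[C]_n) : continuous (fun s => nsq (P *m (Y s *m x))).
Proof.
move=> t; apply: nsq_cont; apply: mcvgM; first exact: mcvg_cst.
by apply: mcvgM => //; exact: mcvg_cst.
Qed.

(** Past some time the perturbation H - Hi takes away at most a quarter of the
    rate 2 dlt at which the squared norms would decay and grow. *)
Lemma close_H : exists2 T, 0 <= T & forall t, T < t ->
  forall (P : 'M[C]_n) (y : 'cV[C]_n), orthoproj P ->
    `|rip (P *m y) ((H t - Hi) *m y)| <= dlt / 8 * nsq y.
Proof.
pose e := dlt / (16 * (n%:R + 1)).
have n0 : 0 <= (n%:R : R) by [].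
have e0 : 0 < e by rewrite divr_gt0 // mulr_gt0 // ltr_wpDl.
have en : 2 * (e * n%:R) <= dlt / 8.
  have -> : dlt / 8 = 2 * (e * (n%:R + 1)) by rewrite /e; field; rewrite gt_eqF // ltr_wpDl.
  by rewrite ler_pM2l // ler_pM2l // lerDl.
have [T TP] : exists T, forall t, T < t -> entry_le (H t - Hi) e.
  have near_e (i j : 'I_n) : \forall t \near +oo,
      `|Re ((H t - Hi) i j)| <= e /\ `|Im ((H t - Hi) i j)| <= e.
    have [h1 h2] := HHi i j.
    move/cvgrPdist_le : h1 => /(_ e e0) h1; move/cvgrPdist_le : h2 => /(_ e e0) h2.
    apply: filterS2 h1 h2 => t /= k1 k2.
    by rewrite !mxE cReD cReN cImD cImN [X in X <= _ /\ _]distrC [X in _ /\ X <= _]distrC.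
  have : \forall t \near +oo, forall i j,
      `|Re ((H t - Hi) i j)| <= e /\ `|Im ((H t - Hi) i j)| <= e.
    by apply: filter_forall => i; apply: filter_forall => j; exact: near_e.
  by move=> [T [_ TP]]; exists T => t /TP.
exists (Num.max T 0); first by rewrite le_max lexx orbT.
move=> t; rewrite gt_max => /andP[Tt _] P y Po.
apply: le_trans (quad_bound (P *m y) y (TP t Tt)) _.
have Py : nsq (P *m y) <= nsq y.
  have -> : nsq y = nsq (P *m y) + nsq (y - P *m y).
    have [Pa PP] := Po.
    have o : rip (P *m y) (y - P *m y) = 0.
      by rewrite -{1}PP -mulmxA -{1}Pa -rip_adj mulmxBr mulmxA PP subrr rip0r.
    by rewrite -(nsq_add_orth o) addrC subrK.
  by rewrite lerDl nsq_ge0.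
apply: (@le_trans _ _ (2 * (e * n%:R) * nsq y)); last exact: ler_wpM2r (nsq_ge0 _) _ _ en.
have -> : 2 * (e * n%:R) * nsq y = e * (n%:R * nsq y + n%:R * nsq y) by ring.
by rewrite ler_pM2l // lerD2r ler_wpM2l.
Qed.

Lemma speeds : exists2 T, 0 <= T & forall x t, T < t ->
  a' x t <= - 2 * dlt * a x t + dlt / 2 * (a x t + b x t) /\
  2 * dlt * b x t - dlt / 2 * (a x t + b x t) <= b' x t.
Proof.
have [T T0 TP] := close_H; exists T => // x t Tt; set y := Y t *m x.
have expand (P : 'M[C]_n) : orthoproj P -> P *m Hi = Hi *m P ->
   2 * rip (P *m y) ((2%:C *: H t + (2 * lam')%:C%:M) *m y) =
   4 * (rip (P *m y) (Hi *m (P *m y)) + lam' * nsq (P *m y)) +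
   4 * rip (P *m y) ((H t - Hi) *m y).
  move=> Po PH; rewrite -(rip_proj_comm y Po PH).
  have -> : nsq (P *m y) = rip (P *m y) y by rewrite /nsq rip_proj.
  rewrite mulmxDl mul_scalar_mx -scalemxAl mulmxBl !ripDr ripNr !ripZr; ring.
have MH : M *m Hi = Hi *m M by rewrite mulmxBl mulmxBr mul1mx mulmx1 NH.
have sy := nsq_split y.
have h1 := TP t Tt N y No; have h2 := TP t Tt M y orthoproj_compl.
rewrite /a' /b' /dY -/y (expand N No NH) (expand M orthoproj_compl MH) /a /b -/y -sy.
exact: conj (slow_speed (slow y) h1) (fast_speed (fast y) h2).
Qed.

Let phi (x : 'cV[C]_n) t := b x t - a x t.

(** Since phi' >= dlt phi and phi' >= 0, phi never decreases and, once positive,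
    grows without bound; as long as it is nonpositive, the slow component
    dominates and decreases. *)
Lemma gap_facts : exists2 T, 0 <= T & [/\
  forall x s t, T <= s -> s <= t -> phi x s <= phi x t,
  forall x s t, T <= s -> s <= t -> 0 < phi x s ->
    phi x s + dlt * phi x s * (t - s) <= phi x t
& forall x, (forall t, T <= t -> phi x t <= 0) -> forall t, T <= t -> a x t <= a x T].
Proof.
have [T T0 TP] := speeds; exists T; first exact: T0.
have phic x : continuous (phi x).
  by move=> t; apply: cvgB; apply: cont_proj.
have t_gt0 (t : R) : T < t -> 0 < t by apply: le_lt_trans.
have phid x t : T < t -> rder (phi x) t (b' x t - a' x t).
  move=> /t_gt0 t0; apply: rderD; first exact: der_proj orthoproj_compl t0.
  by apply: rderN; exact: der_proj No t0.
have mono x s t : T <= s -> s <= t -> phi x s <= phi x t.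
  apply: (nondecreasing_from (phic x) (phid x)) => {s}{}t Tt.
  have [h1 h2] := TP x t Tt.
  exact: gap_speed0 dlt0 (nsq_ge0 _) (nsq_ge0 _) h1 h2.
split; [exact: mono | move=> x s t Ts st ps | move=> x neg t Tt].
- have h : phi x s - dlt * phi x s * s <= phi x t - dlt * phi x s * t.
    apply: (@nondecreasing_from _ (fun u => phi x u - dlt * phi x s * u)
      (fun u => (b' x u - a' x u) - dlt * phi x s) s _ _ _ s t (lexx s) st).
    + move=> u; apply: cvgB; first exact: phic.
      by apply: cvgM; [exact: cvg_cst | exact: cvg_id].
    + move=> u su; apply: (rder_eq (rderD (phid x u (le_lt_trans Ts su))
        (rderN (rderM (rder_cst u (dlt * phi x s)) (rder_id u))))).
      by rewrite mul0r add0r mulr1.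
    + move=> u su; have [h1 h2] := TP x u (le_lt_trans Ts su).
      rewrite subr_ge0; apply: le_trans (gap_speed dlt0 (nsq_ge0 _) h1 h2).
      exact: (ler_wpM2l (ltW dlt0) (mono x s u Ts (ltW su))).
  exact: affine_le_shift h.
- rewrite -lerN2.
  apply: (@nondecreasing_from _ (fun u => - a x u) (fun u => - a' x u) T _ _ _ T t (lexx T) Tt).
  + by move=> u; apply: cvgN; apply: cont_proj.
  + by move=> u Tu; apply: rderN; exact: der_proj No (t_gt0 u Tu).
  + move=> u Tu; rewrite oppr_ge0; have [h1 _] := TP x u Tu.
    exact: slow_decay dlt0 (nsq_ge0 _) (neg u (ltW Tu)) h1.
Qed.

(** By [gap_facts] a solution is bounded exactly when phi stays nonpositive. In
    that case the fast component vanishes with the slow one, so that x is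
    determined by its slow component at time T; this bounds the dimension of W
    from above. If W were too small, then for each t a unit vector orthogonal
    to W would have a solution without fast component at time t, hence with phi
    nonpositive up to time t. A limit of these vectors as t tends to infinity
    has phi nonpositive throughout, so that it lies in W, yet it is a unit
    vector orthogonal to W. *)
Lemma dichotomy : exists W : {vspace 'cV[C]_n}, \dim W = \dim (fixsp N) /\
  forall x, x \in W <-> exists K T, forall t, T <= t -> nsq (Y t *m x) <= K.
Proof.
have [T T0 [mono grow decay]] := gap_facts.
have [W WP] : exists W : {vspace 'cV[C]_n}, forall x, x \in W <->
    exists K T, forall t, T <= t -> nsq (Y t *m x) <= K.
  apply: vspace_of_pred.
    by exists 0, 0 => t _; rewrite mulmx0 /nsq rip0r.
  move=> c x y [K1 [T1 h1]] [K2 [T2 h2]].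
  pose cc := Re c ^+ 2 + Im c ^+ 2.
  have cc0 : 0 <= cc by rewrite addr_ge0 ?sqr_ge0.
  exists (2 * (cc * K1 + K2)), (Num.max T1 T2) => t; rewrite ge_max => /andP[t1 t2].
  apply: (le_trans (nsq_comb_le (Y t) c x y)); rewrite ler_pM2l //.
  by apply: lerD; [apply: ler_wpM2l => //; exact: h1 | exact: h2].
(* If phi > 0 at time t, the linear growth exceeds any bound K by time u. *)
have Wneg x : x \in W <-> forall t, T <= t -> phi x t <= 0.
  split=> [/WP [K [T1 KP]] t Tt|neg].
    rewrite leNgt; apply/negP => p0.
    have dp : 0 < dlt * phi x t by rewrite mulr_gt0.
    pose u := Num.max t T1 + K / (dlt * phi x t).
    have K0 : 0 <= K by apply: le_trans (KP T1 (lexx T1)); exact: nsq_ge0.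
    have mu : Num.max t T1 <= u by rewrite lerDl divr_ge0 // ltW.
    have tu : t <= u by apply: le_trans mu; rewrite le_max lexx.
    have T1u : T1 <= u by apply: le_trans mu; rewrite le_max lexx orbT.
    have h := grow x t u Tt tu p0.
    have h2 : phi x u <= K.
      apply: le_trans (KP u T1u); rewrite (nsq_split (Y u *m x)) /phi.
      by apply: sub_le_add_ge0; exact: nsq_ge0.
    have m1 : t <= Num.max t T1 by rewrite le_max lexx.
    have := lt_le_trans (escape_time K dp m1 p0) h.
    by rewrite ltNge h2.
  apply/WP; exists (2 * a x T), T => t Tt.
  rewrite (nsq_split (Y t *m x)); have h1 := decay x neg t Tt; have h2 := neg t Tt.
  exact: add_le_double h1 h2.
exists W; split=> //; apply/eqP; rewrite eqn_leq; apply/andP; split.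
- pose f : 'Hom('cV[C]_n, 'cV[C]_n) := linfun (mulmx (N *m Y T)).
  have inj : (W :&: lker f = 0)%VS.
    apply/eqP; rewrite -subv0; apply/subvP => x; rewrite memv_cap => /andP[xW].
    rewrite memv_ker lfunE /= -mulmxA => /eqP Nx.
    have /Wneg /(_ T (lexx T)) := xW; rewrite /phi /a Nx [nsq 0]rip0r subr0 => b0.
    have bz : b x T = 0 by apply/eqP; rewrite eq_le b0; exact: nsq_ge0.
    rewrite memv0; apply/eqP; apply: (Yi T0); apply: nsq_eq0.
    by rewrite nsq_split Nx -/(b x T) bz [nsq 0]rip0r addr0.
  have := limg_ker_dim f W; rewrite inj dimv0 add0n => <-.
  apply: dimvS; apply/subvP => _ /memv_imgP [x _ ->]; apply/fixspP.
  by have [_ NN] := No; rewrite lfunE /= !mulmxA NN.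
rewrite leqNgt; apply/negP => lt.
have [PW [PWo PWf _]] := orthoproj_exists W.
(* By dimension count the two kernels meet for each t. *)
have wit t : exists x : 'cV[C]_n, [/\ PW *m x = 0, M *m (Y t *m x) = 0 & nsq x = 1].
  pose f1 : 'Hom('cV[C]_n, 'cV[C]_n) := linfun (mulmx PW).
  pose f2 : 'Hom('cV[C]_n, 'cV[C]_n) := linfun (mulmx (M *m Y t)).
  have d1 : (\dim (lker f1) + \dim W = n)%N.
    have := limg_ker_dim f1 fullv; rewrite capfv dim_cV => e.
    apply: etrans _ e; congr (_ + \dim _)%N.
    apply/vspaceP => x; rewrite -PWf; apply/fixspP/memv_imgP => [xP|[y _ ->]].
      by exists x; rewrite ?memvf // lfunE.
    by rewrite lfunE /= mulmxA; have [_ ->] := PWo.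
  have d2 : (n <= \dim (lker f2) + \dim (fixsp M))%N.
    have := limg_ker_dim f2 fullv; rewrite capfv dim_cV => e.
    rewrite -[X in (X <= _)%N]e leq_add2l; apply: dimvS; apply/subvP => _ /memv_imgP [y _ ->].
    apply/fixspP; rewrite lfunE /= !mulmxA; have [_ h] := orthoproj_compl.
    by rewrite h.
  have d3 : (0 < \dim (lker f1 :&: lker f2))%N.
    have h1 := dimv_sum_cap (lker f1) (lker f2).
    have h2 : (\dim (lker f1 + lker f2) <= n)%N.
      by rewrite -[X in (_ <= X)%N]dim_cV; apply: dimvS; exact: subvf.
    exact: dim_cap_gt0 d1 d2 dim_compl lt h1 h2.
  have [w [v0 f1w f2w]] : exists w, [/\ w != 0, f1 w = 0 & f2 w = 0].
    have pk := memv_pick (lker f1 :&: lker f2)%VS.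
    exists (vpick (lker f1 :&: lker f2)%VS); split.
    - by rewrite vpick0 -dimv_eq0 -lt0n.
    - by apply/eqP; rewrite -memv_ker; exact: subvP (capvSl _ _) _ pk.
    - by apply/eqP; rewrite -memv_ker; exact: subvP (capvSr _ _) _ pk.
  have w1 : PW *m w = 0 by rewrite -f1w lfunE.
  have w2 : M *m Y t *m w = 0 by rewrite -f2w lfunE.
  have w0 := nsq_gt0 v0.
  exists ((Num.sqrt (nsq w))^-1%:C *: w); split.
  - by rewrite -scalemxAr w1 scaler0.
  - by rewrite -!scalemxAr mulmxA w2 scaler0.
  - rewrite /nsq ripZl ripZr mulrA -expr2 exprVn sqr_sqrtr ?ltW //.
    by rewrite mulVf // gt_eqF.
have [x xP] := dep_choice wit.
have [G [GP Ginf Gbd]] := @ultra_limits R R +oo _.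
have xb t i : `|Re (x t i 0)| <= 1 /\ `|Im (x t i 0)| <= 1.
  have [_ _ x1] := xP t; have := nsq_ge_entry (x t) i 0; rewrite x1 => h.
  exact: norm_le1_of_sumsqr h.
have [z zP] : exists z, mcvg G x z.
  by apply: (mcvg_bounded Gbd (K := 1)); apply: nearW => t i j; rewrite (ord1 j).
have z1 : nsq z = 1.
  have h := cvg_rip (FF := GP) zP zP.
  have h1 : rip (x t) (x t) @[t --> G] --> (1 : R).
    have -> : (fun t => rip (x t) (x t)) = (fun=> 1).
      by apply/funext => t; have [_ _] := xP t.
    exact: cvg_cst.
  exact: (@cvg_unique _ (@Rhausdorff R) _ _ _ _ h h1).
have zW : z \in W.
  apply/Wneg => t Tt.
  have cv (P : 'M[C]_n) : nsq (P *m (Y t *m x s)) @[s --> G] --> nsq (P *m (Y t *m z)).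
    by apply: cvg_rip; apply: mcvgM (mcvg_cst _) _; apply: mcvgM (mcvg_cst _) _.
  have cphi : phi (x s) t @[s --> G] --> phi z t by apply: cvgB; apply: cv.
  apply: (@closed_cvg _ _ _ _ _ [set r : R | r <= 0] _ _ _ cphi).
    exact: closed_le.
  have : G [set s | t <= s] by apply: Ginf; exists t; split=> [|s /ltW //]; exact: num_real.
  apply: filterS => s ts; apply: le_trans (mono (x s) t s Tt ts) _.
  have [_ Mx _] := xP s; rewrite /phi /b Mx [nsq 0]rip0r sub0r oppr_le0; exact: nsq_ge0.
have PWz : PW *m z = 0.
  apply: (mcvg_unique (mcvgM (mcvg_cst PW) zP) (mcvg_cst 0)).
  by apply: nearW => t; have [] := xP t.
have : PW *m z = z by apply/fixspP; rewrite PWf.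
by rewrite PWz => z0; move: z1; rewrite -z0 [nsq 0]rip0r => /eqP; rewrite eq_sym oner_eq0.
Qed.

End Dichotomy.

(** * The limit of the flow *)

Section ClippedFlow.
Variable R : realType.

(** Freezing the flow for negative times makes it continuous on the whole
    line. *)
Lemma continuous_clip (u : R -> R) : (forall t : R, 0 < t -> {for t, continuous u}) ->
  u t @[t --> 0^'+] --> u 0 -> continuous (fun t : R => u (Num.max t 0)).
Proof.
move=> uc u0 t; have [tn|tp|->] := ltgtP t 0.
- have h : \forall s \near t, u 0 = u (Num.max s 0).
    by near=> s; rewrite max_r //; apply: ltW; near: s; exact: lt_nbhsl.
  rewrite /continuous_at (max_r (ltW tn)); apply: cvg_trans (near_eq_cvg h) _.
  exact: cvg_cst.
- have h : \forall s \near t, u s = u (Num.max s 0).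
    by near=> s; rewrite max_l //; apply: ltW; near: s; exact: lt_nbhsr.
  rewrite /continuous_at (max_l (ltW tp)); apply: cvg_trans (near_eq_cvg h) _.
  exact: uc.
rewrite /continuous_at maxxx; apply/cvgrPdist_le => e e0.
move/cvgrPdist_le : u0 => /(_ e e0); rewrite near_withinE => h.
near=> s; have [s0|s0] := leP s 0; first by rewrite subrr normr0 ltW.
by move: s0; near: s.
Unshelve. all: by end_near. Qed.

End ClippedFlow.

Section Flow.
Variables (R : realType) (Q : quiver) (v : vertex Q -> nat) (alpha : vertex Q -> R[i]).
Local Notation C := R[i].
Variables (A0 Ainf : Rep R v) (A : R -> Rep R v).
Hypothesis A_le0 : forall t, t <= 0 -> A t = A0.
Hypothesis A_cont : forall t a, mcvg (nbhs t) (fun s => A s a) (A t a).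
Hypothesis A_der : forall t a, 0 < t -> mder (fun s => A s a) t (- grad alpha (A t) a).
Hypothesis A_lim : forall a, mcvg +oo (fun s => A s a) (Ainf a).

Local Notation H t := (hmom alpha (A t)).

Lemma H_cont t l : mcvg (nbhs t) (fun s => H s l) (H t l).
Proof. by apply: mcvg_hmom => a; apply: A_cont. Qed.

Lemma H_lim l : mcvg +oo (fun s => H s l) (hmom alpha Ainf l).
Proof. by apply: mcvg_hmom => a; apply: A_lim. Qed.

(** The derivative of the flow has a limit, because the flow has one and the
    gradient is continuous; this limit can only be 0. *)
Lemma limit_critical a :
  hmom alpha Ainf (tgt a) *m Ainf a = Ainf a *m hmom alpha Ainf (src a).
Proof.
have gl : mcvg +oo (fun t => - grad alpha (A t) a) (- grad alpha Ainf a).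
  apply: mcvgN; apply: mcvgZ; first exact: ccvg_cst.
  apply: mcvgD; last apply: mcvgN; apply: mcvgM => //; exact: H_lim.
have z (u u' : R -> R) (l L : R) : continuous u -> (forall t, 0 < t -> rder u t (u' t)) ->
    u t @[t --> +oo] --> l -> u' t @[t --> +oo] --> L -> L = 0.
  move=> uc ud ul uL; apply/eqP; rewrite eq_le (derivative_limit0 uc ud ul uL) /=.
  have := @derivative_limit0 _ (fun t => - u t) (fun t => - u' t) (- l) (- L).
  rewrite oppr_le0; apply.
  - by move=> t; apply: cvgN; exact: uc.
  - by move=> t t0; apply: rderN; exact: ud.
  - exact: cvgN.
  - exact: cvgN.
have g0 : - grad alpha Ainf a = 0.
  apply/matrixP => i j; rewrite [RHS]mxE.
  have [h1 h2] := gl i j; have [k1 k2] := A_lim i j.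
  apply: C_eq.
    apply: (z (fun t => Re (A t a i j)) (fun t => Re ((- grad alpha (A t) a) i j)) _ _ _ _ k1 h1).
      by move=> t; have [] := A_cont t i j.
    by move=> t t0; have [] := A_der t0 i j.
  apply: (z (fun t => Im (A t a i j)) (fun t => Im ((- grad alpha (A t) a) i j)) _ _ _ _ k2 h2).
    by move=> t; have [] := A_cont t i j.
  by move=> t t0; have [] := A_der t0 i j.
move/eqP: g0; rewrite oppr_eq0 /grad scaler_eq0 => /orP[/eqP|]; last first.
  by rewrite subr_eq0 => /eqP.
by move=> /(congr1 Re) /= /eqP; rewrite oppr_eq0 pnatr_eq0.
Qed.

Lemma H_bounded l : exists K, forall t, entry_le (2%:C *: H t l) K.
Proof.
apply: (@mx_bounded _ _ _ (fun t => 2%:C *: H t l) (2%:C *: hmom alpha Ainf l)).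
- by move=> t; apply: mcvgZ; [exact: ccvg_cst | exact: H_cont].
- by move=> t t0; rewrite (A_le0 t0) (A_le0 (lexx 0)).
- by apply: mcvgZ; [exact: ccvg_cst | exact: H_lim].
Qed.

(** The gauge transformations g' = 2 H g integrate the infinitesimal action
    along the flow. The defect A g - g A0 solves the linear equation
    D' = 2 H D with D 0 = 0, and therefore vanishes. *)
Lemma transport : exists g : forall l, R -> 'M[C]_(v l), [/\
  forall l t, mcvg (nbhs t) (g l) (g l t),
  forall l t, 0 < t -> mder (g l) t (2%:C *: H t l *m g l t),
  forall l t (x : 'cV_(v l)), 0 <= t -> g l t *m x = 0 -> x = 0
& forall t a, 0 <= t -> A t a *m g (src a) t = g (tgt a) t *m A0 a].
Proof.
have B_cont l t : mcvg (nbhs t) (fun s => 2%:C *: H s l) (2%:C *: H t l).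
  by apply: mcvgZ; [exact: ccvg_cst | exact: H_cont].
have /dep_choice [g gP] : forall l, exists g : R -> 'M[C]_(v l),
    [/\ forall t, mcvg (nbhs t) g (g t), forall t, t <= 0 -> g t = 1%:M & forall t, 0 < t -> mder g t (2%:C *: H t l *m g t)].
  move=> l; have [K KP] := H_bounded l.
  exact: linear_ode_mx (B_cont l) KP.
have gc l : forall t, mcvg (nbhs t) (g l) (g l t) by have [] := gP l.
have g1 l : g l 0 = 1%:M by have [_ h _] := gP l; apply: h.
have gd l : forall t, 0 < t -> mder (g l) t (2%:C *: H t l *m g l t) by have [] := gP l.
exists g; split=> //.
- move=> l t x t0 gx; have [K KP] := H_bounded l.
  have Xc s : mcvg (nbhs s) (fun s => g l s *m x) (g l s *m x).
    by apply: mcvgM => //; exact: mcvg_cst.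
  have Xd s : 0 < s -> mder (fun s => g l s *m x) s (2%:C *: H s l *m (g l s *m x)).
    move=> s0; apply: (mder_eq (mderM (gd l s s0) (mder_cst s x))).
    by rewrite mulmx0 addr0 mulmxA.
  have [c /(_ t t0) [_]] := linear_growth KP Xc Xd.
  rewrite gx [nsq 0]rip0r mul0r g1 mul1mx => h.
  by apply: nsq_eq0; apply/eqP; rewrite eq_le h nsq_ge0.
- move=> t a t0; have [K KP] := H_bounded (tgt a).
  pose D s := A s a *m g (src a) s - g (tgt a) s *m A0 a.
  have Dc s : mcvg (nbhs s) D (D s).
    apply: mcvgD; last apply: mcvgN; apply: mcvgM => //; exact: mcvg_cst.
  have Dd s : 0 < s -> mder D s (2%:C *: H s (tgt a) *m D s).
    move=> s0; have h := mderB (mderM (A_der (a := a) s0) (gd (src a) s s0))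
      (mderM (gd (tgt a) s s0) (mder_cst s (A0 a))).
    apply: (@mder_eq _ _ _ D _ _ _ h).
    rewrite mulmx0 addr0 /D mulmxBr mulmxA; congr (_ - _); last by rewrite mulmxA.
    rewrite /grad rmorphN scaleNr opprK scalerBr mulmxBl -!scalemxAl -!scalemxAr -!scalemxAl.
    by rewrite mulmxA subrK.
  have D0 : D 0 = 0.
    by rewrite /D (A_le0 (lexx 0)) !g1 mulmx1 mul1mx subrr.
  have [c /(_ t t0) [+ _]] := linear_growth KP Dc Dd.
  rewrite D0 [nsq 0]rip0r mul0r => h.
  apply/eqP; rewrite -subr_eq0; apply/eqP; apply: nsq_eq0; apply/eqP.
  by rewrite eq_le h nsq_ge0.
Qed.

End Flow.

(** * The isomorphism type of the limit *)

Section SlowSubrepresentation.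
Variables (R : realType) (Q : quiver) (v : vertex Q -> nat) (alpha : vertex Q -> R[i]).
Local Notation C := R[i].
Variables (A0 Ainf : Rep R v) (A : R -> Rep R v).
Hypothesis A_le0 : forall t, t <= 0 -> A t = A0.
Hypothesis A_cont : forall t a, mcvg (nbhs t) (fun s => A s a) (A t a).
Hypothesis A_lim : forall a, mcvg +oo (fun s => A s a) (Ainf a).
Variable g : forall l, R -> 'M[C]_(v l).
Hypothesis g_cont : forall l t, mcvg (nbhs t) (g l) (g l t).
Hypothesis g_der : forall l t, 0 < t -> mder (g l) t (2%:C *: hmom alpha (A t) l *m g l t).
Hypothesis g_inj : forall l t (x : 'cV_(v l)), 0 <= t -> g l t *m x = 0 -> x = 0.
Hypothesis gA : forall t a, 0 <= t -> A t a *m g (src a) t = g (tgt a) t *m A0 a.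

Lemma nsq_mul_bound m n (B : 'M[C]_(m, n)) K (z : 'cV[C]_n) :
  entry_le (adj B *m B) K -> nsq (B *m z) <= K * (n%:R * nsq z + n%:R * nsq z).
Proof.
move=> BK; rewrite /nsq rip_adj ripC mulmxA; apply: le_trans (ler_norm _) _.
exact: quad_bound.
Qed.

(** The vectors x for which exp (k t) g x stays bounded form a subrepresentation,
    because A is bounded along the flow and A g = g A0. The dichotomy gives its
    dimension at each vertex. *)
Lemma slow_subrepr (lam dlt : R) (N : mxfamily R v) : 0 < dlt ->
  dominated alpha Ainf lam (fun=> 1%:M) N dlt ->
  exists W : subfamily (qrep_of A0), is_subrepr W /\
    forall l, \dim (W l) = \dim (fixsp (N l)).
Proof.
move=> d0 [Nr _ slow fast]; have [No NA] := Nr.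
pose k := 2 * (lam - dlt / 2).
pose Y l t := (expR (k * t))%:C *: g l t.
have ec t : cder (fun s => (expR (k * s))%:C) t ((k * expR (k * t))%:C).
  by split; [exact: rder_exp | exact: rder_cst].
have Yc l t : mcvg (nbhs t) (Y l) (Y l t).
  apply: mcvgZ; last exact: g_cont.
  by have [h1 h2] := ec t; split; [exact: rder_cont h1 | exact: rder_cont h2].
have Yd l t : 0 < t -> mder (Y l) t ((2%:C *: hmom alpha (A t) l + k%:C%:M) *m Y l t).
  move=> t0; have h := mderZ (ec t) (g_der (l := l) t0).
  apply: (@mder_eq _ _ _ (Y l) _ _ _ h).
  rewrite /Y mulmxDl mul_scalar_mx scalerA -rmorphM addrC; congr (_ + _).
  by rewrite -scalemxAr.
have Yi l t (x : 'cV_(v l)) : 0 <= t -> Y l t *m x = 0 -> x = 0.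
  move=> t0; rewrite /Y -scalemxAl => /eqP; rewrite scaler_eq0 => /orP[|/eqP /g_inj -> //].
  by move=> /eqP /(congr1 Re) /= /eqP; rewrite gt_eqF // expR_gt0.
have Hl l : mcvg +oo (fun t => hmom alpha (A t) l) (hmom alpha Ainf l).
  by apply: mcvg_hmom => a; apply: A_lim.
have /dep_choice [W WP] : forall l, exists W : {vspace 'cV[C]_(v l)},
   \dim W = \dim (fixsp (N l)) /\
   forall x, x \in W <-> exists K T, forall t, T <= t -> nsq (Y l t *m x) <= K.
  move=> l; exact: (dichotomy d0 (No l) (reducing_hmom alpha Nr l)
    (slow l) (fast l) (Hl l) (Yc l) (Yd l) (Yi l)).
exists W; split; last by move=> l; have [] := WP l.
move=> a; apply/subvP => _ /memv_imgP [x xW ->]; rewrite arrowE.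
have [_ WPs] := WP (src a); have [_ WPt] := WP (tgt a).
have /WPs [K [T KP]] := xW; apply/WPt.
have [L LP] : exists L, forall t, entry_le (adj (A t a) *m A t a) L.
  apply: (@mx_bounded _ _ _ (fun t => adj (A t a) *m A t a) (adj (Ainf a) *m Ainf a)).
  - by move=> t; apply: mcvgM => //; apply: mcvg_adj.
  - by move=> t t0; rewrite (A_le0 t0) (A_le0 (lexx 0)).
  - by apply: mcvgM => //; apply: mcvg_adj.
exists (`|L| * ((v (src a))%:R * K + (v (src a))%:R * K)), (Num.max T 0) => t.
rewrite ge_max => /andP[Tt t0].
have -> : Y (tgt a) t *m (A0 a *m x) = A t a *m (Y (src a) t *m x).
  by rewrite /Y -!scalemxAl -scalemxAr mulmxA -gA // -mulmxA.
apply: le_trans (nsq_mul_bound _ (LP t)) _.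
have b0 : 0 <= (v (src a))%:R * nsq (Y (src a) t *m x).
  by rewrite mulr_ge0 ?nsq_ge0.
apply: (@le_trans _ _ (`|L| * ((v (src a))%:R * nsq (Y (src a) t *m x) +
   (v (src a))%:R * nsq (Y (src a) t *m x)))).
  by apply: ler_wpM2r; [exact: addr_ge0 | exact: ler_norm].
by apply: ler_wpM2l => //; apply: lerD; apply: ler_wpM2l => //; exact: KP.
Qed.

Lemma transport_iso t : 0 <= t -> isomorphic (qrep_of A0) (qrep_of (A t)).
Proof.
move=> t0; apply: (@inj_surj_iso _ _ _ _ (mxfam (fun l => g l t) A0 (A t))).
- by apply: mxfam_hom => a; rewrite gA.
- by apply: injfam0 => l x; rewrite mxfamE; apply: g_inj.
- move=> l y; have := gram_unit (fun x => @g_inj l t x t0).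
  rewrite unitmx_mul => /andP[_ gu].
  by exists (invmx (g l t) *m y); rewrite mxfamE mulmxA mulmxV // mul1mx.
Qed.

End SlowSubrepresentation.

Lemma subr_full_iso (K : fieldType) (Q : quiver) (M : qrep K Q) (U : subfamily M) :
  is_subrepr U -> (forall l, U l = fullv) -> isomorphic (subr U) M.
Proof.
move=> Us Uf; have [ih _ ii _ _] := sub_exact Us.
apply: (inj_surj_iso ih ii) => l y.
exists (vsproj (U l) y : rspace (subr U) l); rewrite sinclE vsprojK // Uf; exact: memvf.
Qed.

(** The flow in the form used above: defined on the whole line, and with the
    gradient made explicit. *)
Lemma flow_clip (R : realType) (Q : quiver) (v : vertex Q -> nat)
    (alpha : vertex Q -> R[i]) (A0 Ainf : Rep R v) :
  (forall l, Re (alpha l) = 0) -> is_flow_limit (energy alpha) A0 Ainf ->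
  exists A : R -> Rep R v, [/\ forall t, t <= 0 -> A t = A0,
    forall t a, mcvg (nbhs t) (fun s => A s a) (A t a),
    forall t a, 0 < t -> mder (fun s => A s a) t (- grad alpha (A t) a)
  & forall a, mcvg +oo (fun s => A s a) (Ainf a)].
Proof.
move=> alpha_imag [A [A00 A0c Ad] Al].
have der t a : 0 < t -> mder (fun s => A s a) t (- grad alpha (A t) a).
  move=> t0; have [X gX dX] := Ad t t0 => i j.
  by have := dX a i j; rewrite -(is_gradientE alpha_imag gX a).
exists (fun t => A (Num.max t 0)); split.
- by move=> t t0; rewrite max_r.
- move=> t a i j; have [h1 h2] := A0c a i j; split.
    apply: (@continuous_clip _ (fun s => Re (A s a i j))); last by rewrite A00.
    by move=> s s0; have [k _] := der s a s0 i j; exact: rder_cont k.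
  apply: (@continuous_clip _ (fun s => Im (A s a i j))); last by rewrite A00.
  by move=> s s0; have [_ k] := der s a s0 i j; exact: rder_cont k.
- move=> t a t0; have h : \forall s \near t, A s a = A (Num.max s 0) a.
    by near=> s; rewrite max_l //; apply: ltW; near: s; exact: lt_nbhsr.
  rewrite (max_l (ltW t0)) => i j; have [k1 k2] := der t a t0 i j.
  by split; [apply: rder_near k1 | apply: rder_near k2]; apply: filterS h => s ->.
- move=> a i j; have [h1 h2] := Al a i j.
  have h : \forall s \near +oo, A s a = A (Num.max s 0) a.
    near=> s; rewrite max_l //; near: s; exists 0; split=> [|s /ltW //]; exact: num_real.
  split; [apply: cvg_trans h1 | apply: cvg_trans h2]; apply: near_eq_cvg;
    by apply: filterS h => s ->.
Unshelve. all: by end_near. Qed.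

Theorem theorem1p3 (R : realType) (Q : quiver) (v : vertex Q -> nat)
    (alpha : vertex Q -> R[i])
    (alpha_imag : forall l, complex.Re (alpha l) = 0)
    (alpha_v : \sum_l alpha l * (v l)%:R = 0)
    (A0 Ainf : Rep R v)
    (Ainf_lim : is_flow_limit (energy alpha) A0 Ainf)
    (H : HNJH alpha (qrep_of A0)) :
  isomorphic (qrep_of Ainf) (graded H).
Proof.
have [s [-> Fs ss sd]] := HNJH_filtered alpha_imag H.
have [A [A_le0 A_cont A_der A_lim]] := flow_clip alpha_imag Ainf_lim.
have crit := limit_critical A_cont A_der A_lim.
have [g [g_cont g_der g_inj gA]] := transport A_le0 A_cont A_der A_lim.
(* Ainf itself is the image of the projection 1. *)
pose one : mxfamily R v := fun l => 1%:M.
have one_r : reducing Ainf one.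
  by split=> [l|a]; [split; rewrite ?hadj1 ?mul1mx | rewrite mul1mx mulmx1].
have [e [es eiso eN]] := decompose alpha_imag crit one_r (leqnn (rk one)).
have Ae : isomorphic (qrep_of Ainf) (dsum e).
  apply: iso_trans eiso; apply: iso_sym; apply: subr_full_iso.
    by apply: imfam_subrepr => a; rewrite mul1mx mulmx1.
  by move=> l; apply/vspaceP => x; rewrite memvf; apply/fixspP; rewrite mul1mx.
apply: (iso_trans Ae).
have [G [GP Ginf Gbd]] := @ultra_limits R R +oo _.
apply: (degenerates_graded Gbd alpha_imag Fs ss sd es) => [lam|].
  (* The part of Ainf of slope at least lam has the dimension vector of a
     subrepresentation of A0. *)
  have [N [dlt [d0 dom ->]]] := eN lam.
  have [W [Ws Wd]] := slow_subrepr A_le0 A_cont A_lim g_cont g_der g_inj gA d0 dom.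
  have <- : excess alpha lam (subdim W) = excess alpha lam (fun l => \dim (fixsp (N l))).
    by apply: excess_eq => l; exact: Wd.
  exact: filtered_excess Fs ss Ws.
exists v, A, Ainf; split=> //.
- have h : G [set t | 0 <= t] by apply: Ginf; exists 0; split=> [|t /ltW //]; exact: num_real.
  by apply: filterS h => t t0; apply: transport_iso gA t t0.
- move=> a i j; have [h1 h2] := A_lim a i j.
  by split; [apply: cvg_trans h1 | apply: cvg_trans h2]; apply: cvg_app.
Qed.
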